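(* For every $1<p<\infty$, $\eta>-1$, and nonzero separable Hilbert space $\mathcal K$ (which may be infinite-dimensional), there is a weight $W$ on $\mathcal H=\mathcal K\oplus\mathcal K$, satisfying the standing assumptions, with the following properties. The weight is noncommuting and is not uniformly scalar-comparable. The projection $P_\eta$ is bounded on $L^p(W)$. There are no $\varepsilon>0$ and $R<\infty$ such that \[ \left(\frac1{\mu_\eta(S)}\int_S\|W^{1/p}e\|^{p+\varepsilon}\,d\mu_\eta\right)^{1/(p+\varepsilon)}\le R\left(\frac1{\mu_\eta(S)}\int_S\|W^{1/p}e\|^p\,d\mu_\eta\right)^{1/p} \] for all Carleson squares $S$ and all $e\in\mathcal H$.
   Context: Measure. $\mathbb D$ is the open unit disc, $dA$ is area measure normalized so that $A(\mathbb D)=1$, and $d\mu_\eta(z)=(\eta+1)(1-|z|^2)^\eta\,dA(z)$. Put $p'=p/(p-1)$. Standing assumptions on a weight $W$ on a nonzero separable complex Hilbert space $\mathcal H$: for almost every $z\in\mathbb D$, $W(z)$ is a positive, boundedly invertible bounded operator on $\mathcal H$; $z\mapsto W(z)e$ is strongly measurable for every $e\in\mathcal H$; and for every $e\in\mathcal H$, $\int_{\mathbb D}\|W^{1/p}e\|^p\,d\mu_\eta<\infty$ and $\int_{\mathbb D}\|W^{-1/p}e\|^{p'}\,d\mu_\eta<\infty$. $L^p(W)$ is the space of (a.e. classes of) strongly measurable $f:\mathbb D\to\mathcal H$ with $\|f\|_{L^p(W)}^p=\int_{\mathbb D}\|W(z)^{1/p}f(z)\|^p\,d\mu_\eta(z)<\infty$.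 Terminology. ''Noncommuting'' means that it is not the case that $W(z)W(\zeta)=W(\zeta)W(z)$ for almost every pair $(z,\zeta)$. ''Not uniformly scalar-comparable'' means that there are no positive measurable scalar function $w$ on $\mathbb D$ and constants $c,C_0>0$ with $c\,w(z)I\le W(z)\le C_0\,w(z)I$ for almost every $z\in\mathbb D$. Carleson squares. Arc length on $\partial\mathbb D$ is normalized so that $|\partial\mathbb D|=1$. For an arc $I\subset\partial\mathbb D$ with $0<|I|\le1$, $S(I)=\{re^{it}:e^{it}\in I,\ 1-|I|<r<1\}$; $S(\partial\mathbb D)=\mathbb D$ (up to a null set) is included. Bergman projection. $P_\eta f(z)=\int_{\mathbb D}\frac{f(\zeta)}{(1-\overline\zeta z)^{\eta+2}}\,d\mu_\eta(\zeta)$, where the power is the analytic branch equal to $1$ at $z=0$, defined as a Bochner integral on the dense subspace $\{W^{-1/p}F: F\text{ a bounded, compactly supported, finite-valued simple }\mathcal H\text{-valued function}\}$ of $L^p(W)$. Boundedness on $L^p(W)$ means that this map extends to a bounded operator on $L^p(W)$. *)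

(* Defs.v *)
From HB Require Import structures.
From mathcomp Require Import all_boot all_order all_algebra.
From mathcomp Require Import sesquilinear complex.
From mathcomp Require Import all_classical all_reals all_analysis.
From mathcomp Require Import measurable_realfun.

Set Implicit Arguments.
Unset Strict Implicit.
Unset Printing Implicit Defensive.

Import Order.TTheory GRing.Theory Num.Theory.
Import numFieldNormedType.Exports.

Local Open Scope classical_set_scope.
Local Open Scope ring_scope.
Local Open Scope complex_scope.

(* A form in [{dot H for Num.conj}] is linear in its first argument and
   conjugate-linear in the second one. *)
Definition dot_norm (R : realType) (H : lmodType R[i])
    (dot : {dot H for Num.conj}) (x : H) : R :=
  Num.sqrt (complex.Re (dot x x)).

Record hilbertType (R : realType) := Hilbert {
  hilbert_sort :> lmodType R[i];
  hdot : {dot hilbert_sort for Num.conj};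
  hilbert_complete : forall u : nat -> hilbert_sort,
    (forall e : R, 0 < e -> exists N : nat, forall m n : nat,
      (N <= m)%N -> (N <= n)%N -> dot_norm hdot (u m - u n) < e) ->
    exists l : hilbert_sort, dot_norm hdot (u n - l) @[n --> \oo] --> (0 : R)
}.

Definition hnorm (R : realType) (H : hilbertType R) (x : H) : R :=
  dot_norm (hdot H) x.

Definition separable (R : realType) (H : hilbertType R) :=
  exists u : nat -> H, forall (x : H) (e : R), 0 < e ->
    exists n, hnorm (x - u n) < e.

Section direct_sum.
Context (R : realType) (K : hilbertType R).

Definition dsum_dot (x y : K * K) : R[i] := hdot K x.1 y.1 + hdot K x.2 y.2.

Let dsum_zmodl y : zmod_morphism (dsum_dot ^~ y).
Proof. by move=> a b; rewrite /dsum_dot !linearBl opprD addrACA. Qed.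

Let dsum_zmodr x : zmod_morphism (dsum_dot x).
Proof. by move=> a b; rewrite /dsum_dot !raddfB/= opprD addrACA. Qed.

Let dsum_scall y : scalable_for *%R (dsum_dot ^~ y).
Proof. by move=> a b; rewrite /dsum_dot !linearZl mulrDr. Qed.

Let dsum_scalr x : scalable_for (Num.conj \; *%R) (dsum_dot x).
Proof. by move=> a b; rewrite /dsum_dot !linearZr_LR/= mulrDr. Qed.

HB.instance Definition _ := @isBilinear.Build R[i] (K * K)%type (K * K)%type
  R[i] *%R (Num.conj \; *%R) dsum_dot dsum_zmodl dsum_zmodr dsum_scall
  dsum_scalr.

Let dsum_hermitian x y : dsum_dot x y = (-1) ^+ false * Num.conj (dsum_dot y x).
Proof.
rewrite /dsum_dot expr0 mul1r rmorphD/=.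
by rewrite (hermC (hdot K) x.1) (hermC (hdot K) x.2) expr0 !mul1r.
Qed.

HB.instance Definition _ := @isHermitianSesquilinear.Build R[i] (K * K)%type
  false Num.conj dsum_dot dsum_hermitian.

Let dsum_gt0 x : x != 0 -> 0 < dsum_dot x x.
Proof.
case: x => x y xy0; rewrite /dsum_dot/=.
have [x0|x0] := eqVneq x 0; last by rewrite ltr_wpDr ?dnorm_ge0 ?dnorm_gt0.
rewrite ltr_wpDl ?dnorm_ge0// dnorm_gt0.
by apply: contraNneq xy0 => y0; rewrite x0 y0.
Qed.

HB.instance Definition _ := @isDotProduct.Build R[i] (K * K)%type
  dsum_dot dsum_gt0.

Let dsum_re_ge0 (x : K) : 0 <= complex.Re (hdot K x x).
Proof. by have := dnorm_ge0 (hdot K) x; rewrite lecE => /andP[]. Qed.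

Let dsum_norm (x : K * K) :
  dot_norm dsum_dot x = Num.sqrt (hnorm x.1 ^+ 2 + hnorm x.2 ^+ 2).
Proof.
rewrite /hnorm /dot_norm !sqr_sqrtr ?dsum_re_ge0//.
by rewrite /dsum_dot raddfD.
Qed.

Let dsum_complete (u : nat -> K * K) :
  (forall e : R, 0 < e -> exists N : nat, forall m n : nat,
    (N <= m)%N -> (N <= n)%N -> dot_norm dsum_dot (u m - u n) < e) ->
  exists l : K * K, dot_norm dsum_dot (u n - l) @[n --> \oo] --> (0 : R).
Proof.
move=> cu.
have h0 (x : K) : 0 <= hnorm x by exact: sqrtr_ge0.
have le1 x : hnorm x.1 <= dot_norm dsum_dot x.
  rewrite dsum_norm -[leLHS]ger0_norm// -sqrtr_sqr ler_sqrt.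
    by rewrite lerDl sqr_ge0.
  by rewrite addr_ge0 ?sqr_ge0.
have le2 x : hnorm x.2 <= dot_norm dsum_dot x.
  rewrite dsum_norm -[leLHS]ger0_norm// -sqrtr_sqr ler_sqrt.
    by rewrite lerDr sqr_ge0.
  by rewrite addr_ge0 ?sqr_ge0.
have [|l1 ul1] := @hilbert_complete R K (fun n => (u n).1).
  move=> e /cu[N uN]; exists N => m n Nm Nn.
  by apply: le_lt_trans (uN _ _ Nm Nn); exact: (le1 (u m - u n)).
have [|l2 ul2] := @hilbert_complete R K (fun n => (u n).2).
  move=> e /cu[N uN]; exists N => m n Nm Nn.
  by apply: le_lt_trans (uN _ _ Nm Nn); exact: (le2 (u m - u n)).
exists (l1, l2).
have -> : (fun n => dot_norm dsum_dot (u n - (l1, l2))) =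
    (fun n => Num.sqrt (hnorm ((u n).1 - l1) ^+ 2 + hnorm ((u n).2 - l2) ^+ 2)).
  by apply/funext => n; rewrite dsum_norm.
rewrite -[X in _ --> X](_ : Num.sqrt (0 ^+ 2 + 0 ^+ 2) = 0); last first.
  by rewrite expr0n/= addr0 sqrtr0.
apply: continuous_cvg; first exact: sqrt_continuous.
by apply: cvgD; rewrite expr2; under eq_fun do rewrite expr2; exact: cvgM.
Qed.

Definition dsum : hilbertType R :=
  @Hilbert R (K * K)%type dsum_dot dsum_complete.

End direct_sum.

Section operators.
Context (R : realType) (H : hilbertType R).
Implicit Types A B : H -> H.

Definition bounded_op A :=
  linear A /\ exists C : R, forall x, hnorm (A x) <= C * hnorm x.

Definition boundedly_invertible A :=
  exists B, [/\ bounded_op B, cancel A B & cancel B A].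

(* [0 <= c] for [c : R[i]] means that [c] is real and nonnegative. *)
Definition positive_op A := forall x, 0 <= hdot H (A x) x.

Definition spectrum A : set R[i] :=
  [set c | ~ boundedly_invertible (fun x => A x - c *: x)].

Definition op_horner A (q : {poly R}) (x : H) : H :=
  \sum_(k < size q) (q`_k)%:C *: iter k A x.

(* The continuous functional calculus for an operator with real spectrum:
   [f(A)] is the norm limit of [q(A)] along polynomials [q] converging to [f]
   uniformly on the spectrum of [A]. *)
Definition is_funcalc (f : R -> R) A B :=
  forall e : R, 0 < e -> exists q : {poly R},
    (forall t : R, spectrum A t%:C -> `|q.[t] - f t| <= e) /\
    (forall x, hnorm (op_horner A q x - B x) <= e * hnorm x).

(* The operator [A ^ s]; meaningful when [A] is bounded, positive and boundedly
   invertible, in which case it exists and is unique. *)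
Definition op_pow A (s : R) : H -> H :=
  xget (fun=> 0) [set B | is_funcalc (fun t => t `^ s) A B].

End operators.

Section bochner.
Context d (T : measurableType d) (R : realType) (H : hilbertType R).
Implicit Types (mu : {measure set T -> \bar R}) (s f : T -> H).

Definition simple_fun s :=
  finite_set (range s) /\ forall v, measurable (s @^-1` [set v]).

Definition strongly_measurable mu f := exists s : nat -> T -> H,
  (forall n, simple_fun (s n)) /\
  {ae mu, forall z, hnorm (f z - s n z) @[n --> \oo] --> (0 : R)}.

Definition simple_integrable mu s :=
  simple_fun s /\ forall v, v != 0 -> (mu (s @^-1` [set v]) < +oo)%E.

Definition simple_integral mu s : H :=
  \sum_(v \in range s) (fine (mu (s @^-1` [set v])))%:C *: v.

Definition is_bochner mu f (v : H) :=
  strongly_measurable mu f /\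
  exists s : nat -> T -> H,
    [/\ forall n, simple_integrable mu (s n),
        (\int[mu]_z (hnorm (f z - s n z))%:E)%E @[n --> \oo] --> 0%E &
        hnorm (simple_integral mu (s n) - v) @[n --> \oo] --> (0 : R)].

End bochner.

(* The point x + iy of the complex plane is represented by the pair (x, y). *)
Notation plane R := (measurableTypeR R * measurableTypeR R)%type.

Section disc.
Context (R : realType).

Definition plane_lebesgue : {measure set (plane R) -> \bar R} :=
  (@lebesgue_measure R \x @lebesgue_measure R)%E.

Definition toC (z : plane R) : R[i] := Complex (z.1 : R) (z.2 : R).

Definition absq (z : plane R) : R := (z.1 : R) ^+ 2 + (z.2 : R) ^+ 2.

Definition disc : set (plane R) := [set z | absq z < 1].

(* The factor [pi^-1] normalizes area measure. *)
Definition bergman_density (eta : R) (z : plane R) : R :=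
  (eta + 1) * (1 - absq z) `^ eta * pi^-1.

Definition mu_eta (eta : R) (heta : -1 < eta) (A : set (plane R)) : \bar R :=
  (\int[plane_lebesgue]_(z in A `&` disc) (bergman_density eta z)%:E)%E.

Lemma measurable_absq : measurable_fun setT absq.
Proof. by apply: measurable_funD; apply: measurable_funX. Qed.

Lemma measurable_disc : measurable disc.
Proof.
rewrite [disc](_ : _ = absq @^-1` `]-oo, 1[%classic); last first.
  by apply/seteqP; split => z /=; rewrite in_itv.
by rewrite -[X in measurable X]setTI; exact: measurable_absq.
Qed.

Lemma measurable_bergman_density eta : measurable_fun setT (bergman_density eta).
Proof.
apply: measurable_funM => //; apply: measurable_funM => //.
apply: (measurableT_comp (measurable_powR eta)).
by apply: measurable_funB => //; exact: measurable_absq.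
Qed.

Section mu_eta_measure.
Context (eta : R) (heta : -1 < eta).
Local Notation mu := (mu_eta heta).

Lemma bergman_density_ge0 z : 0 <= bergman_density eta z.
Proof.
by rewrite !mulr_ge0 ?powR_ge0 ?invr_ge0 ?pi_ge0// -lerBlDr sub0r ltW.
Qed.

Let mu0 : mu set0 = 0%E.
Proof. by rewrite /mu_eta set0I integral_set0. Qed.

Let mu_ge0 A : (0 <= mu A)%E.
Proof. by apply: integral_ge0 => z _; rewrite lee_fin bergman_density_ge0. Qed.

Let mu_sigma_additive : semi_sigma_additive mu.
Proof.
move=> F mF tF mUF; rewrite /mu_eta setI_bigcupl.
rewrite ge0_integral_bigcup//=.
- apply: is_cvg_ereal_nneg_natsum_cond => n _ _.
  by apply: integral_ge0 => z _; rewrite lee_fin bergman_density_ge0.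
- by move=> n; apply: measurableI => //; exact: measurable_disc.
- by apply: measurable_funTS; apply/measurable_EFinP;
    exact: measurable_bergman_density.
- by move=> z _; rewrite lee_fin bergman_density_ge0.
- by apply: trivIset_setIr.
Qed.

HB.instance Definition _ := isMeasure.Build _ _ _ mu
  mu0 mu_ge0 mu_sigma_additive.

End mu_eta_measure.

(* The branch of [w ^ s] on the right half-plane that equals 1 at w = 1;
   [atan (y / x)] is the argument of x + iy when x > 0. *)
Definition cpow (w : R[i]) (s : R) : R[i] :=
  let a := atan (complex.Im w / complex.Re w) in
  (Num.sqrt (complex.Re w ^+ 2 + complex.Im w ^+ 2) `^ s)%:C *
  Complex (cos (s * a)) (sin (s * a)).

Definition bergman_kernel (eta : R) (z zeta : plane R) : R[i] :=
  (cpow (1 - Num.conj (toC zeta) * toC z) (eta + 2))^-1.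

(* The closed arc of normalized length [l] starting at [e^{ia}]. *)
Definition arc (a l : R) : set (plane R) :=
  [set (cos t, sin t) | t in `[a, a + 2 * pi * l]].

Definition carleson_square (a l : R) : set (plane R) :=
  [set z | exists r u, [/\ 1 - l < r < 1, arc a l u & z = (r * u.1, r * u.2)]].

End disc.

Section weights.
Context (R : realType) (p eta : R) (heta : -1 < eta) (H : hilbertType R).
Implicit Types (W : plane R -> H -> H) (f g F : plane R -> H).
Local Notation mu := (mu_eta heta).

Definition is_weight W :=
  [/\ {ae mu, forall z,
        [/\ bounded_op (W z), positive_op (W z) & boundedly_invertible (W z)]},
      forall e, strongly_measurable mu (fun z => W z e),
      forall e,
        (\int[mu]_z (hnorm (op_pow (W z) p^-1 e) `^ p)%:E < +oo)%E &
      forall e,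
        (\int[mu]_z (hnorm (op_pow (W z) (- p^-1) e) `^ (p / (p - 1)))%:E
          < +oo)%E].

Definition commuting W :=
  {ae (@plane_lebesgue R \x @plane_lebesgue R)%E, forall zz,
    disc zz.1 -> disc zz.2 -> forall x, W zz.1 (W zz.2 x) = W zz.2 (W zz.1 x)}.

Definition scalar_comparable W := exists (w : plane R -> R) (c C0 : R),
  [/\ measurable_fun (@disc R) w, forall z, disc z -> 0 < w z, 0 < c, 0 < C0 &
      {ae mu, forall z, forall x,
        (c * w z)%:C * hdot H x x <= hdot H (W z x) x
          <= (C0 * w z)%:C * hdot H x x}].

Definition Lp_norm W f : \bar R :=
  ((\int[mu]_z (hnorm (op_pow (W z) p^-1 (f z)) `^ p)%:E) `^ p^-1)%E.

Definition in_Lp W f := strongly_measurable mu f /\ (Lp_norm W f < +oo)%E.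

(* A function with finite range is bounded. *)
Definition test_fun F := simple_fun F /\
  exists2 r : R, r < 1 & forall z, F z != 0 -> absq z <= r.

Definition is_bergman_projection f g := forall z, disc z ->
  is_bochner mu (fun zeta => bergman_kernel eta z zeta *: f zeta) (g z).

Definition bergman_bounded W := exists T : (plane R -> H) -> (plane R -> H),
  [/\ forall f g (a : R[i]), in_Lp W f -> in_Lp W g ->
        {ae mu, forall z,
          T (fun z => a *: f z + g z) z = a *: T f z + T g z},
      exists C : R, forall f, in_Lp W f ->
        in_Lp W (T f) /\ (Lp_norm W (T f) <= C%:E * Lp_norm W f)%E &
      forall F, test_fun F -> let f z := op_pow (W z) (- p^-1) (F z) in
        exists2 g, is_bergman_projection f g & {ae mu, forall z, T f z = g z}].

Definition power_mean W (S : set (plane R)) (e : H) (q : R) : \bar R :=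
  (((fine (mu S))^-1%:E *
    \int[mu]_(z in S) (hnorm (op_pow (W z) p^-1 e) `^ q)%:E) `^ q^-1)%E.

Definition reverse_holder W (eps C : R) :=
  forall (a l : R) (e : H), 0 < l <= 1 ->
    (power_mean W (carleson_square a l) e (p + eps)%R
      <= C%:E * power_mean W (carleson_square a l) e p)%E.

End weights.

(* Main.v *)
Require Import Defs.
From HB Require Import structures.
From mathcomp Require Import all_boot all_order all_algebra.
From mathcomp Require Import sesquilinear complex.
From mathcomp Require Import all_classical all_reals all_analysis.
From mathcomp Require Import measurable_realfun.
From mathcomp Require Import ring lra.
Import Order.TTheory GRing.Theory Num.Theory.
Import numFieldNormedType.Exports.
Local Open Scope classical_set_scope.
Local Open Scope ring_scope.
Local Open Scope complex_scope.

(* The weight has eigenvalues 1 and lambda >= 1. Off a sequence of disjoint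
   boxes E_n lying in a compact part of the disc it is the constant
   noncommuting partner x |-> x + 2 Q x, with Q the projection on the diagonal
   of K (+) K; on E_n it is diag(1, v_n), where v_n = 2^(n^2 + 1) and
   |E_n| v_n = 2^-(n + 2). Thus lambda is integrable, but no power of lambda
   with exponent > 1 is: the reverse Hoelder inequality fails on the Carleson
   square S(circle) for the vectors (0, e), and W is not scalar-comparable
   since v_n is unbounded.

   Since W >= I, L^p(W) embeds in L^p(mu) and in L^1(mu). Off the boxes
   boundedness of the projection is unweighted L^p boundedness, which follows
   from Schur's test with powers of 1 - |z|^2; on the boxes |P f| is at most a
   constant times the L^1 norm of f, and lambda is integrable.

   The estimate needed for Schur's test is proved without polar coordinates,
   by slicing the disc horizontally or vertically. The vector-valued integral
   of f is characterized by Re <v, e> = \int Re <f, e> for all e, which reduces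
   its linearity, norm estimate and measurability in a parameter to scalar
   integrals. *)

Set Implicit Arguments.
Unset Strict Implicit.
Unset Printing Implicit Defensive.

(** * Real inner product and norm *)

(** The construction separates the two places where trouble can arise. Near the circle, where the
    kernel is singular, the weight is bounded; where the weight is unbounded, the kernel is bounded,
    so only the total mass of the peaks enters. That mass fixes the products |E_n| v_n alone; a
    power 1 + delta multiplies them by v_n^delta, and heights with a quadratic exponent beat the
    geometric decay for every delta > 0. Keeping the eigenvalues above 1 makes the negative powers
    contractions, which settles the dual integrability.

    Two obstacles shape the formal argument. [op_pow] is specified by polynomial approximation on
    the spectrum, so the real spectrum of the two-valued operators has to be determined exactly;
    this uses nonzero vectors of K. Strong measurability holds only up to a null set and the
    sigma-algebra is not completed, so elements of the weighted space are replaced by weakly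
    measurable representatives, and integrals of possibly nonmeasurable nonnegative functions are
    compared by monotonicity. *)

Lemma Re_conj (R : realType) (z : R[i]) :
  complex.Re (Num.conj z) = complex.Re z.
Proof. by case: z. Qed.

(** The modulus as an element of [R]; the norm of [R[i]] takes its values in [R[i]]. *)
Definition cabs (R : realType) (z : R[i]) : R :=
  Num.sqrt (complex.Re z ^+ 2 + complex.Im z ^+ 2).

Lemma cabs_ge0 (R : realType) (z : R[i]) : 0 <= cabs z.
Proof. exact: sqrtr_ge0. Qed.

Lemma sqr_cabs (R : realType) (z : R[i]) :
  cabs z ^+ 2 = complex.Re z ^+ 2 + complex.Im z ^+ 2.
Proof. by rewrite sqr_sqrtr// addr_ge0// sqr_ge0. Qed.

Section hilbert.
Context (R : realType) (H : hilbertType R).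
Implicit Types (x y e : H) (a : R[i]) (t : R).

(** A real inner product with the same norm. Testing against both [e] and ['i *: e] recovers [hdot],
    so real-valued integrals suffice below. *)
Definition rdot x y : R := complex.Re (hdot H x y).

Lemma rdotDl x y e : rdot (x + y) e = rdot x e + rdot y e.
Proof. by rewrite /rdot linearDl raddfD. Qed.

Lemma rdotBl x y e : rdot (x - y) e = rdot x e - rdot y e.
Proof. by rewrite /rdot linearBl raddfB. Qed.

Lemma rdot0l e : rdot 0 e = 0.
Proof. by rewrite /rdot linear0l raddf0. Qed.

Lemma rdot_suml I (r : seq I) (F : I -> H) e :
  rdot (\sum_(i <- r) F i) e = \sum_(i <- r) rdot (F i) e.
Proof.
elim: r => [|i r ih]; first by rewrite !big_nil rdot0l.
by rewrite !big_cons rdotDl ih.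
Qed.

Lemma rdotC x y : rdot x y = rdot y x.
Proof.
rewrite /rdot (hermC (hdot H) x y) expr0 mul1r.
exact: Re_conj.
Qed.

Lemma rdotDr x y e : rdot e (x + y) = rdot e x + rdot e y.
Proof. by rewrite !(rdotC e) rdotDl. Qed.

Lemma rdotBr x y e : rdot e (x - y) = rdot e x - rdot e y.
Proof. by rewrite !(rdotC e) rdotBl. Qed.

(** By conjugate-linearity in the second argument [rdot x ('i *: e)] is the imaginary part of
    [hdot H x e], so this is the real part of a product of complex numbers. *)
Lemma rdotZ a x e :
  rdot (a *: x) e = complex.Re a * rdot x e - complex.Im a * rdot x ('i *: e).
Proof.
rewrite /rdot linearZl_LR linearZr_LR /=.
move: (hdot H x e : R[i]) => z; case: z => u v; case: a => a1 a2 /=.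
by rewrite !mul0r mulN1r opprK add0r.
Qed.

Lemma rdotZR t x e : rdot (t%:C *: x) e = t * rdot x e.
Proof. by rewrite rdotZ/= mul0r subr0. Qed.

Lemma rdotZRr t x e : rdot e (t%:C *: x) = t * rdot e x.
Proof. by rewrite rdotC rdotZR rdotC. Qed.

Lemma rdotxx_ge0 x : 0 <= rdot x x.
Proof. by have := dnorm_ge0 (hdot H) x; rewrite lecE => /andP[]. Qed.

Lemma hnorm_ge0 x : 0 <= hnorm x.
Proof. exact: sqrtr_ge0. Qed.

Lemma hnormE x : hnorm x ^+ 2 = rdot x x.
Proof. by rewrite sqr_sqrtr// rdotxx_ge0. Qed.

Lemma hdotxx x : hdot H x x = (hnorm x ^+ 2)%:C.
Proof.
rewrite hnormE /rdot; have := dnorm_ge0 (hdot H) x.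
by case: (hdot H x x) => u v; rewrite lecE/= => /andP[/eqP-> _].
Qed.

Lemma hnorm_eq0 x : hnorm x = 0 -> x = 0.
Proof.
move=> x0; apply/eqP; rewrite -(dnorm_eq0 (hdot H)).
by rewrite hdotxx x0 expr0n.
Qed.

Lemma hnorm0 : hnorm (0 : H) = 0.
Proof. by apply/eqP; rewrite -sqrf_eq0 hnormE rdot0l. Qed.

Lemma hnorm_gt0 x : x != 0 -> 0 < hnorm x.
Proof.
move=> x0; rewrite lt_neqAle hnorm_ge0 andbT eq_sym.
by apply: contra_neq x0 => /hnorm_eq0.
Qed.

Lemma rdot_ix x : rdot x ('i *: x) = 0.
Proof.
by rewrite /rdot linearZr_LR /= hdotxx /= !(mul0r, mulr0, subr0).
Qed.

Lemma hnormZ a x : hnorm (a *: x) = cabs a * hnorm x.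
Proof.
apply: (@pexpIrn _ 2); rewrite ?nnegrE ?mulr_ge0 ?cabs_ge0 ?hnorm_ge0//.
rewrite exprMn sqr_cabs !hnormE rdotZ scalerA.
rewrite (rdotC x (a *: x)) (rdotC x (_ *: x)) !rdotZ rdot_ix.
by case: a => a1 a2 /=; rewrite !expr2; ring.
Qed.

Lemma hnormZR t x : hnorm (t%:C *: x) = `|t| * hnorm x.
Proof. by rewrite hnormZ /cabs/= expr0n addr0 sqrtr_sqr. Qed.

Lemma rdotNl x e : rdot (- x) e = - rdot x e.
Proof. by rewrite -sub0r rdotBl rdot0l sub0r. Qed.

Lemma hnorm_opp x : hnorm (- x) = hnorm x.
Proof.
apply: (@pexpIrn _ 2); rewrite ?nnegrE ?hnorm_ge0//.
by rewrite !hnormE rdotNl rdotC rdotNl opprK.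
Qed.

Lemma hnormB_sqr x y :
  hnorm (x - y) ^+ 2 = hnorm x ^+ 2 - 2 * rdot x y + hnorm y ^+ 2.
Proof. by rewrite !hnormE rdotBl !rdotBr (rdotC y x); ring. Qed.

(** Cauchy-Schwarz, by expanding the squared norm of ||y|| x - ||x|| y and dividing by ||x||
    ||y||. *)
Lemma rdot_le x y : rdot x y <= hnorm x * hnorm y.
Proof.
have [->|x0] := eqVneq x 0; first by rewrite rdot0l hnorm0 mul0r.
have [->|y0] := eqVneq y 0; first by rewrite rdotC rdot0l hnorm0 mulr0.
have xy0 : 0 < hnorm x * hnorm y by rewrite mulr_gt0 ?hnorm_gt0.
have := sqr_ge0 (hnorm ((hnorm y)%:C *: x - (hnorm x)%:C *: y)).
rewrite hnormB_sqr !hnormZR !ger0_norm ?hnorm_ge0// rdotZR rdotZRr => h.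
rewrite -subr_ge0 -(pmulr_rge0 _ xy0).
by move: h; set u := hnorm x; set v := hnorm y; nra.
Qed.

Lemma rdot_abs x y : `|rdot x y| <= hnorm x * hnorm y.
Proof.
rewrite ler_norml rdot_le andbT lerNl -(hnorm_opp x).
by rewrite -rdotNl; exact: rdot_le.
Qed.

Lemma ler_hnormD x y : hnorm (x + y) <= hnorm x + hnorm y.
Proof.
rewrite -(@ler_pXn2r _ 2)// ?nnegrE ?addr_ge0 ?hnorm_ge0//.
rewrite hnormE rdotDl !rdotDr -!hnormE (rdotC y x).
have := rdot_le x y; set u := hnorm x; set v := hnorm y; nra.
Qed.

Lemma ler_hnormB x y : hnorm (x - y) <= hnorm x + hnorm y.
Proof. by rewrite -(hnorm_opp y); exact: ler_hnormD. Qed.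

Lemma rdot_inj x y : (forall e, rdot x e = rdot y e) -> x = y.
Proof.
move=> xy; apply/eqP; rewrite -subr_eq0; apply/eqP/hnorm_eq0.
by apply/eqP; rewrite -sqrf_eq0 hnormE rdotBl xy subrr.
Qed.

(** Starting the dense sequence at 0 makes the approximations built from it satisfy ||f - s_n|| <=
    ||f||, the domination needed for Bochner integrals. *)
Lemma separable_dense0 : separable H -> exists u : nat -> H,
  u 0%N = 0 /\ forall x (e : R), 0 < e -> exists n, hnorm (x - u n) < e.
Proof.
move=> [u hu]; exists (fun n => if n is m.+1 then u m else 0); split=> // x e e0.
by have [n un] := hu x e e0; exists n.+1.
Qed.

End hilbert.

(** * The orthogonal direct sum *)

Section dsum_lemmas.
Context (R : realType) (K : hilbertType R).

Lemma dsum_hnormE (x : dsum K) :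
  hnorm x ^+ 2 = hnorm x.1 ^+ 2 + hnorm x.2 ^+ 2.
Proof. by rewrite !hnormE /rdot/= /dsum_dot raddfD. Qed.

Lemma dsum_hnorm_le (x : dsum K) : hnorm x <= hnorm x.1 + hnorm x.2.
Proof.
rewrite -(@ler_pXn2r _ 2)// ?nnegrE ?addr_ge0 ?hnorm_ge0// dsum_hnormE.
by rewrite sqrrD lerD2r lerDl mulrn_wge0// mulr_ge0// hnorm_ge0.
Qed.

Lemma dsum_separable : separable K -> separable (dsum K).
Proof.
move=> [u hu].
exists (fun n => (u (odflt (0, 0)%N (unpickle n)).1,
                  u (odflt (0, 0)%N (unpickle n)).2)) => x e e0.
have e20 : 0 < e / 2 by rewrite divr_gt0.
have [n hn] := hu x.1 (e / 2) e20.
have [m hm] := hu x.2 (e / 2) e20.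
exists (pickle (n, m)); rewrite pickleK/=.
by apply: le_lt_trans (dsum_hnorm_le _) _; rewrite (splitr e); exact: ltrD.
Qed.

End dsum_lemmas.

(** * Weak measurability *)

Section nonneg_integral.
Context d (T : measurableType d) (R : realType).
Variable mu : {measure set T -> \bar R}.
Local Open Scope ereal_scope.

(* The integral of a nonnegative function is a supremum over the simple
   functions below it, so that monotonicity requires no measurability. *)
Lemma le_integral_nonmeasurable (f g : T -> \bar R) :
  (forall x, 0 <= f x) -> (forall x, f x <= g x) ->
  \int[mu]_x f x <= \int[mu]_x g x.
Proof.
move=> f0 fg; have g0 x : 0 <= g x by exact: le_trans (fg x).
rewrite !ge0_integralTE//; apply: ereal_sup_le => _ [h hf <-].
by exists h => // x; exact: le_trans (hf x) (fg x).
Qed.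

(** The null set is removed from the integral of [f], which uses its measurability; what is left is
    compared with [g] by monotonicity, valid for any nonnegative [g]. *)
Lemma ae_le_integral_nonmeasurable (N : set T) (f g : T -> \bar R) :
  measurable N -> mu N = 0 -> measurable_fun setT f ->
  (forall x, 0 <= f x) -> (forall x, 0 <= g x) ->
  (forall x, ~ N x -> f x <= g x) ->
  \int[mu]_x f x <= \int[mu]_x g x.
Proof.
move=> mN N0 mf f0 g0 fg.
rewrite (ge0_negligible_integral mN)//= setTD integral_mkcond.
apply: le_integral_nonmeasurable => x; rewrite patchE; case: ifPn => // /set_mem.
exact: fg.
Qed.

End nonneg_integral.

Section weak_measurability.
Context d (T : measurableType d) (R : realType) (H : hilbertType R).
Implicit Types (f g s : T -> H) (e v : H).

(** A condition at every point, without exceptional null set. [wmeas_strongly] and [strongly_wmeas]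
    relate it to strong measurability. *)
Definition wmeas f := forall e, measurable_fun [set: T] (fun z => rdot (f z) e).

Lemma simple_preimage s (B : set H) : simple_fun s -> measurable (s @^-1` B).
Proof.
move=> [fs ms].
rewrite (_ : s @^-1` B = \bigcup_(v in range s `&` B) (s @^-1` [set v])).
  apply: fin_bigcup_measurable; first exact: finite_setIl.
  by move=> v _; exact: ms.
apply/seteqP; split => [z Bz|z [v [_ Bv] /= ->]//].
by exists (s z) => //; split => //; exists z.
Qed.

Lemma wmeas_simple s : simple_fun s -> wmeas s.
Proof.
by move=> ss e _ B mB; rewrite setTI; exact: (simple_preimage [set v | B (rdot v e)]).
Qed.

Lemma simple_cst v : simple_fun (fun _ : T => v).
Proof.
split.
  by apply: (sub_finite_set _ (finite_set1 v)) => _ [_ _ <-].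
move=> w; have [->|vw] := eqVneq w v.
  by rewrite [X in measurable X](_ : _ = setT)//; apply/seteqP; split.
rewrite [X in measurable X](_ : _ = set0)//; apply/seteqP; split => //= z /= h.
by rewrite h eqxx in vw.
Qed.

Lemma simple_if (A : set T) s v : measurable A -> simple_fun s ->
  simple_fun (fun z => if z \in A then v else s z).
Proof.
move=> mA ss; split.
  apply: (@sub_finite_set _ _ (range s `|` [set v])); last first.
    by rewrite finite_setU; split => //; exact: ss.1.
  by move=> _ [z _ <-]; case: ifP => _; [right|left; exists z].
move=> w; rewrite [X in measurable X](_ : _ =
  (A `&` [set z | v = w]) `|` (~` A `&` s @^-1` [set w])); last first.
  apply/seteqP; split => z /=.
    by case: ifPn => [/set_mem Az ->|/negP Az <-]; [left|right; split => //;
      move=> /mem_set].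
  by move=> [[/mem_set -> //]|[nA]]; rewrite memNset.
apply: measurableU; apply: measurableI => //.
- have [->|vw] := eqVneq v w.
    by rewrite [X in measurable X](_ : _ = setT)//; apply/seteqP; split.
  rewrite [X in measurable X](_ : _ = set0)//; apply/seteqP; split => //= z h.
  by rewrite h eqxx in vw.
- exact: measurableC.
- exact: ss.2.
Qed.

Lemma wmeasD f g : wmeas f -> wmeas g -> wmeas (fun z => f z + g z).
Proof.
by move=> mf mg e; under eq_fun do rewrite rdotDl; exact: measurable_funD.
Qed.

Lemma wmeasB f g : wmeas f -> wmeas g -> wmeas (fun z => f z - g z).
Proof.
by move=> mf mg e; under eq_fun do rewrite rdotBl; exact: measurable_funB.
Qed.

Lemma wmeasZ (k : T -> R[i]) f :
  measurable_fun setT (fun z => complex.Re (k z)) ->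
  measurable_fun setT (fun z => complex.Im (k z)) ->
  wmeas f -> wmeas (fun z => k z *: f z).
Proof.
move=> m1 m2 mf e; under eq_fun do rewrite rdotZ.
by apply: measurable_funB; exact: measurable_funM.
Qed.

Lemma wmeas_if (A : set T) f g : measurable A -> wmeas f -> wmeas g ->
  wmeas (fun z => if z \in A then f z else g z).
Proof.
move=> mA mf mg e.
rewrite [X in measurable_fun _ X](_ : _ =
  (fun z => if z \in A then rdot (f z) e else rdot (g z) e)); last first.
  by apply/funext => z; case: ifP.
apply: measurable_fun_if => //.
- apply: (measurable_fun_bool true).
  rewrite setTI [X in measurable X](_ : _ = A)//.
  by apply/seteqP; split => z /= => [/set_mem|/mem_set].
- exact: measurable_funTS.
- exact: measurable_funTS.
Qed.

Section pettis.
Hypothesis sepH : separable H.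

(* For a dense sequence [u], [hnorm x ^+ 2] is the supremum over [n] of
   [2 * rdot x (u n) - hnorm (u n) ^+ 2 = hnorm x ^+ 2 - hnorm (x - u n) ^+ 2]. *)
Lemma wmeas_hnorm f : wmeas f -> measurable_fun setT (fun z => hnorm (f z)).
Proof.
move=> mf; have [u hu] := sepH.
pose h n z := 2 * rdot (f z) (u n) - hnorm (u n) ^+ 2.
have hle n z : h n z <= hnorm (f z) ^+ 2.
  have := sqr_ge0 (hnorm (f z - u n)); rewrite hnormB_sqr /h; lra.
have ms : measurable_fun setT (fun z => sups (h ^~ z) 0%N).
  apply: measurable_fun_sups => [z _|n].
    by exists (hnorm (f z) ^+ 2) => _ [n _ <-]; exact: hle.
  by apply: measurable_funB => //; apply: measurable_funM => //; exact: mf.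
have E z : hnorm (f z) = Num.sqrt (sups (h ^~ z) 0%N).
  apply/esym; rewrite -[RHS]ger0_norm ?hnorm_ge0// -sqrtr_sqr; congr Num.sqrt.
  apply/eqP; rewrite eq_le; apply/andP; split.
    apply: ge_sup; first by exists (h 0%N z), 0%N.
    by move=> _ [n _ <-]; exact: hle.
  apply/ler_addgt0Pr => e e0.
  have [n hn] : exists n, hnorm (f z - u n) < Num.sqrt e.
    by apply: hu; rewrite sqrtr_gt0.
  have : h n z <= sups (h ^~ z) 0%N.
    apply: ub_le_sup; last by exists n.
    by exists (hnorm (f z) ^+ 2) => _ [m _ <-]; exact: hle.
  have : hnorm (f z - u n) ^+ 2 < e.
    by rewrite -(sqr_sqrtr (ltW e0)) ltr_pXn2r// nnegrE ?hnorm_ge0 ?sqrtr_ge0.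
  by rewrite hnormB_sqr /h; lra.
have -> : (fun z => hnorm (f z)) = @Num.sqrt R \o (fun z => sups (h ^~ z) 0%N).
  by apply/funext => z; rewrite E.
apply: measurableT_comp => //.
by apply: continuous_measurable_fun; exact: sqrt_continuous.
Qed.

(* [s n z] is a point of [u 0, ..., u n] closest to [f z], with [u 0 = 0]. *)
Lemma wmeas_approx f : wmeas f -> exists s : nat -> T -> H,
  [/\ forall n, simple_fun (s n),
      forall n z, hnorm (f z - s n z) <= hnorm (f z) &
      forall z, hnorm (f z - s n z) @[n --> \oo] --> (0 : R)].
Proof.
move=> mf; have [u [u0 hu]] := separable_dense0 sepH.
pose fix s n := if n is m.+1 then (fun z =>
  if z \in [set z | hnorm (f z - u m.+1) < hnorm (f z - s m z)] then u m.+1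
  else s m z) else (fun=> u 0%N).
have ss n : simple_fun (s n).
  elim: n => [|n ih] /=; first exact: simple_cst.
  apply: simple_if => //.
  rewrite -[X in measurable X]setTI.
  pose a z := hnorm (f z - u n.+1) < hnorm (f z - s n z).
  rewrite [X in _ `&` X](_ : _ = a @^-1` [set true]); last first.
    by apply/seteqP; split.
  suff : measurable_fun setT a by apply.
  apply: measurable_fun_ltr; apply: wmeas_hnorm; apply: wmeasB => //; exact: wmeas_simple.
have sS n z : hnorm (f z - s n.+1 z) <= hnorm (f z - s n z).
  by rewrite /=; case: ifPn => // /set_mem/= /ltW.
have su n z : hnorm (f z - s n z) <= hnorm (f z - u n).
  case: n => //= n; case: ifPn => //= /negP; rewrite inE/=.
  by move=> /negP; rewrite -leNgt.
have smn z m n : (m <= n)%N -> hnorm (f z - s n z) <= hnorm (f z - s m z).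
  move=> /subnK <-; elim: (n - m)%N => // k ih.
  by rewrite addSn; exact: le_trans (sS _ _) ih.
exists s; split => // [n z|z].
  by have := smn z 0%N n (leq0n n); rewrite /= u0 subr0.
apply/cvgrPdist_lt => e e0.
have [N hN] := hu (f z) e e0.
near=> n; rewrite sub0r normrN ger0_norm ?hnorm_ge0//.
apply: le_lt_trans hN; apply: le_trans (su N z); apply: smn.
by near: n; exact: nbhs_infty_ge.
Unshelve. all: by end_near. Qed.

Lemma wmeas_strongly (mu : {measure set T -> \bar R}) f :
  wmeas f -> strongly_measurable mu f.
Proof.
move=> /wmeas_approx[s [ss _ fs]]; exists s; split => //.
exact: aeW.
Qed.

End pettis.

(** Setting the function and its simple approximations to 0 on the exceptional null set makes the
    convergence hold everywhere, and weak measurability passes to the pointwise limit. *)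
Lemma strongly_wmeas (mu : {measure set T -> \bar R}) f :
  strongly_measurable mu f -> exists g, wmeas g /\ exists N,
    [/\ measurable N, mu N = 0%E & forall z, ~ N z -> f z = g z].
Proof.
move=> [s [ss [N [mN N0 fN]]]].
exists (fun z => if z \in N then 0 else f z); split; last first.
  by exists N; split => // z Nz; rewrite memNset.
move=> e.
apply: (@measurable_fun_cvg _ _ _ setT
  (fun n z => rdot (if z \in N then 0 else s n z) e)).
  move=> n; have : wmeas (fun z => if z \in N then 0 else s n z).
    by apply: wmeas_if => //; apply: wmeas_simple => //; exact: simple_cst.
  exact.
move=> z _; case: ifPn => [_|/negP Nz]; first exact: cvg_cst.
have {}fN : hnorm (f z - s n z) @[n --> \oo] --> (0 : R).
  by apply: contrapT => h; apply: Nz; rewrite inE; exact: fN.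
have [->|e0] := eqVneq e 0.
  by under eq_cvg do rewrite rdotC rdot0l; rewrite rdotC rdot0l; exact: cvg_cst.
apply/cvgrPdist_lt => c c0.
have ce : 0 < c / hnorm e by rewrite divr_gt0// hnorm_gt0.
move/cvgrPdist_lt : fN => /(_ _ ce).
apply: filterS => n; rewrite sub0r normrN ger0_norm ?hnorm_ge0// => fsn.
rewrite -rdotBl; apply: le_lt_trans (rdot_abs _ _) _.
by rewrite -ltr_pdivlMr ?hnorm_gt0.
Qed.

End weak_measurability.

(** * Existence of Bochner integrals *)

Section bochner_integral.
Context d (T : measurableType d) (R : realType) (H : hilbertType R).
Variable mu : {measure set T -> \bar R}.
Hypothesis sepH : separable H.
Implicit Types (f g s : T -> H) (e v w : H).
Local Open Scope ereal_scope.

Definition norm_integrable f :=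
  wmeas f /\ \int[mu]_z (hnorm (f z))%:E < +oo.

Definition weak_integral f v :=
  forall e, \int[mu]_z (rdot (f z) e)%:E = (rdot v e)%:E.

Lemma norm_integrableP f : wmeas f ->
  norm_integrable f <-> mu.-integrable setT (fun z => (hnorm (f z))%:E).
Proof.
move=> mf; split => [[_ fi]|/integrableP[_ fi]].
  apply/integrableP; split; first exact/measurable_EFinP/wmeas_hnorm.
  by under eq_integral do rewrite gee0_abs ?lee_fin ?hnorm_ge0//.
split => //.
by under eq_integral do rewrite -[X in X%:E]ger0_norm ?hnorm_ge0//.
Qed.

Lemma norm_integrable_rdot f e : norm_integrable f ->
  mu.-integrable setT (fun z => (rdot (f z) e)%:E).
Proof.
move=> [mf fi].
have /integrableZr := (norm_integrableP mf).1 (conj mf fi).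
move=> /(_ measurableT (hnorm e)); apply: le_integrable => //.
  exact/measurable_EFinP/mf.
move=> z _ /=; rewrite lee_fin [leRHS]ger0_norm ?mulr_ge0 ?hnorm_ge0//.
exact: rdot_abs.
Qed.

Lemma norm_integrable_le f g : wmeas f -> norm_integrable g ->
  (forall z, hnorm (f z) <= hnorm (g z))%R -> norm_integrable f.
Proof.
move=> mf [mg gi] fg; split => //; apply: le_lt_trans gi.
by apply: le_integral_nonmeasurable => z; rewrite lee_fin// hnorm_ge0.
Qed.

Lemma norm_integrableB f g : norm_integrable f -> norm_integrable g ->
  norm_integrable (fun z => f z - g z)%R.
Proof.
move=> fi gi; have mfg := wmeasB fi.1 gi.1; split => //.
apply: (@le_lt_trans _ _ (\int[mu]_z ((hnorm (f z))%:E + (hnorm (g z))%:E))).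
  apply: le_integral_nonmeasurable => z; first by rewrite lee_fin hnorm_ge0.
  rewrite -EFinD lee_fin. exact: ler_hnormB.
rewrite ge0_integralD//; last 4 first.
- by move=> z _; rewrite lee_fin hnorm_ge0.
- exact/measurable_EFinP/wmeas_hnorm/fi.1.
- by move=> z _; rewrite lee_fin hnorm_ge0.
- exact/measurable_EFinP/wmeas_hnorm/gi.1.
by rewrite lte_add_pinfty ?fi.2 ?gi.2.
Qed.

Lemma norm_integrableD f g : norm_integrable f -> norm_integrable g ->
  norm_integrable (fun z => f z + g z)%R.
Proof.
move=> fi gi; have mfg := wmeasD fi.1 gi.1; split => //.
apply: (@le_lt_trans _ _ (\int[mu]_z ((hnorm (f z))%:E + (hnorm (g z))%:E))).
  apply: le_integral_nonmeasurable => z; first by rewrite lee_fin hnorm_ge0.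
  by rewrite -EFinD lee_fin; exact: ler_hnormD.
rewrite ge0_integralD//; last 4 first.
- by move=> z _; rewrite lee_fin hnorm_ge0.
- exact/measurable_EFinP/wmeas_hnorm/fi.1.
- by move=> z _; rewrite lee_fin hnorm_ge0.
- exact/measurable_EFinP/wmeas_hnorm/gi.1.
by rewrite lte_add_pinfty ?fi.2 ?gi.2.
Qed.

Lemma norm_integrableZ (a : R[i]) f : norm_integrable f ->
  norm_integrable (fun z => a *: f z)%R.
Proof.
move=> [mf fi]; split; first by apply: wmeasZ => //; exact: measurable_cst.
under eq_integral do rewrite hnormZ EFinM.
rewrite ge0_integralZl//; last 3 first.
- exact/measurable_EFinP/wmeas_hnorm.
- by move=> z _; rewrite lee_fin hnorm_ge0.
- by rewrite lee_fin cabs_ge0.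
by apply: lte_mul_pinfty => //; rewrite lee_fin cabs_ge0.
Qed.

Lemma weak_integral_unique f v w :
  weak_integral f v -> weak_integral f w -> v = w.
Proof.
by move=> fv fw; apply: rdot_inj => e; apply: EFin_inj; rewrite -fv -fw.
Qed.

(** Test against [v] itself: ||v||^2 is the integral of [rdot (f z) v], at most ||v|| times the
    integral of ||f||; then divide by ||v||. *)
Lemma weak_integral_norm f v : wmeas f -> weak_integral f v ->
  (hnorm v)%:E <= \int[mu]_z (hnorm (f z))%:E.
Proof.
move=> mf fv.
have [->|v0] := eqVneq v 0%R.
  by rewrite hnorm0; apply: integral_ge0 => z _; rewrite lee_fin hnorm_ge0.
have vp := hnorm_gt0 v0.
have [fi|] := ltP (\int[mu]_z (hnorm (f z))%:E) +oo; last first.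
  by rewrite leye_eq => /eqP ->; rewrite leey.
have nfi := (norm_integrableP mf).1 (conj mf fi).
have : (hnorm v * hnorm v)%:E <= (hnorm v)%:E * \int[mu]_z (hnorm (f z))%:E.
  rewrite -expr2 hnormE -fv -integralZl//.
  apply: le_integral => //.
  - exact: norm_integrable_rdot.
  - exact: integrableZl.
  - by move=> z _; rewrite -EFinM lee_fin mulrC rdot_le.
have /fineK <- := integrable_fin_num measurableT nfi.
by rewrite -EFinM !lee_fin ler_pM2l.
Qed.

Lemma weak_integralB f g v w : norm_integrable f -> norm_integrable g ->
  weak_integral f v -> weak_integral g w ->
  weak_integral (fun z => f z - g z)%R (v - w)%R.
Proof.
move=> fi gi fv gw e.
under eq_integral do rewrite rdotBl EFinB.
rewrite integralB ?fv ?gw ?rdotBl//; exact: norm_integrable_rdot.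
Qed.

Lemma weak_integralD f g v w : norm_integrable f -> norm_integrable g ->
  weak_integral f v -> weak_integral g w ->
  weak_integral (fun z => f z + g z)%R (v + w)%R.
Proof.
move=> fi gi fv gw e.
under eq_integral do rewrite rdotDl EFinD.
rewrite integralD ?fv ?gw ?rdotDl//; exact: norm_integrable_rdot.
Qed.

Lemma weak_integralZ (a : R[i]) f v : norm_integrable f ->
  weak_integral f v -> weak_integral (fun z => a *: f z)%R (a *: v)%R.
Proof.
move=> fi fv e.
under eq_integral do rewrite rdotZ EFinB !EFinM.
rewrite integralB//; last 2 first.
- by apply: integrableZl => //; exact: norm_integrable_rdot.
- by apply: integrableZl => //; exact: norm_integrable_rdot.
rewrite !integralZl// ?fv; try exact: norm_integrable_rdot.
by rewrite rdotZ.
Qed.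

Lemma weak_integral_ae f g v (N : set T) : measurable N -> mu N = 0 ->
  (forall z, ~ N z -> f z = g z) -> wmeas f -> wmeas g ->
  weak_integral f v -> weak_integral g v.
Proof.
move=> mN N0 fg mf mg fv e; rewrite -fv; apply: ae_eq_integral => //.
- exact/measurable_EFinP/mg.
- exact/measurable_EFinP/mf.
- exists N; split => // z /= h; apply: contrapT => Nz; apply: h => _.
  by rewrite fg.
Qed.

Lemma integrable_indic_fin (A : set T) : measurable A -> mu A < +oo ->
  mu.-integrable setT (fun z => (\1_A z)%:E).
Proof.
move=> mA Aoo; apply/integrableP; split; first exact/measurable_EFinP.
under eq_integral do rewrite gee0_abs ?lee_fin//.
by rewrite integral_indic// setIT.
Qed.

(** The fibre over 0 may have infinite measure, so the value 0 is treated apart throughout; its term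
    vanishes on both sides. *)
Lemma simple_weak_integral s : simple_integrable mu s ->
  weak_integral s (simple_integral mu s).
Proof.
move=> [[fs ms] si] e.
rewrite /simple_integral fsbig_finite//=.
pose r := finmap.enum_fset (fset_set (range s)).
have sE z : (rdot (s z) e)%:E =
    \sum_(v <- r) (rdot v e)%:E * (\1_(s @^-1` [set v]) z)%:E.
  rewrite (bigD1_seq (s z))//=; last 2 first.
  - by rewrite in_fset_set// inE; exists z.
  - exact: finmap.fset_uniq.
  rewrite indicE mem_set// mule1 big1 ?adde0// => v vs.
  by rewrite indicE memNset ?mule0// => /= h; rewrite h eqxx in vs.
under eq_integral do rewrite sE.
have iv v : mu.-integrable setT
    (fun z => (rdot v e)%:E * (\1_(s @^-1` [set v]) z)%:E).
  have [->|v0] := eqVneq v 0%R.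
    rewrite rdot0l; under eq_fun do rewrite mul0e.
    exact: integrable0.
  by apply: integrableZl => //; exact: integrable_indic_fin (ms v) (si v v0).
rewrite integral_sum//.
transitivity (\sum_(v <- r) (rdot ((fine (mu (s @^-1` [set v])))%:C *: v)%R e)%:E).
  apply: eq_bigr => v _.
  have [->|v0] := eqVneq v 0%R.
    rewrite scaler0 rdot0l; under eq_integral do rewrite mul0e.
    by rewrite integral0.
  rewrite integralZl//; last exact: integrable_indic_fin (ms v) (si v v0).
  rewrite integral_indic//.
  rewrite setIT rdotZR EFinM fineK; last first.
    by rewrite ge0_fin_numE//; exact: si.
  by rewrite muleC.
by rewrite sumEFin rdot_suml.
Qed.

Hypothesis fin_mu : mu setT < +oo.

Lemma simple_fun_integrable s : simple_fun s -> simple_integrable mu s.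
Proof.
move=> ss; split => // v _; apply: le_lt_trans fin_mu.
by apply: le_measure; rewrite ?inE//; exact: ss.2.
Qed.

(** Dominated convergence, with ||f|| as dominating function, makes the simple approximations
    converge in L^1. Their integrals are then Cauchy by [weak_integral_norm], completeness gives the
    limit, and the weak characterization passes to it. *)
Lemma bochner_exists f : norm_integrable f ->
  exists v, is_bochner mu f v /\ weak_integral f v.
Proof.
move=> fi; have mf := fi.1.
have [s [ss sf fs]] := wmeas_approx sepH mf.
have ms n : wmeas (s n) by exact: wmeas_simple.
have mfs n : wmeas (fun z => f z - s n z)%R by exact: wmeasB.
have fsi n : norm_integrable (fun z => f z - s n z)%R.
  exact: norm_integrable_le (mfs n) fi (sf n).
have si n : norm_integrable (s n).
  have := norm_integrableB fi (fsi n).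
  by under eq_fun do rewrite subKr.
pose I n := simple_integral mu (s n).
have wI n : weak_integral (s n) (I n).
  exact/simple_weak_integral/simple_fun_integrable.
have cvg0 : \int[mu]_z (hnorm (f z - s n z))%:E @[n --> \oo] --> 0.
  have := @dominated_convergence _ _ _ mu setT measurableT
    (fun n z => (hnorm (f z - s n z))%:E) (cst 0) (fun z => (hnorm (f z))%:E).
  case.
  - by move=> n; exact/measurable_EFinP/wmeas_hnorm.
  - exact: measurable_cst.
  - by apply: aeW => z _; apply: cvg_EFin; [near=> n|exact: fs].
  - exact: (norm_integrableP mf).1.
  - by apply: aeW => z n _; rewrite gee0_abs lee_fin ?hnorm_ge0.
  - by move=> _ _ /=; rewrite integral0.
have III m n : (hnorm (I m - I n))%:E <=
    \int[mu]_z (hnorm (f z - s m z))%:E + \int[mu]_z (hnorm (f z - s n z))%:E.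
  apply: le_trans (weak_integral_norm (wmeasB (ms m) (ms n))
    (weak_integralB (si m) (si n) (wI m) (wI n))) _.
  rewrite -ge0_integralD//; last 4 first.
  - by move=> z _; rewrite lee_fin hnorm_ge0.
  - exact/measurable_EFinP/wmeas_hnorm.
  - by move=> z _; rewrite lee_fin hnorm_ge0.
  - exact/measurable_EFinP/wmeas_hnorm.
  apply: le_integral_nonmeasurable => z; first by rewrite lee_fin hnorm_ge0.
  rewrite -EFinD lee_fin (_ : s m z - s n z = (f z - s n z) - (f z - s m z))%R.
    by rewrite [leRHS]addrC; exact: ler_hnormB.
  by rewrite opprB [RHS]addrC addrA subrK.
have small (c : R) : (0 < c)%R -> exists N, forall n, (N <= n)%N ->
    \int[mu]_z (hnorm (f z - s n z))%:E < c%:E.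
  move=> c0; have : \forall n \near \oo,
      \int[mu]_z (hnorm (f z - s n z))%:E < c%:E.
    have : nbhs (0 : \bar R) [set x | x < c%:E].
      by apply: open_ereal_lt'; rewrite lte_fin.
    exact: (cvg0 [set x | x < c%:E]).
  by move=> [N _ hN]; exists N => n Nn; exact: hN.
have [v Iv] : exists v, hnorm (I n - v) @[n --> \oo] --> (0 : R)%R.
  apply: hilbert_complete => c c0.
  have c20 : (0 < c / 2)%R by rewrite divr_gt0.
  have [N hN] := small _ c20; exists N => m n Nm Nn.
  rewrite -lte_fin; apply: le_lt_trans (III m n) _.
  by rewrite (splitr c) EFinD; apply: lteD; exact: hN.
exists v; split.
  split; first exact: wmeas_strongly.
  by exists s; split => // n; exact: simple_fun_integrable.
move=> e.
have ife := norm_integrable_rdot e fi.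
have /fineK fE := integrable_fin_num measurableT ife.
rewrite -fE; congr EFin; set a := fine _ in fE *.
pose h n := \int[mu]_z (hnorm (f z - s n z))%:E.
have aI n : `|a - rdot (I n) e|%:E <= (hnorm e)%:E * h n.
  rewrite -abse_EFin EFinB fE -wI -integralB//; last exact: norm_integrable_rdot.
  apply: le_trans (le_abse_integral _ _ _) _ => //.
    by apply: measurable_int; apply: integrableB => //;
      exact: norm_integrable_rdot.
  rewrite -integralZl//; last exact/norm_integrableP.
  apply: le_integral_nonmeasurable => z //.
  by rewrite -EFinB -rdotBl -EFinM lee_fin mulrC rdot_abs.
apply/eqP; rewrite -subr_eq0 -normr_le0; apply/ler_addgt0Pr => c c0.
rewrite add0r.
(* Two errors of size at most ||e|| c' must add up to at most c; the [+ 1] keeps the denominator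
   positive when [e] is 0. *)
pose c' := (c / (2 * (hnorm e + 1)))%R.
have e1 : (0 < hnorm e + 1)%R by rewrite ltr_wpDl// hnorm_ge0.
have c'0 : (0 < c')%R by rewrite divr_gt0// mulr_gt0.
have [N hN] := small _ c'0.
move/cvgrPdist_lt : Iv => /(_ _ c'0)[M _ hM].
pose n := maxn N M.
have {hN} hn := hN n (leq_maxl _ _).
have {hM} := hM n (leq_maxr _ _); rewrite /= sub0r normrN ger0_norm ?hnorm_ge0// => In.
have -> : (a - rdot v e = (a - rdot (I n) e) + rdot (I n - v) e)%R.
  by rewrite rdotBl; ring.
apply: le_trans (ler_normD _ _) _.
have h1 : (`|a - rdot (I n) e| <= hnorm e * c')%R.
  rewrite -lee_fin; apply: le_trans (aI n) _.
  by rewrite EFinM lee_wpmul2l// ?lee_fin ?hnorm_ge0// ltW.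
have h2 : (`|rdot (I n - v) e| <= hnorm e * c')%R.
  apply: le_trans (rdot_abs _ _) _.
  by rewrite mulrC ler_wpM2l// ?hnorm_ge0// ltW.
apply: le_trans (lerD h1 h2) _.
have -> : (hnorm e * c' + hnorm e * c' = c * (hnorm e / (hnorm e + 1)))%R.
  by rewrite /c'; field; rewrite gt_eqF.
rewrite ger_pMr// ler_pdivrMr// mul1r lerDl//.
Unshelve. all: by end_near. Qed.

End bochner_integral.

(** * Powers of operators with two spectral values *)

Section spectral_operator.
Context (R : realType) (H : hilbertType R).
Variable Q : H -> H.
Implicit Types (x y : H) (a b t l s : R).

Record orth_proj := OrthProj {
  orth_proj_linear : linear Q;
  orth_proj_idem : forall x, Q (Q x) = Q x;
  orth_proj_adj : forall x y, hdot H (Q x) y = hdot H x (Q y)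
}.

(* The operator equal to [a] on the range of [Q] and to 1 on its complement. *)
Definition sop a x : H := x + (a - 1)%:C *: Q x.

Hypothesis oQ : orth_proj.

Let QD x y : Q (x + y) = Q x + Q y.
Proof. by have := oQ.(orth_proj_linear) 1 x y; rewrite !scale1r. Qed.

Let Q0 : Q 0 = 0.
Proof. by apply: (@addIr _ (Q 0)); rewrite -QD !add0r. Qed.

Let QZ (c : R[i]) x : Q (c *: x) = c *: Q x.
Proof. by have := oQ.(orth_proj_linear) c x 0; rewrite !addr0 Q0 addr0. Qed.

Lemma sop_linear a : linear (sop a).
Proof.
move=> c x y; rewrite /sop QD QZ scalerDr scalerDr !scalerA.
by rewrite (mulrC c) addrACA.
Qed.

Lemma sopE a x : sop a x = (x - Q x) + a%:C *: Q x.
Proof.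
apply: rdot_inj => e; rewrite !(rdotDl, rdotNl, rdotZR); ring.
Qed.

Lemma sop_comp a b x : sop a (sop b x) = sop (a * b) x.
Proof.
rewrite /sop QD QZ oQ.(orth_proj_idem); apply: rdot_inj => e.
by rewrite !(rdotDl, rdotZR); ring.
Qed.

Lemma sop1 x : sop 1 x = x.
Proof. by rewrite /sop subrr scale0r addr0. Qed.

Lemma sop_iter a n x : iter n (sop a) x = sop (a ^+ n) x.
Proof.
by elim: n => [|n ih] /=; rewrite ?expr0 ?sop1// ih sop_comp -exprS.
Qed.

Lemma sop_fix a x : Q x = x -> sop a x = a%:C *: x.
Proof.
move=> Qx; rewrite /sop Qx; apply: rdot_inj => e.
by rewrite !(rdotDl, rdotZR); ring.
Qed.

Lemma sop_ker a x : Q x = 0 -> sop a x = x.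
Proof. by rewrite /sop => ->; rewrite scaler0 addr0. Qed.

Let Qdot x : rdot x (Q x) = rdot (Q x) (Q x).
Proof. by rewrite /rdot [in RHS]oQ.(orth_proj_adj) oQ.(orth_proj_idem). Qed.

(** Pythagoras: self-adjointness and idempotence give <x, Q x> = ||Q x||^2. *)
Lemma orth_proj_sqr x : hnorm x ^+ 2 = hnorm (x - Q x) ^+ 2 + hnorm (Q x) ^+ 2.
Proof. by rewrite hnormB_sqr Qdot -hnormE; ring. Qed.

Lemma orth_proj_norm x : hnorm (Q x) <= hnorm x.
Proof.
rewrite -(@ler_pXn2r _ 2)// ?nnegrE ?hnorm_ge0//.
by rewrite (orth_proj_sqr x) lerDr sqr_ge0.
Qed.

Lemma orth_proj_normC x : hnorm (x - Q x) <= hnorm x.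
Proof.
rewrite -(@ler_pXn2r _ 2)// ?nnegrE ?hnorm_ge0//.
by rewrite (orth_proj_sqr x) lerDl sqr_ge0.
Qed.

Lemma sop_norm_sqr a x :
  hnorm (sop a x) ^+ 2 = hnorm (x - Q x) ^+ 2 + a ^+ 2 * hnorm (Q x) ^+ 2.
Proof.
rewrite hnormB_sqr Qdot -hnormE /sop hnormE rdotDl !rdotDr !rdotZR !rdotZRr.
by rewrite (rdotC (Q x) x) Qdot -!hnormE; ring.
Qed.

Lemma sop_norm_ge1 a x : 1 <= a -> hnorm x <= hnorm (sop a x).
Proof.
move=> a1; rewrite -(@ler_pXn2r _ 2)// ?nnegrE ?hnorm_ge0//.
rewrite sop_norm_sqr (orth_proj_sqr x) lerD2l ler_peMl ?sqr_ge0//.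
by rewrite expr_ge1// (le_trans ler01).
Qed.

Lemma sop_norm_le a b x : 0 <= a <= b -> 1 <= b ->
  hnorm (sop a x) <= b * hnorm x.
Proof.
move=> /andP[a0 ab] b1; have b0 := le_trans a0 ab.
rewrite -(@ler_pXn2r _ 2)// ?nnegrE ?mulr_ge0 ?hnorm_ge0//.
rewrite sop_norm_sqr exprMn (orth_proj_sqr x) mulrDr; apply: lerD.
  by rewrite ler_peMl ?sqr_ge0// expr_ge1.
by rewrite ler_wpM2r ?sqr_ge0// ler_pXn2r.
Qed.

Lemma sop_bounded a : bounded_op (sop a).
Proof.
split; first exact: sop_linear.
exists (1 + `|a - 1|) => x; apply: le_trans (ler_hnormD _ _) _.
rewrite hnormZR mulrDl mul1r lerD2l ler_wpM2l//; exact: orth_proj_norm.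
Qed.

Lemma sop_invertible a : a != 0 -> boundedly_invertible (sop a).
Proof.
move=> a0; exists (sop a^-1); split; first exact: sop_bounded.
  by move=> x; rewrite sop_comp mulVf// sop1.
by move=> x; rewrite sop_comp mulfV// sop1.
Qed.

Lemma sop_dot a x : hdot H (sop a x) x =
  (hnorm (x - Q x) ^+ 2 + a * hnorm (Q x) ^+ 2)%:C.
Proof.
have Qx : hdot H (Q x) x = (hnorm (Q x) ^+ 2)%:C.
  by rewrite -hdotxx [RHS]oQ.(orth_proj_adj) oQ.(orth_proj_idem) -oQ.(orth_proj_adj).
rewrite /sop linearDl linearZl_LR /= Qx hdotxx (orth_proj_sqr x).
rewrite -(rmorphM (real_complex R)) -(rmorphD (real_complex R)).
by congr (_%:C); ring.
Qed.

Lemma sop_positive a : 0 <= a -> positive_op (sop a).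
Proof.
move=> a0 x; rewrite sop_dot ler0c; apply: addr_ge0; first exact: sqr_ge0.
by apply: mulr_ge0 => //; exact: sqr_ge0.
Qed.

(** The k-th iterate of [sop a] is [sop (a ^+ k)], so a polynomial acts through its values at the
    two eigenvalues, on the kernel and on the range of [Q]. *)
Lemma horner_sop a (q : {poly R}) x :
  op_horner (sop a) q x = q.[1]%:C *: (x - Q x) + q.[a]%:C *: Q x.
Proof.
rewrite /op_horner !horner_coef !rmorph_sum/= !scaler_suml -big_split/=.
apply: eq_bigr => i _; rewrite sop_iter expr1n mulr1 rmorphM/= -scalerA -scalerDr.
by congr (_ *: _); rewrite sopE.
Qed.

Hypothesis Qfix : exists2 x, x != 0 & Q x = x.
Hypothesis Qker : exists2 x, x != 0 & Q x = 0.

(** For any other t, subtracting t leaves 1 - t times the operator [sop] with parameter (l - t) / (1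
    - t), which is nonzero, and such an operator is invertible. *)
Lemma spectrum_sop l t : spectrum (sop l) t%:C -> t = 1 \/ t = l.
Proof.
move=> h; have [->|t1] := eqVneq t 1; first by left.
have [->|tl] := eqVneq t l; first by right.
exfalso; apply: h.
have d1 : 1 - t != 0 by rewrite subr_eq0 eq_sym.
have d2 : l - t != 0 by rewrite subr_eq0 eq_sym.
have E x : sop l x - t%:C *: x = (1 - t)%:C *: sop ((l - t) / (1 - t)) x.
  apply: rdot_inj => e; rewrite !(rdotDl, rdotNl, rdotZR) /sop.
  by field.
have [|B [[lB [C BC]] BA AB]] := @sop_invertible ((l - t) / (1 - t)).
  by rewrite mulf_neq0// invr_neq0.
have BZ (c : R[i]) x : B (c *: x) = c *: B x.
  have B0 : B 0 = 0.
    have := lB 1 0 0; rewrite !scaler0 scale1r addr0 => h.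
    by apply: (@addIr _ (B 0)); rewrite add0r -h.
  by have := lB c x 0; rewrite !addr0 B0 addr0.
have cV : (1 - t)^-1%:C * (1 - t)%:C = 1 :> R[i] by rewrite -rmorphM mulVf.
have cV' : (1 - t)%:C * (1 - t)^-1%:C = 1 :> R[i] by rewrite -rmorphM mulfV.
exists (fun x => (1 - t)^-1%:C *: B x); split.
- split; first by move=> c x y; rewrite lB scalerDr !scalerA mulrC.
  exists (`|(1 - t)^-1| * C) => x; rewrite hnormZR -mulrA ler_wpM2l//.
- by move=> x; rewrite E BZ scalerA cV scale1r BA.
- by move=> x; rewrite E -BZ AB scalerA cV' scale1r.
Qed.

(** A nonzero vector of the kernel of [Q] is an eigenvector. Together with [spectrum_sopl] this
    forces any approximating polynomial to be accurate at both 1 and l, hence uniqueness in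
    [op_pow_sop]. *)
Lemma spectrum_sop1 l : spectrum (sop l) 1.
Proof.
move=> [B [_ BA _]]; have [x x0 Qx] := Qker.
have E : sop l x - 1 *: x = sop l 0 - 1 *: 0.
  by rewrite !sop_ker// !scale1r !subrr.
by move/eqP: x0; apply; rewrite -(BA x) -[RHS](BA 0) E.
Qed.

Lemma spectrum_sopl l : spectrum (sop l) l%:C.
Proof.
move=> [B [_ BA _]]; have [x x0 Qx] := Qfix.
have E : sop l x - l%:C *: x = sop l 0 - l%:C *: 0.
  by rewrite !sop_fix// !subrr.
by move/eqP: x0; apply; rewrite -(BA x) -[RHS](BA 0) E.
Qed.

(** The affine function interpolating t^s at 1 and l shows that the right-hand side is a value of
    the functional calculus. Since [op_pow] chooses some such operator, uniqueness is shown as well: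
    a polynomial accurate at 1 and l determines the operator up to a small error. *)
Lemma op_pow_sop l s : 1 < l -> op_pow (sop l) s = sop (l `^ s).
Proof.
move=> l1; set f := fun t : R => t `^ s.
have l0 : l - 1 != 0 by rewrite subr_eq0 gt_eqF.
have ex : is_funcalc f (sop l) (sop (l `^ s)).
  move=> e e0; exists (1 + ((l `^ s - 1) / (l - 1)) *: ('X - 1)).
  have q1 : (1 + ((l `^ s - 1) / (l - 1)) *: ('X - 1%:P)).[1] = 1.
    by rewrite !hornerE subrr mulr0 addr0.
  have ql : (1 + ((l `^ s - 1) / (l - 1)) *: ('X - 1%:P)).[l] = l `^ s.
    by rewrite !hornerE; field.
  split.
    by move=> t /spectrum_sop[->|->]; rewrite ?q1 ?ql /f ?powR1 subrr normr0 ltW.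
  move=> x; rewrite horner_sop q1 ql scale1r -sopE subrr hnorm0.
  by rewrite mulr_ge0 ?hnorm_ge0// ltW.
rewrite /op_pow; apply/funext => x.
have := xgetPex (fun=> 0) (ex_intro (fun B => is_funcalc f (sop l) B) _ ex).
set B := xget _ _ => fB.
apply/eqP; rewrite -subr_eq0; apply/eqP/hnorm_eq0/eqP.
rewrite -normr_le0 ger0_norm ?hnorm_ge0//.
apply/ler_addgt0Pr => c c0; rewrite add0r.
(* There are three errors: those of the polynomial at 1 and at l, and the distance of
   [op_horner (sop l) q x] to [B x]. *)
pose c' := c / (3 * (hnorm x + 1)).
have x1 : 0 < hnorm x + 1 by rewrite ltr_wpDl// hnorm_ge0.
have c'0 : 0 < c' by rewrite divr_gt0// mulr_gt0.
have [q [hq hB]] := fB _ c'0.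
have h1 := hq 1 (@spectrum_sop1 l); have hl := hq l (@spectrum_sopl l).
have {}hB := hB x.
have -> : B x - sop (l `^ s) x = (q.[1] - 1)%:C *: (x - Q x)
    + (q.[l] - l `^ s)%:C *: Q x - (op_horner (sop l) q x - B x).
  rewrite horner_sop sopE; apply: rdot_inj => e.
  by rewrite !(rdotDl, rdotNl, rdotZR); ring.
apply: le_trans (ler_hnormB _ _) _.
apply: (@le_trans _ _ (c' * hnorm x + c' * hnorm x + c' * hnorm x)).
  apply: lerD => //; apply: le_trans (ler_hnormD _ _) _; rewrite !hnormZR.
  apply: lerD; apply: ler_pM => //; rewrite ?hnorm_ge0//.
  - by move: h1; rewrite /f powR1.
  - exact: orth_proj_normC.
  - exact: orth_proj_norm.
have -> : c' * hnorm x + c' * hnorm x + c' * hnorm x =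
    c * (hnorm x / (hnorm x + 1)) by rewrite /c'; field; rewrite gt_eqF.
by rewrite ger_pMr// ler_pdivrMr// mul1r lerDl.
Qed.

End spectral_operator.

(** * The Forelli-Rudin estimate *)

Section density.
Context d (T : measurableType d) (R : realType).
Variables (mu nu : {measure set T -> \bar R}) (D : set T) (g : T -> R).
Hypothesis mD : measurable D.
Hypothesis g0 : forall x, 0 <= g x.
Hypothesis mg : measurable_fun setT g.
Local Open Scope ereal_scope.
Hypothesis nuE : forall A, measurable A ->
  nu A = \int[mu]_(x in A `&` D) (g x)%:E.

Import HBNNSimple.

(** By monotone convergence along simple functions increasing to [f], it suffices to treat
    indicators, where the identity is the hypothesis on [nu]. *)
Lemma ge0_integral_density (f : T -> \bar R) :
  measurable_fun setT f -> (forall x, 0 <= f x) ->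
  \int[nu]_x f x = \int[mu]_(x in D) (f x * (g x)%:E).
Proof.
move=> mf f0.
pose h := nnsfun_approx measurableT mf.
have -> : \int[nu]_x f x = lim (\int[nu]_x (EFin \o h n) x @[n --> \oo]).
  have fE x : f x = lim ((EFin \o h n) x @[n --> \oo]).
    by apply/esym/cvg_lim => //; exact: cvg_nnsfun_approx.
  under eq_integral => x _ do rewrite fE.
  apply: monotone_convergence => //.
  - by move=> n; apply/measurable_EFinP; exact/measurable_funP.
  - by move=> n x _ //=; rewrite lee_fin.
  - by move=> x _ a b ab; rewrite lee_fin; exact/lefP/nd_nnsfun_approx.
have mgD : measurable_fun D (fun x => (g x)%:E).
  by apply/measurable_funTS/measurable_EFinP.
have -> : \int[mu]_(x in D) (f x * (g x)%:E) =
    lim (\int[mu]_(x in D) ((EFin \o h n) x * (g x)%:E) @[n --> \oo]).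
  have fg x : f x * (g x)%:E = lim (((EFin \o h n) x * (g x)%:E) @[n --> \oo]).
    apply/esym/cvg_lim => //; apply: cvgeZr => //.
    exact: cvg_nnsfun_approx.
  under eq_integral => x _ do rewrite fg.
  apply: monotone_convergence => //.
  - by move=> n; apply/emeasurable_funM => //; apply/measurable_funTS/measurable_EFinP.
  - by move=> n x _ /=; rewrite mule_ge0 ?lee_fin.
  - by move=> x _ a b ab/=; rewrite lee_wpmul2r ?lee_fin//;
      exact/lefP/nd_nnsfun_approx.
suff suf n : \int[mu]_(x in D) ((EFin \o h n) x * (g x)%:E) =
    \int[nu]_x (EFin \o h n) x.
  by congr (lim (_ @ \oo)); apply/funext => n; rewrite suf.
transitivity (\int[nu]_x
   (\sum_(y \in range (h n)) (y * \1_(h n @^-1` [set y]) x)%:E)); last first.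
  by apply: eq_integral => t tE; rewrite /= fimfunE -fsumEFin.
have indich (E : set T) m r :
    measurable_fun E (fun x => (r * \1_(h m @^-1` [set r]) x)%:E).
  apply: (@measurable_funTS _ _ _ _ E).
  by apply: (measurable_comp measurableT) => //; exact: measurable_funM.
rewrite ge0_integral_fsum//; last by move=> m y Ey; exact: nnfun_muleindic_ge0.
transitivity (\int[mu]_(x in D) (\sum_(y \in range (h n))
    (y * \1_(h n @^-1` [set y]) x)%:E * (g x)%:E)).
  under [RHS]eq_integral => x xE.
    rewrite -ge0_mule_fsuml => [|y]; last exact: nnfun_muleindic_ge0.
    rewrite fsumEFin // -(fimfunE _ x); over.
  by [].
rewrite ge0_integral_fsum//; last 2 first.
  - by move=> y; apply: emeasurable_funM => //.
  - move=> m y Ey; apply: mule_ge0; last by rewrite lee_fin.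
    exact: nnfun_muleindic_ge0.
apply: eq_fsbigr => r rhn.
under [RHS]eq_integral do rewrite EFinM.
rewrite integralZl_indic_nnsfun => //.
under eq_integral do rewrite EFinM -muleA.
rewrite ge0_integralZl//.
- under eq_integral do rewrite muleC.
  rewrite (eq_integral ((fun x => (g x)%:E) \_ (h n @^-1` [set r]))); last first.
    by move=> x xE; rewrite epatch_indic.
  by rewrite -integral_mkcondr integral_indic// setIT nuE// setIC.
- by apply: emeasurable_funM => //; exact/measurable_EFinP/measurable_funTS.
- by move=> t Et; rewrite mule_ge0 ?lee_fin ?f_ge0.
- by move: rhn; rewrite inE => -[t _ <-]; rewrite lee_fin.
Qed.

End density.

(** * Integrals of powers on the line *)

Section real_integrals.
Context (R : realType).
Local Notation mu := (@lebesgue_measure R).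
Local Open Scope ereal_scope.
Implicit Types (f : R -> \bar R).

(** The image of Lebesgue measure under the reflection gives intervals their length, and Lebesgue
    measure is the only measure that does so. The reflection moves the open end of a half-open
    interval to the other side. *)
Lemma integral_reflection (c : R) f :
  measurable_fun [set: measurableTypeR R] f -> (forall x, 0 <= f x) ->
  \int[mu]_x f (c - x)%R = \int[mu]_x f x.
Proof.
move=> mf f0.
pose phi (x : measurableTypeR R) : measurableTypeR R := (c - x)%R.
have mphi : measurable_fun setT phi by exact: measurable_funB.
transitivity (\int[pushforward mu phi]_x f x).
  by rewrite ge0_integral_pushforward//= => x _; exact: f0.
apply: eq_measure_integral => //= A mA _.
apply/esym/lebesgue_measure_unique => //= _ [[a b]] _ <-.
rewrite /pushforward.
have -> : phi @^-1` `]a, b] = `[(c - b)%R, (c - a)%R[%classic.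
  by apply/seteqP; split => x /=; rewrite /phi !in_itv/=; lra.
rewrite !lebesgue_measure_itv/= !lte_fin.
have -> : (c - b < c - a)%R = (a < b)%R by lra.
by case: ifP => // _; rewrite -!EFinB; congr EFin; lra.
Qed.

(** A translation is a composition of two reflections. *)
Lemma integral_translation (c : R) f :
  measurable_fun [set: measurableTypeR R] f -> (forall x, 0 <= f x) ->
  \int[mu]_x f (x - c)%R = \int[mu]_x f x.
Proof.
move=> mf f0; rewrite -[RHS](integral_reflection 0)//.
rewrite -[RHS](integral_reflection c)//; last first.
  apply: (measurableT_comp mf); exact: measurable_funB.
by apply: eq_integral => x _; congr f; lra.
Qed.

Lemma integral_bigcup_le (F : nat -> set R) f (M : \bar R) :
  (forall n, measurable (F n)) -> nondecreasing_seq F ->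
  measurable_fun (\bigcup_n F n) f -> (forall x, 0 <= f x) ->
  (forall n, \int[mu]_(x in F n) f x <= M) ->
  \int[mu]_(x in \bigcup_n F n) f x <= M.
Proof.
move=> mF ndF mf f0 fM.
have cF : \int[mu]_(x in F n) f x @[n --> \oo] -->
    \int[mu]_(x in \bigcup_n F n) f x.
  apply: ge0_nondecreasing_set_cvg_integral => //.
  by move=> n; apply: measurable_funS mf; [exact: bigcup_measurable|exact: bigcup_sup].
by apply: (cvge_le _ cF); apply: nearW => n; exact: fM.
Qed.

Lemma measurable_powR_EFin (D : set R) c :
  measurable_fun D (fun x : R => (x `^ c)%:E).
Proof. by apply: measurable_funTS; apply/measurable_EFinP; exact: measurable_powR. Qed.

Lemma integral_powR (c x y : R) : (c + 1 != 0)%R -> (0 < x)%R -> (x < y)%R ->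
  \int[mu]_(s in `[x, y]) (s `^ c)%:E =
  ((y `^ (c + 1) - x `^ (c + 1)) / (c + 1))%:E.
Proof.
move=> c1 x0 xy.
have dF z : (0 < z)%R ->
    is_derive (z : R) 1%R (fun s : R => (c + 1)^-1 * s `^ (c + 1))%R (z `^ c)%R.
  move=> z0.
  have := @is_deriveZ _ _ _ (fun s : R => s `^ (c + 1))%R (c + 1)^-1%R z 1%R _
    (is_derive1_powR (c + 1)%R z0).
  move=> h; apply: (is_derive_eq h).
  by rewrite -[LHS]/(_ * _)%R mulrA mulVf// mul1r addrK.
have cpow z e : (0 < z)%R -> {for z, continuous (fun s : R => s `^ e)%R}.
  move=> z0; apply: differentiable_continuous; apply/derivable1_diffP.
  by apply: derivable_powR; rewrite in_itv/= z0.
rewrite (@continuous_FTC2 _ _ (fun s => (c + 1)^-1 * s `^ (c + 1))%R)//.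
- by rewrite -EFinB -mulrBr mulrC.
- apply: continuous_in_subspaceT => z; rewrite inE/= in_itv/= => /andP[xz _].
  by apply: cpow; exact: lt_le_trans xz.
- have cF z : (0 < z)%R -> {for z, continuous (fun s : R => (c + 1)^-1 * s `^ (c + 1))%R}.
    move=> z0; apply: differentiable_continuous; apply/derivable1_diffP.
    by have [] := dF z z0.
  split.
  + move=> z; rewrite in_itv/= => /andP[xz _].
    by have [] := dF z (lt_trans x0 xz).
  + by apply: cvg_at_right_filter; exact: cF.
  + by apply: cvg_at_left_filter; apply: cF; exact: lt_trans xy.
- move=> z; rewrite in_itv/= => /andP[xz _].
  by rewrite derive1E; have [_ ->] := dF z (lt_trans x0 xz).
Qed.

Lemma integral_powR_0 (c y : R) : (0 < c + 1)%R -> (0 < y)%R ->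
  \int[mu]_(s in `]0%R, y]) (s `^ c)%:E <= (y `^ (c + 1) / (c + 1))%:E.
Proof.
move=> c1 y0.
(* With [n.+2] the left end is strictly below [y] already for n = 0, as [integral_powR] requires. *)
pose F n := `[(y / n.+2%:R)%R, y]%classic.
have -> : `]0%R, y]%classic = \bigcup_n F n.
  apply/seteqP; split => s /=.
    rewrite in_itv/= => /andP[s0 sy].
    exists (Num.truncn (y / s)) => //; rewrite /F/= in_itv/= sy andbT.
    rewrite ler_pdivrMr// mulrC -ler_pdivrMr//.
    have := truncnS_gt (y / s); set m := Num.truncn _ => h.
    by rewrite (le_trans (ltW h))// ler_nat.
  move=> [n _]; rewrite /F/= !in_itv/= => /andP[h ->]; rewrite andbT.
  by apply: lt_le_trans h; rewrite divr_gt0.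
apply: integral_bigcup_le => //.
- move=> n; exact: measurable_itv.
- apply/nondecreasing_seqP => n; rewrite subsetEset => s.
  rewrite /F/= !in_itv/= => /andP[h ->]; rewrite andbT (le_trans _ h)//.
  by rewrite ler_pM2l// lef_pV2 ?posrE// ler_nat.
- exact: measurable_powR_EFin.
- by move=> x; rewrite lee_fin powR_ge0.
- move=> n; rewrite /F integral_powR ?gt_eqF//.
  + by rewrite lee_fin ler_pM2r ?invr_gt0// gerBl powR_ge0.
  + by rewrite divr_gt0.
  + by rewrite ltr_pdivrMr// ltr_pMr// ltr1n.
Qed.

Lemma integral_powR_infty (c x : R) : (c + 1 < 0)%R -> (0 < x)%R ->
  \int[mu]_(s in `]x, +oo[) (s `^ c)%:E <= (x `^ (c + 1) / - (c + 1))%:E.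
Proof.
move=> c1 x0.
rewrite integral_itv_obnd_cbnd; last exact: measurable_powR_EFin.
pose F n := `[x, (x + n.+1%:R)%R]%classic.
have -> : `[x, +oo[%classic = \bigcup_n F n.
  apply/seteqP; split => s /=.
    rewrite in_itv/= andbT => xs.
    exists (Num.truncn (s - x)) => //; rewrite /F/= in_itv/= xs/=.
    by rewrite -lerBlDl ltW// truncnS_gt.
  by move=> [n _]; rewrite /F/= !in_itv/= => /andP[-> _].
apply: integral_bigcup_le => //.
- move=> n; exact: measurable_itv.
- apply/nondecreasing_seqP => n; rewrite subsetEset => s.
  rewrite /F/= !in_itv/= => /andP[-> h] /=; rewrite (le_trans h)//.
  by rewrite lerD2l ler_nat.
- exact: measurable_powR_EFin.
- by move=> s; rewrite lee_fin powR_ge0.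
- move=> n; rewrite /F integral_powR ?lt_eqF//.
  + rewrite lee_fin -mulrNN -invrN ler_pM2r ?invr_gt0 ?oppr_gt0// opprB gerBl.
    exact: powR_ge0.
  + by rewrite ltrDl.
Qed.

End real_integrals.

Section half_line_kernel.
Context (R : realType).
Local Notation mu := (@lebesgue_measure R).
Implicit Types (b c t s : R).

(** One-dimensional model of the kernel: [s] is a distance to the boundary. The extension by 0 makes
    it a function on the whole line, to which reflections and translations apply. *)
Definition halfker b c t s : R := if 0 < s then s `^ b * (s + t) `^ (- c) else 0.

Lemma halfker_ge0 b c t s : 0 <= halfker b c t s.
Proof. by rewrite /halfker; case: ifP => // _; rewrite mulr_ge0 ?powR_ge0. Qed.

Lemma measurable_halfker b c d (T : measurableType d) (f g : T -> R) :
  measurable_fun setT f -> measurable_fun setT g ->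
  measurable_fun setT (fun x => halfker b c (f x) (g x)).
Proof.
move=> mf mg; rewrite /halfker; apply: measurable_fun_if => //.
- exact: measurable_fun_ltr.
- apply: measurable_funTS; apply: measurable_funM.
    exact: (measurableT_comp (measurable_powR b)).
  apply: (measurableT_comp (measurable_powR (- c))).
  exact: measurable_funD.
Qed.

(** Split at s = t and bound (s + t)^(-c) by t^(-c) below and by s^(-c) above. The conditions on [b]
    and [c] are convergence at 0 and at infinity, and the two terms of the constant come from the
    two pieces. *)
Lemma integral_halfker b c t : 0 < t -> -1 < b -> b + 1 < c ->
  (\int[mu]_s (halfker b c t s)%:E <=
   (((b + 1)^-1 + (c - b - 1)^-1) * t `^ (b + 1 - c))%:E)%E.
Proof.
move=> t0 b1 bc.
have c0 : 0 < c by lra.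
pose f1 (s : R) := ((s `^ b)%:E * (t `^ (- c))%:E)%E.
pose f2 (s : R) := ((s `^ (b - c))%:E)%E.
have mf1 : measurable_fun [set: R] f1.
  by apply: emeasurable_funM => //; exact: measurable_powR_EFin.
have mf2 : measurable_fun [set: R] f2 by exact: measurable_powR_EFin.
have f10 s : (0 <= f1 s)%E by rewrite mule_ge0// lee_fin powR_ge0.
have f20 s : (0 <= f2 s)%E by rewrite lee_fin powR_ge0.
apply: (@le_trans _ _ (\int[mu]_s
    ((f1 \_ `]0%R, t]) s + (f2 \_ `]t, +oo[) s))%E).
  apply: le_integral_nonmeasurable => s; first by rewrite lee_fin halfker_ge0.
  rewrite /halfker; case: ifPn => [s0|_]; last first.
    by apply: adde_ge0; apply: erestrict_ge0.
  have [st|ts] := leP s t.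
    rewrite !patchE mem_set ?memNset/= ?in_itv/= ?s0 ?adde0//=; last first.
      by apply/negP; rewrite andbT -leNgt.
    rewrite /f1 -EFinM lee_fin ler_wpM2l ?powR_ge0// !powRN lef_pV2 ?posrE ?powR_gt0 ?addr_gt0//.
    by rewrite ge0_ler_powR// ?nnegrE ?ltW// ?addr_gt0// ltrDr.
  rewrite !patchE memNset ?mem_set/= ?in_itv/= ?ts// ?add0e; last first.
    by apply/negP; rewrite s0/= -ltNge.
  rewrite /f2 lee_fin powRD ?(gt_eqF s0) ?implybT//.
  rewrite ler_wpM2l ?powR_ge0// !powRN lef_pV2 ?posrE ?powR_gt0 ?addr_gt0//.
  by rewrite ge0_ler_powR// ?nnegrE ?ltW// ?addr_gt0// ltrDl.
rewrite ge0_integralD//; last 4 first.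
- by move=> s _; apply: erestrict_ge0.
- by apply/(measurable_restrictT f1) => //; exact: measurable_funTS.
- by move=> s _; apply: erestrict_ge0.
- by apply/(measurable_restrictT f2) => //; exact: measurable_funTS.
rewrite -!integral_mkcond mulrDl EFinD; apply: leeD.
  rewrite /f1 ge0_integralZr//; last 3 first.
  - exact: measurable_powR_EFin.
  - by move=> s _; rewrite lee_fin powR_ge0.
  - by rewrite lee_fin powR_ge0.
  have b10 : 0 < b + 1 by lra.
  apply: le_trans (lee_wpmul2r _ (integral_powR_0 b10 t0)) _.
    by rewrite lee_fin powR_ge0.
  rewrite -EFinM lee_fin (@powRD _ t (b + 1) (- c)) ?(gt_eqF t0) ?implybT//.
  by rewrite le_eqVlt; apply/orP; left; apply/eqP; ring.
have bc0 : b - c + 1 < 0 by lra.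
apply: le_trans (integral_powR_infty bc0 t0) _.
rewrite lee_fin (_ : b - c + 1 = b + 1 - c); last by ring.
by rewrite mulrC (_ : - (b + 1 - c) = c - b - 1)//; ring.
Qed.

(** After translation to y = 0, each half-line contributes one copy of the integral of s^(-1-a) over
    s >= t, with s = |v| + t. *)
Lemma integral_shifted_power (y a t : R) : 0 < a -> 0 < t ->
  (\int[mu]_v ((`|v - y| + t) `^ (- 1 - a))%:E <= (2 / a * t `^ (- a))%:E)%E.
Proof.
move=> a0 t0.
pose h := (fun s : R => (s `^ (- 1 - a))%:E) \_ `[t, +oo[.
have mh : measurable_fun [set: R] h.
  by apply/(measurable_restrictT (fun s : R => (s `^ (- 1 - a))%:E)) => //;
    exact: measurable_powR_EFin.
have h0 s : (0 <= h s)%E by apply: erestrict_ge0 => {}s _; rewrite lee_fin powR_ge0.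
rewrite (integral_translation y (f := fun v => ((`|v| + t) `^ (- 1 - a))%:E)).
apply: (@le_trans _ _ (\int[mu]_v (h (v - (- t))%R + h (t - v)%R))%E).
  apply: le_integral_nonmeasurable => v; first by rewrite lee_fin powR_ge0.
  have [v0|v0] := leP 0 v.
    apply: (@le_trans _ _ (h (v - (- t))%R)); last by rewrite leeDl.
    rewrite /h patchE mem_set ?opprK//=; last by rewrite in_itv/= andbT lerDr.
    by rewrite ger0_norm.
  apply: (@le_trans _ _ (h (t - v)%R)); last by rewrite leeDr.
  rewrite /h patchE mem_set//=; last by rewrite in_itv/= andbT lerBrDr gerDl ltW.
  by rewrite ltr0_norm// addrC.
rewrite ge0_integralD//; last 2 first.
- by apply: (measurableT_comp mh); exact: measurable_funB.
- by apply: (measurableT_comp mh); exact: measurable_funB.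
rewrite integral_translation// integral_reflection//.
rewrite -integral_mkcond -integral_itv_obnd_cbnd; last exact: measurable_powR_EFin.
have a1 : - 1 - a + 1 < 0 by lra.
apply: le_trans (leeD (integral_powR_infty a1 t0) (integral_powR_infty a1 t0)) _.
rewrite -EFinD lee_fin (_ : - 1 - a + 1 = - a) ?opprK; last by ring.
have a00 : a != 0 by rewrite gt_eqF.
by rewrite le_eqVlt; apply/orP; left; apply/eqP; field.
apply/measurable_EFinP; apply: (measurableT_comp (measurable_powR (- 1 - a))).
by apply: measurable_funD => //; exact: measurableT_comp.
by move=> x; rewrite lee_fin powR_ge0.
Qed.

End half_line_kernel.

(** * The modulus of the kernel on the disc *)

Section disc_kernel.
Context (R : realType).
Local Notation mu := (@lebesgue_measure R).
Implicit Types (x y u v : R).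

(** The squared modulus of 1 - conj(w) z for z = x + iy and w = u + iv. *)
Definition dker2 x y u v : R :=
  (1 - x * u - y * v) ^+ 2 + (y * u - x * v) ^+ 2.

(** The classical identity |1 - conj(w) z|^2 = |z - w|^2 + (1 - |z|^2)(1 - |w|^2), from which the
    kernel is bounded below by coordinate differences. *)
Lemma dker2E x y u v : dker2 x y u v =
  (x - u) ^+ 2 + (y - v) ^+ 2
  + (1 - (x ^+ 2 + y ^+ 2)) * (1 - (u ^+ 2 + v ^+ 2)).
Proof. by rewrite /dker2; ring. Qed.

Definition dker (z w : plane R) : R := Num.sqrt (dker2 z.1 z.2 w.1 w.2).

(** The first two bounds drop nonnegative terms from [dker2E]. The third bounds the modulus below by
    the real part 1 - xu - yv and uses 2(xu + yv) <= |z|^2 + |w|^2. *)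
Lemma dker_lower x y u v (q := Num.sqrt (dker2 x y u v)) :
  x ^+ 2 + y ^+ 2 < 1 -> u ^+ 2 + v ^+ 2 < 1 ->
  [/\ `|u - x| <= q, `|v - y| <= q &
     (1 - (x ^+ 2 + y ^+ 2)) + (1 - (u ^+ 2 + v ^+ 2)) <= 2 * q].
Proof.
move=> xy uv.
have q0 : 0 <= q by exact: sqrtr_ge0.
have d0 : 0 <= dker2 x y u v by rewrite addr_ge0// sqr_ge0.
have pr : 0 <= (1 - (x ^+ 2 + y ^+ 2)) * (1 - (u ^+ 2 + v ^+ 2)).
  by rewrite mulr_ge0// subr_ge0 ltW.
split.
- rewrite -sqrtr_sqr ler_sqrt// dker2E.
  by have := sqr_ge0 (y - v); nra.
- rewrite -sqrtr_sqr ler_sqrt// dker2E.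
  by have := sqr_ge0 (x - u); nra.
- have h : 1 - x * u - y * v <= q.
    apply: le_trans (ler_norm _) _; rewrite -sqrtr_sqr ler_sqrt//.
    by rewrite lerDl sqr_ge0.
  by have := sqr_ge0 (x - u); have := sqr_ge0 (y - v); nra.
Qed.

Definition halfchord v : R := Num.sqrt (1 - v ^+ 2).

(* On the part of the disc where [v ^+ 2 <= 1/2], the distance [s] to the
   boundary along horizontal lines is comparable to [1 - (u ^+ 2 + v ^+ 2)]. *)
Lemma disc_majorant b c x y u v : 0 < c ->
  x ^+ 2 + y ^+ 2 < 1 -> u ^+ 2 + v ^+ 2 < 1 -> v ^+ 2 <= 1 / 2 ->
  Num.sqrt (dker2 x y u v) `^ (- c) * (1 - (u ^+ 2 + v ^+ 2)) `^ b <=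
  5 `^ c * 2 `^ `|b| * (
    halfker b c (`|v - y| + (1 - (x ^+ 2 + y ^+ 2))) (halfchord v - u) +
    halfker b c (`|v - y| + (1 - (x ^+ 2 + y ^+ 2))) (halfchord v + u)).
Proof.
move=> c0 xy uv v2.
set q := Num.sqrt _; set r := 1 - (u ^+ 2 + v ^+ 2).
set t := _ + (1 - _); set k := halfchord v.
have [_ h2 h3] := dker_lower xy uv; rewrite -/q -/r in h2 h3.
have r0 : 0 < r by rewrite subr_gt0.
have t0 : 0 < t by rewrite ltr_wpDl// subr_gt0.
have q0 : 0 < q by rewrite -(@pmulr_rgt0 _ 2)//; apply: lt_le_trans h3; lra.
have k2 : k ^+ 2 = 1 - v ^+ 2 by rewrite sqr_sqrtr//; lra.
have k0 : 0 <= k by exact: sqrtr_ge0.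
have kl : 1 / 2 <= k by nra.
have ku : k <= 1 by have := sqr_ge0 v; nra.
have C0 : 0 <= 5 `^ c * 2 `^ `|b| by rewrite mulr_ge0 ?powR_ge0.
(* Here w stands for |u|, so that [k - w] is the distance to the nearer end of the chord. *)
have key w : 0 <= w -> w ^+ 2 = u ^+ 2 ->
    q `^ (- c) * r `^ b <= 5 `^ c * 2 `^ `|b| * halfker b c t (k - w).
  move=> w0 wu; set s := k - w.
  have wk : w < k.
    rewrite ltNge; apply/negP => kleu.
    by move: r0; rewrite /r -wu; nra.
  have s0 : 0 < s by rewrite subr_gt0.
  (* As 1/2 <= k <= 1 and 0 <= w < k, the factor [k + w] lies between 1/2 and 2. This two-sided
     comparison of r and s serves both signs of [b] and gives the constant 2^|b|. *)
  have rs : r = s * (k + w) by rewrite /r /s -subr_sqr k2 wu; ring.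
  have rl : s / 2 <= r by rewrite rs ler_pM2l//; lra.
  have ru : r <= 2 * s by rewrite rs [leLHS]mulrC ler_pM2r//; lra.
  have s0' := ltW s0; have r0' := ltW r0; have q0' := ltW q0.
  have rb : r `^ b <= 2 `^ `|b| * s `^ b.
    have [b0|b0] := leP 0 b.
      by rewrite ger0_norm// -powRM// ge0_ler_powR// nnegrE ?mulr_ge0.
    have [be be0 ->] : exists2 be, 0 < be & b = - be.
      by exists (- b); rewrite ?oppr_gt0 ?opprK.
    rewrite normrN gtr0_norm// !powRN ler_pdivlMr ?powR_gt0// mulrC.
    rewrite ler_pdivrMr ?powR_gt0// -powRM//.
    by apply: ge0_ler_powR; rewrite ?nnegrE ?mulr_ge0//; lra.
  (* From s <= 2 r, from r + (1 - |z|^2) <= 2 q and from |v - y| <= q follows s + t <= 5 q. *)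
  have qc : q `^ (- c) <= 5 `^ c * (s + t) `^ (- c).
    have st0 : 0 < s + t by rewrite addr_gt0.
    have st0' := ltW st0.
    rewrite !powRN ler_pdivlMr ?powR_gt0// mulrC ler_pdivrMr ?powR_gt0//.
    rewrite -powRM//.
    apply: ge0_ler_powR; rewrite ?nnegrE ?mulr_ge0//.
      by lra.
    by rewrite /t; lra.
  have -> : halfker b c t s = s `^ b * (s + t) `^ (- c) by rewrite /halfker s0.
  apply: le_trans (ler_pM (powR_ge0 _ _) (powR_ge0 _ _) qc rb) _.
  by rewrite le_eqVlt; apply/orP; left; apply/eqP; ring.
rewrite mulrDr.
have K0 s : 0 <= 5 `^ c * 2 `^ `|b| * halfker b c t s.
  by rewrite mulr_ge0// halfker_ge0.
have [u0|u0] := leP 0 u.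
  by apply: le_trans (key u u0 erefl) _; rewrite lerDl.
have u0' : 0 <= - u by rewrite oppr_ge0 ltW.
apply: le_trans (key (- u) u0' (sqrrN u)) _.
by rewrite opprK lerDr.
Qed.

End disc_kernel.

Section forelli_rudin.
Context (R : realType).
Local Notation mu := (@lebesgue_measure R).
Variables (eta a : R).
Hypothesis a_gt0 : 0 < a.
Hypothesis a_lt : a < eta + 1.
Local Notation b := (eta - a).
Local Notation c := (eta + 2).

(** One term for each end of the horizontal chord at height [v]; [D] will be 1 - |z|^2. *)
Definition halfker2 (y D u v : R) : R :=
  halfker b c (`|v - y| + D) (halfchord v - u) +
  halfker b c (`|v - y| + D) (halfchord v + u).

Lemma halfker2_ge0 y D u v : 0 <= halfker2 y D u v.
Proof. by rewrite addr_ge0 ?halfker_ge0. Qed.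

Lemma measurable_halfker2 d (T : measurableType d) (f g : T -> R) y D :
  measurable_fun setT f -> measurable_fun setT g ->
  measurable_fun setT (fun x => halfker2 y D (f x) (g x)).
Proof.
move=> mf mg.
have mk : measurable_fun setT (fun x => halfchord (g x)).
  apply: (@measurableT_comp _ _ _ _ _ _ (@Num.sqrt R)).
    by apply: continuous_measurable_fun; exact: sqrt_continuous.
  by apply: measurable_funB => //; exact: measurable_funX.
have mn : measurable_fun setT (fun x => `|g x - y| + D).
  apply: measurable_funD => //; apply: measurableT_comp => //.
  exact: measurable_funB.
apply: measurable_funD; apply: measurable_halfker => //.
  exact: measurable_funB.
exact: measurable_funD.
Qed.

(** The factor 2 for the two ends of a chord, times the constants of [integral_halfker] and
    [integral_shifted_power]. *)
Definition frC : R := 2 * ((b + 1)^-1 + (c - b - 1)^-1) * (2 / a).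

(** Here b + 1 - c = -1 - a, so the integral along a chord leaves a multiple of (|v - y| +
    D)^(-1-a), which is integrable in [v]. *)
Lemma integral_halfker2 y D : 0 < D ->
  (\int[mu]_v \int[mu]_u (halfker2 y D u v)%:E <= (frC * D `^ (- a))%:E)%E.
Proof.
move=> D0; set C := (b + 1)^-1 + (c - b - 1)^-1.
have a0 := a_gt0; have al := a_lt.
have C0 : 0 <= C by rewrite addr_ge0// invr_ge0; lra.
apply: (@le_trans _ _ (\int[mu]_v ((2 * C)%:E *
    ((`|v - y| + D) `^ (- 1 - a))%:E))%E).
  apply: le_integral_nonmeasurable => v.
    by apply: integral_ge0 => u _; rewrite lee_fin halfker2_ge0.
  set t := `|v - y| + D; set k := halfchord v.
  have t0 : 0 < t by rewrite ltr_wpDl.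
  have hm : measurable_fun [set: measurableTypeR R] (fun s => (halfker b c t s)%:E).
    by apply/measurable_EFinP; apply: measurable_halfker.
  have hp s : (0 <= (halfker b c t s)%:E)%E by rewrite lee_fin halfker_ge0.
  under eq_integral do rewrite /halfker2 -/t -/k EFinD.
  rewrite ge0_integralD//; last 2 first.
  - apply/measurable_EFinP; apply: measurable_halfker => //.
    exact: measurable_funB.
  - apply/measurable_EFinP; apply: measurable_halfker => //.
    exact: measurable_funD.
  rewrite (integral_reflection k (f := fun s => (halfker b c t s)%:E))//.
  have -> : (\int[mu]_u (halfker b c t (k + u))%:E =
      \int[mu]_s (halfker b c t s)%:E)%E.
    have <- := integral_translation (- k) hm hp.
    by apply: eq_integral => u _; rewrite opprK (addrC u).
  have b1 : - 1 < b by lra.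
  have bc : b + 1 < c by lra.
  apply: le_trans (leeD (integral_halfker t0 b1 bc) (integral_halfker t0 b1 bc)) _.
  rewrite -EFinD -EFinM lee_fin -/C (_ : b + 1 - c = - 1 - a); last by ring.
  by rewrite le_eqVlt; apply/orP; left; apply/eqP; ring.
rewrite ge0_integralZl//; last 3 first.
- apply/measurable_EFinP; apply: (measurableT_comp (measurable_powR (- 1 - a))).
  apply: measurable_funD => //; apply: measurableT_comp => //.
  exact: measurable_funB.
- by move=> v _; rewrite lee_fin powR_ge0.
- by rewrite lee_fin mulr_ge0.
apply: le_trans (lee_wpmul2l _ (integral_shifted_power y a_gt0 D0)) _.
  by rewrite lee_fin mulr_ge0.
by rewrite -EFinM lee_fin /frC -/C !mulrA.
Qed.

(** Every point of the disc has a coordinate of square at most 1/2, so the horizontal or the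
    vertical majorant applies there. Their sum is integrated by Tonelli, each term in the order
    adapted to it. *)
Lemma forelli_rudin : exists2 C : R, 0 < C & forall z : plane R, disc z ->
  (\int[@plane_lebesgue R]_(w in @disc R)
      (dker z w `^ (- c) * (1 - absq w) `^ b)%:E <=
    (C * (1 - absq z) `^ (- a))%:E)%E.
Proof.
have a0 := a_gt0; have al := a_lt.
pose C0 := 5 `^ c * 2 `^ `|b|.
have c0 : 0 < c by lra.
have C00 : 0 < C0 by rewrite mulr_gt0 ?powR_gt0.
have frC0 : 0 < frC by rewrite !mulr_gt0// ?addr_gt0 ?invr_gt0//; lra.
exists (C0 * (frC + frC)) => [|z dz]; first by rewrite mulr_gt0// addr_gt0.
pose x : R := z.1; pose y : R := z.2; pose D := 1 - (x ^+ 2 + y ^+ 2).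
have D0 : 0 < D by rewrite subr_gt0.
pose M1 (w : plane R) := (halfker2 y D w.1 w.2)%:E.
pose M2 (w : plane R) := (halfker2 x D w.2 w.1)%:E.
have mM1 : measurable_fun setT M1.
  by apply/measurable_EFinP; apply: measurable_halfker2.
have mM2 : measurable_fun setT M2.
  by apply/measurable_EFinP; apply: measurable_halfker2.
have M10 w : (0 <= M1 w)%E by rewrite lee_fin halfker2_ge0.
have M20 w : (0 <= M2 w)%E by rewrite lee_fin halfker2_ge0.
rewrite integral_mkcond.
apply: (@le_trans _ _ (\int[@plane_lebesgue R]_w (C0%:E * (M1 w + M2 w)))%E).
  apply: le_integral_nonmeasurable => w.
    by apply: erestrict_ge0 => {}w _; rewrite lee_fin mulr_ge0 ?powR_ge0.
  rewrite patchE; case: ifPn => [/set_mem dw|_]; last first.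
    by rewrite mule_ge0 ?adde_ge0// lee_fin ltW.
  pose u : R := w.1; pose v : R := w.2.
  have uv : u ^+ 2 + v ^+ 2 < 1 by exact: dw.
  have xy : x ^+ 2 + y ^+ 2 < 1 by exact: dz.
  rewrite -EFinD -EFinM lee_fin.
  have [v2|v2] := leP (v ^+ 2) (1 / 2).
    apply: le_trans (disc_majorant b c0 xy uv v2) _.
    by rewrite -/C0 ler_pM2l// lerDl halfker2_ge0.
  have u2 : u ^+ 2 <= 1 / 2 by lra.
  have yx : y ^+ 2 + x ^+ 2 < 1 by rewrite addrC.
  have vu : v ^+ 2 + u ^+ 2 < 1 by rewrite addrC.
  have := disc_majorant b c0 yx vu u2.
  have -> : dker2 y x v u = dker2 x y u v by rewrite /dker2; ring.
  rewrite (addrC (v ^+ 2)) (addrC (y ^+ 2)) => h.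
  apply: le_trans h _.
  by rewrite -/C0 ler_pM2l// lerDr halfker2_ge0.
rewrite ge0_integralZl//; last 3 first.
- exact: emeasurable_funD.
- by move=> w _; rewrite adde_ge0.
- by rewrite lee_fin ltW.
rewrite ge0_integralD//.
have I1 : (\int[@plane_lebesgue R]_w M1 w <= (frC * D `^ (- a))%:E)%E.
  by rewrite /plane_lebesgue fubini_tonelli2//; exact: integral_halfker2.
have I2 : (\int[@plane_lebesgue R]_w M2 w <= (frC * D `^ (- a))%:E)%E.
  by rewrite /plane_lebesgue fubini_tonelli1//; exact: integral_halfker2.
apply: le_trans (lee_wpmul2l _ (leeD I1 I2)) _; first by rewrite lee_fin ltW.
by rewrite -EFinD -EFinM lee_fin -mulrDl mulrA.
Qed.

End forelli_rudin.

(** * Schur's test *)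

Section schur.
Context d (T : measurableType d) (R : realType).
Variable mu : {sigma_finite_measure set T -> \bar R}.
Local Open Scope ereal_scope.

(** The Hölder inequality raised to the power p, with p/q = p - 1; this form is the one iterated in
    Schur's test. *)
Lemma hoelder_powR (p q : R) (f g : T -> R) :
  (1 < p)%R -> (0 < q)%R -> (p^-1 + q^-1 = 1)%R ->
  measurable_fun setT f -> measurable_fun setT g ->
  (forall x, 0 <= f x)%R -> (forall x, 0 <= g x)%R ->
  (\int[mu]_x (f x * g x)%:E) `^ p <=
  (\int[mu]_x (f x `^ q)%:E) `^ (p - 1) * \int[mu]_x (g x `^ p)%:E.
Proof.
move=> p1 q0 pq mf mg f0 g0.
have p0 : (0 < p)%R by rewrite (lt_trans ltr01).
have p_0 : p != 0%R by rewrite gt_eqF.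
have q_0 : q != 0%R by rewrite gt_eqF.
have qp : (q^-1 * p = p - 1)%R.
  have -> : (q^-1 = 1 - p^-1)%R by rewrite -pq; ring.
  by field.
have qp' : (q^-1 + p^-1 = 1)%R by rewrite addrC.
have := hoelder mu mf mg q0 p0 qp'.
rewrite Lnorm1 unlock /=.
have -> : \int[mu]_x `|((f \* g)%R x)%:E| = \int[mu]_x (f x * g x)%:E.
  by apply: eq_integral => x _; rewrite gee0_abs// lee_fin mulr_ge0.
have -> : \int[mu]_x `|(f x)%:E| `^ q = \int[mu]_x (f x `^ q)%:E.
  by apply: eq_integral => x _; rewrite gee0_abs ?lee_fin// poweR_EFin.
have -> : \int[mu]_x `|(g x)%:E| `^ p = \int[mu]_x (g x `^ p)%:E.
  by apply: eq_integral => x _; rewrite gee0_abs ?lee_fin// poweR_EFin.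
set A := \int[mu]_x _; set B := \int[mu]_x _; set C := \int[mu]_x _.
have A0 : 0 <= A by apply: integral_ge0 => x _; rewrite lee_fin mulr_ge0.
have B0 : 0 <= B by apply: integral_ge0 => x _; rewrite lee_fin powR_ge0.
have C0 : 0 <= C by apply: integral_ge0 => x _; rewrite lee_fin powR_ge0.
move=> ABC.
have := gt0_ler_poweR (ltW p0) _ _ ABC.
rewrite !in_itv/= !leey !andbT => /(_ A0) h.
apply: le_trans (h _) _; first by rewrite mule_ge0// poweR_ge0.
rewrite poweRM; [|exact: poweR_ge0|exact: poweR_ge0].
by rewrite -(poweRrM B) -(poweRrM C) qp mulVf// poweRe1.
Qed.

Variables (p q : R) (k : T * T -> R) (h : T -> R) (C : R).
Hypothesis p1 : (1 < p)%R.
Hypothesis q0 : (0 < q)%R.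
Hypothesis pq : (p^-1 + q^-1 = 1)%R.
Hypothesis k0 : forall x, (0 <= k x)%R.
Hypothesis mk : measurable_fun setT k.
Hypothesis h0 : forall x, (0 < h x)%R.
Hypothesis mh : measurable_fun setT h.
Hypothesis C0 : (0 < C)%R.
Hypothesis kh1 : forall z,
  \int[mu]_w (k (z, w) * h w `^ q)%:E <= (C * h z `^ q)%:E.
Hypothesis kh2 : forall w,
  \int[mu]_z (k (z, w) * h z `^ p)%:E <= (C * h w `^ p)%:E.

(** Write k phi as the product of k^(1/q) h and k^(1/p) phi / h. Hölder in w and [kh1] bound the
    inner integral, where h^(q(p-1)) = h^p; after Tonelli, [kh2] absorbs the power of h. *)
Lemma schur_test (phi : T -> R) :
  measurable_fun setT phi -> (forall x, 0 <= phi x)%R ->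
  \int[mu]_z (\int[mu]_w (k (z, w) * phi w)%:E) `^ p <=
  (C `^ p)%:E * \int[mu]_w (phi w `^ p)%:E.
Proof.
move=> mphi phi0.
have p0 : (0 < p)%R by rewrite (lt_trans ltr01).
have p_0 : p != 0%R by rewrite gt_eqF.
have q_0 : q != 0%R by rewrite gt_eqF.
have qE : (q * (p - 1) = p)%R.
  have pqE : (p + q = p * q)%R.
    by rewrite -[RHS]mulr1 -pq; field; rewrite p_0 q_0.
  by rewrite mulrBr mulr1 (mulrC q) -pqE addrK.
have kn x e : (0 <= k x `^ e)%R by exact: powR_ge0.
have mk1 z : measurable_fun setT (fun w => k (z, w)).
  exact: measurableT_comp mk (pair1_measurable z).
have mhx e : measurable_fun setT (fun w => h w `^ e)%R.
  exact: (measurableT_comp (measurable_powR e)).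
pose G (x : T * T) := (k x * (phi x.2 * h x.2 `^ (- 1)) `^ p)%R.
have mG : measurable_fun setT G.
  apply: measurable_funM => //.
  apply: (measurableT_comp (measurable_powR p)); apply: measurable_funM.
    exact: measurableT_comp.
  exact: (measurableT_comp (mhx (- 1)%R)).
have G0 x : (0 <= G x)%R by rewrite mulr_ge0 ?powR_ge0.
have step z : (\int[mu]_w (k (z, w) * phi w)%:E) `^ p <=
    (C `^ (p - 1) * h z `^ p)%:E * \int[mu]_w (G (z, w))%:E.
  pose f w := (k (z, w) `^ q^-1 * h w)%R.
  pose g w := (k (z, w) `^ p^-1 * (phi w * h w `^ (- 1)))%R.
  have fg w : (k (z, w) * phi w = f w * g w)%R.
    have [kz|kz] := eqVneq (k (z, w)) 0%R.
      by rewrite /f /g kz !powR0 ?invr_eq0// !mul0r.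
    rewrite /f /g mulrACA -powRD ?kz ?implybT// (addrC (q^-1)%R) pq powRr1//.
    rewrite powR_inv1 ?ltW//; have hw0 : h w != 0%R by rewrite gt_eqF.
    by field.
  have mf : measurable_fun setT f.
    apply: measurable_funM => //.
    exact: (measurableT_comp (measurable_powR (q^-1)%R)).
  have mg : measurable_fun setT g.
    apply: measurable_funM.
      exact: (measurableT_comp (measurable_powR (p^-1)%R)).
    exact: measurable_funM.
  under eq_integral do rewrite fg.
  have f0 w : (0 <= f w)%R by rewrite mulr_ge0 ?powR_ge0 ?ltW.
  have g0 w : (0 <= g w)%R by rewrite mulr_ge0 ?mulr_ge0 ?powR_ge0.
  apply: le_trans (hoelder_powR p1 q0 pq mf mg f0 g0) _.
  have -> : \int[mu]_w (g w `^ p)%:E = \int[mu]_w (G (z, w))%:E.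
    apply: eq_integral => w _; congr EFin.
    rewrite /g powRM ?mulr_ge0 ?powR_ge0// -powRrM mulVf// powRr1//.
  have -> : \int[mu]_w (f w `^ q)%:E = \int[mu]_w (k (z, w) * h w `^ q)%:E.
    apply: eq_integral => w _; congr EFin.
    by rewrite /f powRM ?powR_ge0 ?ltW// -powRrM mulVf// powRr1.
  apply: lee_wpmul2r.
    by apply: integral_ge0 => w _; rewrite lee_fin.
  have -> : (C `^ (p - 1) * h z `^ p)%:E = (C * h z `^ q)%:E `^ (p - 1).
    by rewrite poweR_EFin powRM ?powR_ge0 ?ltW// -powRrM qE.
  have p10 : (0 <= p - 1)%R by rewrite subr_ge0 ltW.
  apply: (gt0_ler_poweR p10) => //; rewrite in_itv/= leey andbT.
    by apply: integral_ge0 => w _; rewrite lee_fin mulr_ge0 ?powR_ge0.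
  by rewrite lee_fin mulr_ge0 ?powR_ge0// ltW.
apply: (@le_trans _ _ (\int[mu]_z
    ((C `^ (p - 1))%:E * \int[mu]_w (h z `^ p * G (z, w))%:E))).
  apply: le_integral_nonmeasurable => z; first exact: poweR_ge0.
  apply: le_trans (step z) _.
  under [in leRHS]eq_integral do rewrite EFinM.
  rewrite ge0_integralZl//; last 3 first.
  - apply/measurable_EFinP.
    exact: measurableT_comp mG (pair1_measurable z).
  - by move=> w _; rewrite lee_fin.
  - by rewrite lee_fin powR_ge0.
  by rewrite muleA -EFinM.
pose F (x : T * T) := (h x.1 `^ p * G x)%R.
have F0 x : (0 <= F x)%R by rewrite mulr_ge0 ?powR_ge0.
have mF : measurable_fun setT F.
  apply: measurable_funM => //.
  exact: (measurableT_comp (mhx p)).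
have mFE : measurable_fun setT (EFin \o F) by exact/measurable_EFinP.
have FE0 x : 0 <= (EFin \o F) x by rewrite lee_fin.
rewrite ge0_integralZl//; last 3 first.
- exact: (@measurable_fun_fubini_tonelli_F _ _ _ _ _ mu (EFin \o F)).
- by move=> z _; apply: integral_ge0 => w _; exact: (FE0 (z, w)).
- by rewrite lee_fin powR_ge0.
have -> : \int[mu]_z \int[mu]_w (h z `^ p * G (z, w))%:E =
    \int[mu]_w \int[mu]_z (h z `^ p * G (z, w))%:E.
  exact: (fubini_tonelli (EFin \o F)).
have -> : (C `^ p)%:E * \int[mu]_w (phi w `^ p)%:E =
    (C `^ (p - 1))%:E * (C%:E * \int[mu]_w (phi w `^ p)%:E).
  rewrite muleA -EFinM (mulrC _ C) mulr_powRB1 ?ltW//. 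
apply: lee_wpmul2l; first by rewrite lee_fin powR_ge0.
have <- : \int[mu]_w (C%:E * (phi w `^ p)%:E) =
    C%:E * \int[mu]_w (phi w `^ p)%:E.
  rewrite ge0_integralZl//.
  - by apply/measurable_EFinP; exact: (measurableT_comp (measurable_powR p)).
  - by move=> w _; rewrite lee_fin powR_ge0.
  - by rewrite lee_fin ltW.
apply: le_integral_nonmeasurable => w.
  by apply: integral_ge0 => z _; exact: (FE0 (z, w)).
pose a := ((phi w * h w `^ (- 1)) `^ p)%R.
have a0 : (0 <= a)%R by exact: powR_ge0.
have -> : \int[mu]_z (h z `^ p * G (z, w))%:E =
    a%:E * \int[mu]_z (k (z, w) * h z `^ p)%:E.
  transitivity (\int[mu]_z (a%:E * (k (z, w) * h z `^ p)%:E)).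
    apply: eq_integral => z _; rewrite -EFinM; congr EFin.
    by rewrite /G /= -/a; ring.
  rewrite ge0_integralZl//.
  - apply/measurable_EFinP; apply: measurable_funM => //.
    exact: measurableT_comp mk (pair2_measurable w).
  - by move=> z _; rewrite lee_fin mulr_ge0 ?powR_ge0.
apply: le_trans (lee_wpmul2l _ (kh2 w)) _; first by rewrite lee_fin.
rewrite -!EFinM lee_fin /a powRM ?powR_ge0// -powRrM mulN1r powRN.
rewrite mulrCA -mulrA mulVf ?mulr1//.
by rewrite gt_eqF// powR_gt0.
Qed.

End schur.

(** * The Bergman projection *)

Section bergman_measure.
Context (R : realType) (eta : R) (heta : -1 < eta).
Local Notation mu := (mu_eta heta).
Local Notation leb := (@plane_lebesgue R).

Lemma absq_ge0 (z : plane R) : 0 <= absq z.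
Proof. by rewrite addr_ge0 ?sqr_ge0. Qed.

Lemma mu_eta_integral (f : plane R -> \bar R) :
  measurable_fun setT f -> (forall x, (0 <= f x)%E) ->
  (\int[mu]_z f z = \int[leb]_(z in @disc R) (f z * (bergman_density eta z)%:E))%E.
Proof.
move=> mf f0; apply: ge0_integral_density => //.
- exact: measurable_disc.
- exact: bergman_density_ge0.
- exact: measurable_bergman_density.
Qed.

Lemma mu_eta_discC : mu (~` @disc R) = 0%E.
Proof. by rewrite /= /mu_eta setICl integral_set0. Qed.

Lemma mu_eta_le_disc (f g : plane R -> \bar R) : measurable_fun setT f ->
  (forall z, (0 <= f z)%E) -> (forall z, (0 <= g z)%E) ->
  (forall z, disc z -> (f z <= g z)%E) ->
  (\int[mu]_z f z <= \int[mu]_z g z)%E.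
Proof.
move=> mf f0 g0 fg.
apply: (@ae_le_integral_nonmeasurable _ _ _ mu (~` @disc R)) => //.
- by apply: measurableC; exact: measurable_disc.
- exact: mu_eta_discC.
- by move=> z /contrapT; exact: fg.
Qed.

Lemma measurable_dker d (T : measurableType d) (f g : T -> plane R) :
  measurable_fun setT f -> measurable_fun setT g ->
  measurable_fun setT (fun x => dker (f x) (g x)).
Proof.
move=> mf mg.
have m1 (h : T -> plane R) : measurable_fun setT h ->
    measurable_fun setT (fun x => (h x).1 : R).
  by move=> mh; exact: measurableT_comp.
have m2 (h : T -> plane R) : measurable_fun setT h ->
    measurable_fun setT (fun x => (h x).2 : R).
  by move=> mh; exact: measurableT_comp.
rewrite /dker; apply: (@measurableT_comp _ _ _ _ _ _ (@Num.sqrt R)).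
  by apply: continuous_measurable_fun; exact: sqrt_continuous.
apply: measurable_funD; apply: measurable_funX.
  apply: measurable_funB.
    by apply: measurable_funB => //; apply: measurable_funM; [exact: m1|exact: m1].
  by apply: measurable_funM; [exact: m2|exact: m2].
by apply: measurable_funB; apply: measurable_funM; [exact: m2|exact: m1|exact: m1|exact: m2].
Qed.

Lemma dkerC (z w : plane R) : dker z w = dker w z.
Proof. by rewrite /dker; congr Num.sqrt; rewrite /dker2; ring. Qed.

Lemma measurable_rho_pow d (T : measurableType d) (f : T -> plane R) s :
  measurable_fun setT f ->
  measurable_fun setT (fun x => (1 - absq (f x)) `^ s).
Proof.
move=> mf; apply: (measurableT_comp (measurable_powR s)).
apply: measurable_funB => //; exact: (measurableT_comp (@measurable_absq R)).
Qed.

(** The density contributes (1 - |w|^2)^eta, which turns the exponent -a into the eta - a of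
    [forelli_rudin]. *)
Lemma mu_eta_forelli_rudin a : 0 < a -> a < eta + 1 ->
  exists2 C : R, 0 < C & forall z : plane R, disc z ->
  (\int[mu]_w (dker z w `^ (- (eta + 2)) * (1 - absq w) `^ (- a))%:E <=
    (C * (1 - absq z) `^ (- a))%:E)%E.
Proof.
move=> a0 aeta; have [C C0 hC] := forelli_rudin a0 aeta.
have c0 : 0 < (eta + 1) * pi^-1 by rewrite mulr_gt0 ?invr_gt0 ?pi_gt0//; lra.
exists ((eta + 1) * pi^-1 * C) => [|z dz]; first exact: mulr_gt0.
have mk : measurable_fun setT (fun w : plane R => dker z w `^ (- (eta + 2))).
  by apply: (measurableT_comp (measurable_powR _)); exact: measurable_dker.
rewrite mu_eta_integral; last 2 first.
- by apply/measurable_EFinP; apply: measurable_funM => //; exact: measurable_rho_pow.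
- by move=> w; rewrite lee_fin mulr_ge0 ?powR_ge0.
apply: (@le_trans _ _ (\int[leb]_(w in @disc R) (((eta + 1) * pi^-1)%:E *
    (dker z w `^ (- (eta + 2)) * (1 - absq w) `^ (eta - a))%:E))%E).
  rewrite le_eqVlt; apply/orP; left; apply/eqP; apply: eq_integral => w /set_mem dw.
  have r0 : 1 - absq w != 0 by rewrite subr_eq0 gt_eqF.
  rewrite -!EFinM; congr EFin; rewrite /bergman_density.
  by rewrite (@powRD _ _ eta (- a)) ?r0 ?implybT//; ring.
rewrite ge0_integralZl//; last 4 first.
- exact: measurable_disc.
- apply/measurable_funTS/measurable_EFinP; apply: measurable_funM => //.
  exact: measurable_rho_pow.
- by move=> w _; rewrite lee_fin mulr_ge0 ?powR_ge0.
- by rewrite lee_fin ltW.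
apply: le_trans (lee_wpmul2l _ (hC z dz)) _; first by rewrite lee_fin ltW.
by rewrite -EFinM lee_fin !mulrA.
Qed.

(** The preceding estimate at z = 0, where the kernel is 1, dominates the total mass because (1 -
    |w|^2)^(-a) >= 1 on the disc. *)
Lemma mu_eta_lty : (mu setT < +oo)%E.
Proof.
have a0 : 0 < (eta + 1) / 2 by rewrite divr_gt0//; move: heta; lra.
have aeta : (eta + 1) / 2 < eta + 1 by move: heta; lra.
have [C C0 hC] := mu_eta_forelli_rudin a0 aeta.
pose o : plane R := (0, 0).
have od : disc o by rewrite /disc/= /absq expr0n addr0.
have dker0 w : dker o w = 1.
  by rewrite /dker /dker2/= !mul0r !subr0 expr0n/= addr0 expr1n sqrtr1.
apply: le_lt_trans (ltry _); apply: le_trans (hC o od).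
have -> : (mu setT = \int[mu]_w (cst 1 w))%E by rewrite integral_cst// mul1e.
apply: mu_eta_le_disc => //= [w|w dw].
  by rewrite lee_fin mulr_ge0 ?powR_ge0.
rewrite lee_fin dker0 powR1 mul1r powRN.
have r0 : 0 < 1 - absq w by rewrite subr_gt0.
rewrite invf_ge1 ?powR_gt0//.
have r1 : 0 < 1 - absq w <= 1 by rewrite r0/= gerBl absq_ge0.
by have := ger_powR r1 (ltW a0); rewrite powRr0.
Qed.

HB.instance Definition _ := @Measure_isFinite.Build _ _ R mu
  (lty_fin_num_fun mu_eta_lty).

End bergman_measure.


(** * Modulus and measurability of the Bergman kernel *)

Section bergman_kernel_lemmas.
Context (R : realType).

Lemma cabsM (x y : R[i]) : cabs (x * y) = cabs x * cabs y.
Proof.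
by have := ComplexField.Normc.normcM x y; case: x => ? ?; case: y => ? ?.
Qed.

Lemma cabsV (x : R[i]) : cabs x^-1 = (cabs x)^-1.
Proof.
have := ComplexField.Normc.normcV x; rewrite /cabs.
by case: x => a b h; exact: h.
Qed.

Lemma cabs_cpow (w : R[i]) s : cabs (cpow w s) = cabs w `^ s.
Proof.
rewrite /cpow cabsM /cabs/= cos2Dsin2 sqrtr1 mulr1 expr0n/= addr0 sqrtr_sqr.
by rewrite ger0_norm// powR_ge0.
Qed.

Lemma kernel_baseE (z w : plane R) : 1 - Num.conj (toC w) * toC z =
  Complex (1 - z.1 * w.1 - z.2 * w.2) (z.1 * w.2 - z.2 * w.1).
Proof.
by apply/eqP; rewrite eq_complex /=; apply/andP; split; apply/eqP; ring.
Qed.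

Lemma cabs_bergman_kernel eta (z w : plane R) :
  cabs (bergman_kernel eta z w) = dker z w `^ (- (eta + 2)).
Proof.
rewrite /bergman_kernel cabsV cabs_cpow powRN kernel_baseE /cabs /dker /dker2/=.
by congr ((Num.sqrt _ `^ _)^-1); ring.
Qed.

Lemma measurable_funVr d (T : measurableType d) (f : T -> R) :
  measurable_fun setT f -> measurable_fun setT (fun x => (f x)^-1).
Proof.
move=> mf.
(* The exponent -1 of [powR] is inversion on nonnegative reals only, hence the square; at a zero of
   [f] both sides are 0. *)
have -> : (fun x => (f x)^-1) = (fun x => f x * (f x ^+ 2) `^ (- 1)).
  apply/funext => x; rewrite powR_inv1 ?sqr_ge0//.
  have [->|fx0] := eqVneq (f x) 0; first by rewrite invr0 mul0r.
  by field.
apply: measurable_funM => //.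
apply: (measurableT_comp (measurable_powR (- 1))).
exact: measurable_funX.
Qed.

Section measurability.
Context d (T : measurableType d) (f g : T -> plane R) (eta : R).
Hypothesis mf : measurable_fun setT f.
Hypothesis mg : measurable_fun setT g.

Let re x : R := 1 - (f x).1 * (g x).1 - (f x).2 * (g x).2.
Let im x : R := (f x).1 * (g x).2 - (f x).2 * (g x).1.
Let rad x : R := Num.sqrt (re x ^+ 2 + im x ^+ 2) `^ (eta + 2).
Let arg x : R := (eta + 2) * atan (im x / re x).

Let m1 (h : T -> plane R) : measurable_fun setT h ->
  measurable_fun setT (fun x => (h x).1 : R).
Proof. by move=> mh; exact: measurableT_comp. Qed.

Let m2 (h : T -> plane R) : measurable_fun setT h ->
  measurable_fun setT (fun x => (h x).2 : R).
Proof. by move=> mh; exact: measurableT_comp. Qed.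

Let mre : measurable_fun setT re.
Proof.
apply: measurable_funB.
  by apply: measurable_funB => //; apply: measurable_funM; exact: m1.
by apply: measurable_funM; exact: m2.
Qed.

Let mim : measurable_fun setT im.
Proof.
by apply: measurable_funB; apply: measurable_funM; [exact: m1|exact: m2|
  exact: m2|exact: m1].
Qed.

Let mrad : measurable_fun setT rad.
Proof.
apply: (measurableT_comp (measurable_powR _)).
apply: (@measurableT_comp _ _ _ _ _ _ (@Num.sqrt R)).
  by apply: continuous_measurable_fun; exact: sqrt_continuous.
by apply: measurable_funD; exact: measurable_funX.
Qed.

Let marg : measurable_fun setT arg.
Proof.
apply: measurable_funM => //.
apply: (@measurableT_comp _ _ _ _ _ _ (@atan R)).
  by apply: continuous_measurable_fun => x; exact: continuous_atan.
apply: measurable_funM => //; exact: measurable_funVr.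
Qed.

Let mcos : measurable_fun setT (fun x => cos (arg x)).
Proof.
apply: (@measurableT_comp _ _ _ _ _ _ (@cos R)) => //.
by apply: continuous_measurable_fun; exact: continuous_cos.
Qed.

Let msin : measurable_fun setT (fun x => sin (arg x)).
Proof.
apply: (@measurableT_comp _ _ _ _ _ _ (@sin R)) => //.
by apply: continuous_measurable_fun; exact: continuous_sin.
Qed.

Let kerE x : bergman_kernel eta (f x) (g x) =
  (Complex (rad x * cos (arg x)) (rad x * sin (arg x)))^-1.
Proof.
rewrite /bergman_kernel kernel_baseE /cpow/= -/(re x) -/(im x) -/(rad x) -/(arg x).
congr (_^-1); apply/eqP; rewrite eq_complex /=.
by apply/andP; split; apply/eqP; ring.
Qed.

Lemma measurable_Re_bergman_kernel :
  measurable_fun setT (fun x => complex.Re (bergman_kernel eta (f x) (g x))).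
Proof.
under eq_fun do rewrite kerE/=.
apply: measurable_funM; first exact: measurable_funM.
apply: measurable_funVr; apply: measurable_funD; apply: measurable_funX;
  exact: measurable_funM.
Qed.

Lemma measurable_Im_bergman_kernel :
  measurable_fun setT (fun x => complex.Im (bergman_kernel eta (f x) (g x))).
Proof.
under eq_fun do rewrite kerE/=.
apply: measurableT_comp => //.
apply: measurable_funM; first exact: measurable_funM.
apply: measurable_funVr; apply: measurable_funD; apply: measurable_funX;
  exact: measurable_funM.
Qed.

End measurability.

Lemma dker_ge_disc (z w : plane R) : disc z -> disc w ->
  (1 - absq z) / 2 <= dker z w.
Proof.
move=> dz dw.
have [_ _ h] := dker_lower (dz : z.1 ^+ 2 + z.2 ^+ 2 < 1) (dw : w.1 ^+ 2 + w.2 ^+ 2 < 1).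
have r0 : 0 < 1 - (w.1 ^+ 2 + w.2 ^+ 2) by rewrite subr_gt0.
by rewrite ler_pdivrMr// mulrC; apply: le_trans h; rewrite lerDl ltW.
Qed.

Lemma bergman_kernel_bound eta (z w : plane R) : -1 < eta -> disc z -> disc w ->
  dker z w `^ (- (eta + 2)) <= ((1 - absq z) / 2) `^ (- (eta + 2)).
Proof.
move=> heta dz dw; have r0 : 0 < (1 - absq z) / 2 by rewrite divr_gt0// subr_gt0.
have d0 : 0 < dker z w by exact: lt_le_trans (dker_ge_disc dz dw).
have e0 : 0 <= eta + 2 by lra.
rewrite !powRN lef_pV2 ?posrE ?powR_gt0//.
by apply: ge0_ler_powR; rewrite ?nnegrE ?(ltW r0) ?(ltW d0)//; exact: dker_ge_disc.
Qed.

End bergman_kernel_lemmas.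

(** * The projection of integrable vector-valued functions *)

Section bergman_operator.
Context (R : realType) (eta : R) (heta : -1 < eta) (H : hilbertType R).
Hypothesis sepH : separable H.
Local Notation mu := (mu_eta heta).
Implicit Types (f g : plane R -> H) (z w : plane R).

(** The choice is harmless, since a weak integral is unique; for integrable [f] it exists and is the
    Bochner integral, by [bergman_opP]. The value 0 off the disc gives a function that is measurable
    on the whole plane. *)
Definition bergman_op f z : H :=
  if z \in @disc R
  then xget 0 [set v | weak_integral mu (fun w => bergman_kernel eta z w *: f w) v]
  else 0.

Let wmeas_ker f z : wmeas f -> wmeas (fun w => bergman_kernel eta z w *: f w).
Proof.
move=> mf; apply: wmeasZ => //.
  exact: (@measurable_Re_bergman_kernel _ _ _ (fun=> z) id).
exact: (@measurable_Im_bergman_kernel _ _ _ (fun=> z) id).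
Qed.

Let mkappa z : measurable_fun setT (fun w => dker z w `^ (- (eta + 2))).
Proof. by apply: (measurableT_comp (measurable_powR _)); exact: measurable_dker. Qed.

(** For a fixed z in the disc the kernel is bounded in w. *)
Lemma kernel_norm_integrable f z : norm_integrable mu f -> disc z ->
  norm_integrable mu (fun w => bergman_kernel eta z w *: f w).
Proof.
move=> [mf fi] dz; split; first exact: wmeas_ker.
apply: (@le_lt_trans _ _ (\int[mu]_w
   ((((1 - absq z) / 2) `^ (- (eta + 2)))%:E * (hnorm (f w))%:E))%E).
  apply: mu_eta_le_disc => [|w|w|w dw].
  - by apply/measurable_EFinP; apply: wmeas_hnorm => //; exact: wmeas_ker.
  - by rewrite lee_fin hnorm_ge0.
  - by rewrite mule_ge0 ?lee_fin ?hnorm_ge0 ?powR_ge0.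
  - rewrite -EFinM lee_fin hnormZ cabs_bergman_kernel ler_wpM2r ?hnorm_ge0//.
    exact: bergman_kernel_bound.
rewrite ge0_integralZl//; last 3 first.
- exact/measurable_EFinP/wmeas_hnorm.
- by move=> w _; rewrite lee_fin hnorm_ge0.
- by rewrite lee_fin powR_ge0.
by apply: lte_mul_pinfty => //; rewrite lee_fin powR_ge0.
Qed.

Lemma bergman_opP f z : norm_integrable mu f -> disc z ->
  is_bochner mu (fun w => bergman_kernel eta z w *: f w) (bergman_op f z) /\
  weak_integral mu (fun w => bergman_kernel eta z w *: f w) (bergman_op f z).
Proof.
move=> fi dz.
have [v [bv wv]] := bochner_exists sepH (mu_eta_lty heta) (kernel_norm_integrable fi dz).
rewrite /bergman_op mem_set//.
have := xgetPex 0 (ex_intro (fun v => weak_integral mu _ v) v wv).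
by set u := xget _ _ => wu; rewrite (weak_integral_unique wu wv).
Qed.

Lemma bergman_op_norm f z : norm_integrable mu f -> disc z ->
  ((hnorm (bergman_op f z))%:E <=
    \int[mu]_w (dker z w `^ (- (eta + 2)) * hnorm (f w))%:E)%E.
Proof.
move=> fi dz; have [_ wv] := bergman_opP fi dz.
have [mkf _] := kernel_norm_integrable fi dz.
apply: le_trans (weak_integral_norm sepH mkf wv) _.
by apply: le_integral_nonmeasurable => w;
  rewrite lee_fin ?hnorm_ge0// hnormZ cabs_bergman_kernel.
Qed.

Lemma bergman_opD (a : R[i]) f g z :
  norm_integrable mu f -> norm_integrable mu g ->
  norm_integrable mu (fun w => a *: f w + g w) ->
  bergman_op (fun w => a *: f w + g w) z = a *: bergman_op f z + bergman_op g z.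
Proof.
move=> fi gi fgi.
have [dz|dz] := pselect (disc z); last first.
  by rewrite /bergman_op memNset// scaler0 addr0.
have kf := kernel_norm_integrable fi dz.
have kg := kernel_norm_integrable gi dz.
apply: (weak_integral_unique (bergman_opP fgi dz).2).
have -> : (fun w => bergman_kernel eta z w *: (a *: f w + g w)) =
    (fun w => a *: (bergman_kernel eta z w *: f w) + bergman_kernel eta z w *: g w).
  by apply/funext => w; rewrite scalerDr !scalerA mulrC.
apply: weak_integralD => //; last 2 first.
- by apply: weak_integralZ => //; exact: (bergman_opP fi dz).2.
- exact: (bergman_opP gi dz).2.
by apply: norm_integrableZ.
Qed.

Lemma bergman_op_ae f g z (N : set (plane R)) :
  norm_integrable mu f -> norm_integrable mu g ->
  measurable N -> mu N = 0%E -> (forall w, ~ N w -> f w = g w) ->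
  bergman_op f z = bergman_op g z.
Proof.
move=> fi gi mN N0 fg.
have [dz|dz] := pselect (disc z); last by rewrite /bergman_op memNset.
apply: (weak_integral_unique _ (bergman_opP gi dz).2).
apply: (weak_integral_ae mN N0 _ _ _ (bergman_opP fi dz).2).
- by move=> w Nw; rewrite fg.
- exact: (wmeas_ker z fi.1).
- exact: (wmeas_ker z gi.1).
Qed.

(** Tested against [e], the projection is a parametric integral of a jointly measurable scalar
    function; Tonelli's theorem applies to its positive and negative parts. *)
Lemma wmeas_bergman_op f : norm_integrable mu f -> wmeas (bergman_op f).
Proof.
move=> fi e.
pose G (x : plane R * plane R) := (rdot (bergman_kernel eta x.1 x.2 *: f x.2) e)%:E.
have mG : measurable_fun setT G.
  apply/measurable_EFinP; rewrite /G.
  under eq_fun do rewrite rdotZ.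
  apply: measurable_funB; apply: measurable_funM.
  - exact: measurable_Re_bergman_kernel.
  - exact: (measurableT_comp (fi.1 e)).
  - exact: measurable_Im_bergman_kernel.
  - exact: (measurableT_comp (fi.1 ('i *: e))).
have mF : measurable_fun setT (fun z => \int[mu]_w G (z, w))%E.
  have mp := @measurable_fun_fubini_tonelli_F _ _ _ _ _ mu G^\+%E
    (measurable_funepos mG) (fun x => funepos_ge0 _ _).
  have mn := @measurable_fun_fubini_tonelli_F _ _ _ _ _ mu G^\-%E
    (measurable_funeneg mG) (fun x => funeneg_ge0 _ _).
  have -> : (fun z => \int[mu]_w G (z, w))%E =
      (fun z => fubini_F mu G^\+ z - fubini_F mu G^\- z)%E.
    apply/funext => z; rewrite integralE.
    by congr (_ - _)%E; apply: eq_integral => w _; rewrite ?funeposE ?funenegE.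
  exact: emeasurable_funB.
have mfF : measurable_fun setT (fun z => fine (\int[mu]_w G (z, w)))%E.
  exact: (measurableT_comp (fine_measurable measurableT)).
have -> : (fun z => rdot (bergman_op f z) e) =
    (fun z => if z \in @disc R then fine (\int[mu]_w G (z, w))%E else 0).
  apply/funext => z; case: ifPn => [/set_mem dz|zN].
    by rewrite /G/= (bergman_opP fi dz).2.
  by rewrite /bergman_op (negbTE zN) rdot0l.
apply: measurable_fun_if => //.
- apply: (measurable_fun_bool true).
  rewrite setTI [X in measurable X](_ : _ = @disc R); first exact: measurable_disc.
  by apply/seteqP; split => z /= => [/set_mem|/mem_set].
- exact: measurable_funTS.
Qed.

End bergman_operator.

(** * Unweighted bounds for the projection *)

Section bergman_schur.
Context (R : realType) (eta : R) (heta : -1 < eta).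
Local Notation mu := (mu_eta heta).

(** The indicators make the hypotheses of Schur's test hold at all points of the plane. *)
Definition disc_kernel (x : plane R * plane R) : R :=
  dker x.1 x.2 `^ (- (eta + 2)) * \1_(@disc R) x.1 * \1_(@disc R) x.2.

Lemma disc_kernel_ge0 x : 0 <= disc_kernel x.
Proof. by rewrite !mulr_ge0 ?powR_ge0. Qed.

Lemma disc_kernelE z w : disc z -> disc w ->
  disc_kernel (z, w) = dker z w `^ (- (eta + 2)).
Proof. by move=> dz dw; rewrite /disc_kernel !indicE/= !mem_set// !mulr1. Qed.

Lemma disc_kernel0 z w : ~ disc z -> disc_kernel (z, w) = 0.
Proof. by move=> dz; rewrite /disc_kernel indicE/= memNset// mulr0 mul0r. Qed.

Lemma disc_kernelC z w : disc_kernel (z, w) = disc_kernel (w, z).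
Proof. by rewrite /disc_kernel/= dkerC -!mulrA (mulrC (\1__ z)). Qed.

Lemma measurable_disc_kernel : measurable_fun setT disc_kernel.
Proof.
apply: measurable_funM; last first.
  by apply: measurableT_comp => //; apply: measurable_indic; exact: measurable_disc.
apply: measurable_funM; last first.
  by apply: measurableT_comp => //; apply: measurable_indic; exact: measurable_disc.
by apply: (measurableT_comp (measurable_powR _)); exact: measurable_dker.
Qed.

(** The test function for Schur's test; the value 1 off the disc keeps it positive everywhere. *)
Let hw (s : R) (w : plane R) : R := if w \in @disc R then (1 - absq w) `^ (- s) else 1.

Let hw_gt0 s w : 0 < hw s w.
Proof.
by rewrite /hw; case: ifPn => // /set_mem dw; rewrite powR_gt0// subr_gt0.
Qed.

Let measurable_disc_bool : measurable_fun setT (fun w : plane R => w \in @disc R).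
Proof.
apply: (measurable_fun_bool true).
rewrite setTI [X in measurable X](_ : _ = @disc R); first exact: measurable_disc.
by apply/seteqP; split => z /= => [/set_mem|/mem_set].
Qed.

Let measurable_hw s : measurable_fun setT (hw s).
Proof.
apply: measurable_fun_if => //.
by apply: measurable_funTS; exact: (measurable_rho_pow (f := id)).
Qed.

Let hw_bound s e : 0 < s * e -> s * e < eta + 1 ->
  exists2 C, 0 < C & forall z,
    (\int[mu]_w (disc_kernel (z, w) * hw s w `^ e)%:E <= (C * hw s z `^ e)%:E)%E.
Proof.
move=> se0 se1; have [C C0 hC] := mu_eta_forelli_rudin heta se0 se1.
exists C => // z; have [dz|dz] := pselect (disc z); last first.
  under eq_integral do rewrite disc_kernel0// mul0r.
  by rewrite integral0 lee_fin mulr_ge0 ?powR_ge0// ltW.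
rewrite {2}/hw mem_set// -powRrM mulNr.
apply: le_trans (hC z dz); apply: mu_eta_le_disc => [|w|w|w dw].
- apply/measurable_EFinP; apply: measurable_funM.
    exact: (measurableT_comp measurable_disc_kernel (pair1_measurable z)).
  exact: (measurableT_comp (measurable_powR e) (measurable_hw s)).
- by rewrite lee_fin mulr_ge0 ?powR_ge0 ?disc_kernel_ge0.
- by rewrite lee_fin mulr_ge0 ?powR_ge0.
- by rewrite disc_kernelE// /hw mem_set// -powRrM mulNr.
Qed.

Lemma bergman_schur p : 1 < p -> exists2 C : R, 0 < C &
  forall phi : plane R -> R, measurable_fun setT phi -> (forall x, 0 <= phi x) ->
  (\int[mu]_z (\int[mu]_w (disc_kernel (z, w) * phi w)%:E) `^ p <=
   C%:E * \int[mu]_w (phi w `^ p)%:E)%E.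
Proof.
move=> p1; pose q := p / (p - 1).
have p0 : 0 < p by lra.
have pm0 : 0 < p - 1 by lra.
have q0 : 0 < q by rewrite divr_gt0.
have pq : p^-1 + q^-1 = 1.
  by rewrite /q; field; rewrite !gt_eqF.
(* This makes s p and s q positive with sum (eta + 1) / 2, so both are admissible exponents in the
   Forelli-Rudin estimate. *)
pose s := (eta + 1) / (2 * (p + q)).
have e0 : 0 < eta + 1 by move: heta; lra.
have pq0 : 0 < p + q by rewrite addr_gt0.
have s0 : 0 < s by rewrite divr_gt0// mulr_gt0.
have sE : s * (p + q) = (eta + 1) / 2 by rewrite /s; field; rewrite gt_eqF.
have sp0 : 0 < s * p by rewrite mulr_gt0.
have sq0 : 0 < s * q by rewrite mulr_gt0.
have sp1 : s * p < eta + 1 by move: sE; rewrite mulrDr; lra.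
have sq1 : s * q < eta + 1 by move: sE; rewrite mulrDr; lra.
have [C1 C10 hC1] := hw_bound sq0 sq1.
have [C2 C20 hC2] := hw_bound sp0 sp1.
have C0 : 0 < C1 + C2 by rewrite addr_gt0.
exists ((C1 + C2) `^ p) => [|phi mphi phi0]; first by rewrite powR_gt0.
apply: (schur_test p1 q0 pq disc_kernel_ge0 measurable_disc_kernel
  (h := hw s)) => // [z|w].
  apply: le_trans (hC1 z) _.
  by rewrite lee_fin ler_wpM2r ?powR_ge0// lerDl ltW.
under eq_integral do rewrite disc_kernelC.
apply: le_trans (hC2 w) _.
by rewrite lee_fin ler_wpM2r ?powR_ge0// lerDr ltW.
Qed.

Context (H : hilbertType R).
Hypothesis sepH : separable H.

Lemma bergman_op_disc_kernel (f : plane R -> H) z : norm_integrable mu f ->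
  ((hnorm (bergman_op heta f z))%:E <=
    \int[mu]_w (disc_kernel (z, w) * hnorm (f w))%:E)%E.
Proof.
move=> fi; have mf := wmeas_hnorm sepH fi.1.
have [dz|dz] := pselect (disc z); last first.
  rewrite /bergman_op memNset// hnorm0; apply: integral_ge0 => w _.
  by rewrite lee_fin mulr_ge0 ?disc_kernel_ge0 ?hnorm_ge0.
apply: le_trans (bergman_op_norm sepH fi dz) _.
apply: mu_eta_le_disc => [|w|w|w dw].
- apply/measurable_EFinP; apply: measurable_funM => //.
  by apply: (measurableT_comp (measurable_powR _)); exact: measurable_dker.
- by rewrite lee_fin mulr_ge0 ?powR_ge0 ?hnorm_ge0.
- by rewrite lee_fin mulr_ge0 ?disc_kernel_ge0 ?hnorm_ge0.
- by rewrite disc_kernelE.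
Qed.

(** Away from the circle |1 - conj(w) z| >= (1 - |z|^2) / 2 >= (1 - r) / 2, so the kernel is bounded
    uniformly in both variables. *)
Lemma bergman_op_compact (r : R) : r < 1 -> exists2 C : R, 0 < C &
  forall (f : plane R -> H) z, norm_integrable mu f -> absq z <= r ->
  ((hnorm (bergman_op heta f z))%:E <= C%:E * \int[mu]_w (hnorm (f w))%:E)%E.
Proof.
move=> r1; have r0 : 0 < (1 - r) / 2 by rewrite divr_gt0// subr_gt0.
exists (((1 - r) / 2) `^ (- (eta + 2))) => [|f z fi zr]; first by rewrite powR_gt0.
have dz : disc z by exact: le_lt_trans r1.
have mf := wmeas_hnorm sepH fi.1.
apply: le_trans (bergman_op_norm sepH fi dz) _.
rewrite -ge0_integralZl//; last 3 first.
- exact/measurable_EFinP.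
- by move=> w _; rewrite lee_fin hnorm_ge0.
- by rewrite lee_fin powR_ge0.
apply: mu_eta_le_disc => [|w|w|w dw].
- apply/measurable_EFinP; apply: measurable_funM => //.
  by apply: (measurableT_comp (measurable_powR _)); exact: measurable_dker.
- by rewrite lee_fin mulr_ge0 ?powR_ge0 ?hnorm_ge0.
- by rewrite mule_ge0 ?lee_fin ?powR_ge0 ?hnorm_ge0.
- rewrite -EFinM lee_fin ler_wpM2r ?hnorm_ge0//.
  apply: le_trans (bergman_kernel_bound heta dz dw) _.
  have e0 : 0 <= eta + 2 by move: heta; lra.
  have rz0 : 0 < (1 - absq z) / 2 by rewrite divr_gt0// subr_gt0.
  rewrite !powRN lef_pV2 ?posrE ?powR_gt0//.
  apply: ge0_ler_powR; rewrite ?nnegrE ?(ltW r0) ?(ltW rz0)//.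
  by rewrite ler_pM2r// lerB.
Qed.

End bergman_schur.

(** * Boundedness on the weighted space *)

Section bergman_bounded.
Context (R : realType) (p eta : R) (hp : 1 < p) (heta : -1 < eta).
Context (H : hilbertType R).
Hypothesis sepH : separable H.
Local Notation mu := (mu_eta heta).
Variable W : plane R -> H -> H.
Local Notation A z := (op_pow (W z) p^-1).
Local Notation B z := (op_pow (W z) (- p^-1)).
(** The weight is dominated by a constant [M] plus an integrable height [V] that vanishes near the
    circle; [A_ge] and [B_le] reflect that the weight is at least the identity. *)
Variables (M r : R) (V : plane R -> R).
Hypothesis A_ge : forall z x, hnorm x <= hnorm (A z x).
Hypothesis A_le : forall z x, hnorm (A z x) `^ p <= (M + V z) * hnorm x `^ p.
Hypothesis B_le : forall z x, hnorm (B z x) <= hnorm x.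
Hypothesis wmeas_B : forall f : plane R -> H, wmeas f -> wmeas (fun z => B z (f z)).
Hypothesis M_ge0 : 0 <= M.
Hypothesis V_ge0 : forall z, 0 <= V z.
Hypothesis mV : measurable_fun setT V.
Hypothesis V_int : (\int[mu]_z (V z)%:E < +oo)%E.
Hypothesis r_lt1 : r < 1.
Hypothesis V_supp : forall z, V z != 0 -> absq z <= r.
Implicit Types f g : plane R -> H.

Let poweR_le (e : R) (x y : \bar R) : 0 <= e -> (0 <= x)%E -> (x <= y)%E ->
  (x `^ e <= y `^ e)%E.
Proof.
move=> e0 x0 xy; apply: gt0_ler_poweR => //; rewrite in_itv/= leey andbT//.
exact: le_trans xy.
Qed.

Let p0 : 0 < p. Proof. exact: lt_trans hp. Qed.

Let ip0 : 0 < p^-1. Proof. by rewrite invr_gt0. Qed.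

Let is_rep f g := wmeas g /\ exists N,
  [/\ measurable N, mu N = 0%E & forall z, ~ N z -> f z = g z].

(** The operator must act on functions that are measurable only up to a null set, so the projection
    is applied to a chosen representative; [T_rep] shows that the choice is immaterial. *)
Let rep f := xget (fun=> 0) [set g | is_rep f g].

Let repP f : strongly_measurable mu f -> is_rep f (rep f).
Proof. by move=> /strongly_wmeas[g hg]; exact: (xgetPex _ (ex_intro _ g hg)). Qed.

Let Lp_normE f : (Lp_norm p heta W f = (\int[mu]_z (hnorm (A z (f z)) `^ p)%:E) `^ p^-1)%E.
Proof. by []. Qed.

Let energy_ge0 f : (0 <= \int[mu]_z (hnorm (A z (f z)) `^ p)%:E)%E.
Proof. by apply: integral_ge0 => z _; rewrite lee_fin powR_ge0. Qed.

Let mpow f : wmeas f -> measurable_fun setT (fun z => hnorm (f z) `^ p).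
Proof. by move=> mf; exact: (measurableT_comp (measurable_powR p) (wmeas_hnorm sepH mf)). Qed.

Let rep_energy f g : is_rep f g ->
  (\int[mu]_z (hnorm (g z) `^ p)%:E <=
   \int[mu]_z (hnorm (A z (f z)) `^ p)%:E)%E.
Proof.
move=> [mg [N [mN N0 fg]]].
apply: (ae_le_integral_nonmeasurable mN N0) => [|z|z|z Nz].
- by apply/measurable_EFinP; exact: mpow.
- by rewrite lee_fin powR_ge0.
- by rewrite lee_fin powR_ge0.
- by rewrite lee_fin fg// ge0_ler_powR ?nnegrE ?hnorm_ge0 ?(ltW p0).
Qed.

(** Hölder against the constant function 1; finiteness of the measure then embeds L^p into L^1. *)
Let norm1_le f : wmeas f ->
  ((\int[mu]_z (hnorm (f z))%:E) `^ p <= (mu setT) `^ (p - 1) *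
    \int[mu]_z (hnorm (f z) `^ p)%:E)%E.
Proof.
move=> mf; pose q := p / (p - 1).
have pm0 : 0 < p - 1 by rewrite subr_gt0.
have q0 : 0 < q by rewrite divr_gt0.
have pq : p^-1 + q^-1 = 1.
  by rewrite /q; field; rewrite !gt_eqF.
have := hoelder_powR mu hp q0 pq (@measurable_cst _ _ _ _ setT (1 : R))
  (wmeas_hnorm sepH mf) (fun=> ler01) (fun z => hnorm_ge0 (f z)).
under eq_integral do rewrite mul1r.
have -> : (\int[mu]_x (1 `^ q)%:E = mu setT)%E.
  under eq_integral do rewrite powR1.
  by rewrite integral_cst// mul1e.
by [].
Qed.

Let energy_fin f : in_Lp p heta W f ->
  (\int[mu]_z (hnorm (A z (f z)) `^ p)%:E < +oo)%E.
Proof. by move=> [_]; apply: lty_poweRy; rewrite gt_eqF. Qed.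

Let wmeas_norm_integrable f : wmeas f ->
  (\int[mu]_z (hnorm (f z) `^ p)%:E < +oo)%E -> norm_integrable mu f.
Proof.
move=> mf fi; split => //.
have := le_lt_trans (norm1_le mf) (lte_mul_pinfty _ _ fi).
move=> /(_ (poweR_ge0 _ _)) h; apply: lty_poweRy (h _); first by rewrite gt_eqF.
by apply: fin_num_poweR; exact: fin_num_measure.
Qed.

Let rep_integrable f g : in_Lp p heta W f -> is_rep f g -> norm_integrable mu g.
Proof.
move=> fL fg; apply: wmeas_norm_integrable; first by case: fg.
exact: le_lt_trans (rep_energy fg) (energy_fin fL).
Qed.

Let T f := bergman_op heta (rep f).

Let T_rep f g z : is_rep f g -> norm_integrable mu g ->
  T f z = bergman_op heta g z.
Proof.
move=> fg gi.
have [mr [N' [mN' N'0 hN']]] : is_rep f (rep f).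
  exact: (xgetPex _ (ex_intro _ g fg)).
case: fg => mg [N [mN N0 hN]].
have mNN : measurable (N `|` N') by exact: measurableU.
have NN0 : mu (N `|` N') = 0%E by exact: null_set_setU.
have gr w : ~ (N `|` N') w -> rep f w = g w.
  by move=> /not_orP[Nw N'w]; rewrite -hN'// hN.
apply: (bergman_op_ae sepH z _ gi mNN NN0 gr).
split => //; apply: le_lt_trans gi.2.
apply: (ae_le_integral_nonmeasurable mNN NN0) => [|w|w|w Nw].
- exact/measurable_EFinP/wmeas_hnorm.
- by rewrite lee_fin hnorm_ge0.
- by rewrite lee_fin hnorm_ge0.
- by rewrite gr.
Qed.

Let energy_bound : exists2 C : R, 0 < C & forall g, wmeas g ->
  (\int[mu]_z (hnorm (g z) `^ p)%:E < +oo)%E ->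
  (\int[mu]_z (hnorm (A z (bergman_op heta g z)) `^ p)%:E <=
    C%:E * \int[mu]_z (hnorm (g z) `^ p)%:E)%E.
Proof.
have [C1 C10 hC1] := bergman_schur heta hp.
have [C2 C20 hC2] := bergman_op_compact heta sepH r_lt1.
pose m := fine (mu setT).
have mE : mu setT = m%:E by rewrite fineK// fin_num_measure.
have m0 : 0 <= m by exact: fine_ge0.
pose v := fine (\int[mu]_z (V z)%:E)%E.
have v0 : 0 <= v.
  by apply: fine_ge0; apply: integral_ge0 => z _; rewrite lee_fin.
have vE : (\int[mu]_z (V z)%:E = v%:E)%E.
  rewrite fineK// ge0_fin_numE//.
  by apply: integral_ge0 => z _; rewrite lee_fin.
(* The first term is Schur's test for the bounded part of the weight, the second the pointwise bound
   on the support of [V]; adding 1 makes the constant positive. *)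
exists (M * C1 + v * (C2 `^ p * m `^ (p - 1)) + 1) => [|g mg gfin].
  by rewrite ltr_wpDl// addr_ge0 ?mulr_ge0 ?powR_ge0// ltW.
have gi := wmeas_norm_integrable mg gfin.
have mT := wmeas_bergman_op sepH gi.
set N := (\int[mu]_z (hnorm (g z) `^ p)%:E)%E.
have N0 : (0 <= N)%E by apply: integral_ge0 => z _; rewrite lee_fin powR_ge0.
have I1 : (\int[mu]_z (hnorm (bergman_op heta g z) `^ p)%:E <= C1%:E * N)%E.
  apply: le_trans (hC1 _ (wmeas_hnorm sepH mg) (fun z => hnorm_ge0 (g z))).
  apply: le_integral_nonmeasurable => z; first by rewrite lee_fin powR_ge0.
  rewrite -poweR_EFin; apply: poweR_le; rewrite ?(ltW p0) ?lee_fin ?hnorm_ge0//.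
  exact: bergman_op_disc_kernel.
have I2 z : V z != 0 ->
    ((hnorm (bergman_op heta g z) `^ p)%:E <= (C2 `^ p * m `^ (p - 1))%:E * N)%E.
  move=> Vz; rewrite -poweR_EFin.
  have h0 : (0 <= (hnorm (bergman_op heta g z))%:E)%E by rewrite lee_fin hnorm_ge0.
  apply: le_trans (poweR_le (ltW p0) h0 (hC2 g z gi (V_supp Vz))) _.
  have i0 : (0 <= \int[mu]_w (hnorm (g w))%:E)%E.
    by apply: integral_ge0 => w _; rewrite lee_fin hnorm_ge0.
  rewrite poweRM ?lee_fin ?(ltW C20)// poweR_EFin EFinM -muleA.
  apply: lee_wpmul2l; first by rewrite lee_fin powR_ge0.
  by apply: le_trans (norm1_le mg) _; rewrite mE poweR_EFin.
have I3 : (\int[mu]_z (V z * hnorm (bergman_op heta g z) `^ p)%:E <=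
    v%:E * ((C2 `^ p * m `^ (p - 1))%:E * N))%E.
  have cN0 : (0 <= (C2 `^ p * m `^ (p - 1))%:E * N)%E.
    by rewrite mule_ge0// lee_fin mulr_ge0 ?powR_ge0.
  rewrite -vE -ge0_integralZr//; last 2 first.
  - exact/measurable_EFinP.
  - by move=> z _; rewrite lee_fin.
  apply: le_integral_nonmeasurable => z.
    by rewrite lee_fin mulr_ge0 ?powR_ge0.
  have [->|Vz] := eqVneq (V z) 0; first by rewrite mul0r mul0e.
  by rewrite EFinM; apply: lee_wpmul2l; [rewrite lee_fin|exact: I2].
apply: (@le_trans _ _ (\int[mu]_z ((M%:E * (hnorm (bergman_op heta g z) `^ p)%:E) +
    (V z * hnorm (bergman_op heta g z) `^ p)%:E))%E).
  apply: le_integral_nonmeasurable => z; first by rewrite lee_fin powR_ge0.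
  by rewrite -EFinM -EFinD lee_fin -mulrDl; exact: A_le.
have mTp : measurable_fun setT (fun z => (hnorm (bergman_op heta g z) `^ p)%:E).
  by apply/measurable_EFinP; exact: mpow.
rewrite ge0_integralD//; last 4 first.
- by move=> z _; rewrite mule_ge0 ?lee_fin ?powR_ge0.
- by apply: emeasurable_funM => //; exact: measurable_cst.
- by move=> z _; rewrite lee_fin mulr_ge0 ?powR_ge0.
- by apply/measurable_EFinP; apply: measurable_funM => //; exact: mpow.
rewrite ge0_integralZl//; last by move=> z _; rewrite lee_fin powR_ge0.
have Nfin : N \is a fin_num by rewrite ge0_fin_numE.
apply: le_trans (leeD (lee_wpmul2l _ I1) I3) _; first by rewrite lee_fin.
rewrite -(fineK Nfin) -!EFinM -EFinD lee_fin.
rewrite -subr_ge0 [X in 0 <= X](_ : _ = fine N); first exact: fine_ge0.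
by ring.
Qed.

Lemma bergman_bounded_of : bergman_bounded p heta W.
Proof.
have [C C0 hC] := energy_bound.
exists T; split.
- move=> f g a fL gL; apply: aeW => z.
  have fr := repP fL.1; have gr := repP gL.1.
  have fi := rep_integrable fL fr; have gi := rep_integrable gL gr.
  have fgi := norm_integrableD sepH (norm_integrableZ sepH a fi) gi.
  rewrite (T_rep z fr fi) (T_rep z gr gi) -bergman_opD//.
  apply: T_rep => //.
  case: fr => mr [N [mN N0 hN]]; case: gr => mr' [N' [mN' N'0 hN']].
  split; first exact: (norm_integrableD sepH (norm_integrableZ sepH a fi) gi).1.
  exists (N `|` N'); split.
  + exact: measurableU.
  + exact: null_set_setU.
  + by move=> w /not_orP[Nw N'w]; rewrite hN ?hN'.
- exists (C `^ p^-1) => f fL.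
  have fr := repP fL.1.
  have Ef := energy_fin fL.
  have gE := rep_energy fr.
  have gfin := le_lt_trans gE Ef.
  have h : (\int[mu]_z (hnorm (A z (T f z)) `^ p)%:E <=
      C%:E * \int[mu]_z (hnorm (A z (f z)) `^ p)%:E)%E.
    apply: le_trans (hC _ fr.1 gfin) _; apply: lee_wpmul2l => //.
    by rewrite lee_fin ltW.
  have h' : (Lp_norm p heta W (T f) <= (C `^ p^-1)%:E * Lp_norm p heta W f)%E.
    rewrite !Lp_normE -poweR_EFin -poweRM ?lee_fin ?(ltW C0)//.
    exact: (poweR_le (ltW ip0) (energy_ge0 (T f)) h).
  split; last exact: h'.
  split.
    apply: (wmeas_strongly sepH); apply: (wmeas_bergman_op sepH).
    exact: rep_integrable fL fr.
  apply: le_lt_trans h' _; apply: lte_mul_pinfty; last by case: fL.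
    by rewrite lee_fin powR_ge0.
  by [].
- move=> F [sF [r' r'1 hF]] f.
  have mF := wmeas_simple sF.
  have mf : wmeas f by exact: wmeas_B.
  have [c hc] : exists c, forall z, hnorm (F z) <= c.
    exists (\sum_(v <- finmap.enum_fset (fset_set (range F))) hnorm v) => z.
    rewrite (bigD1_seq (F z))//=; last 2 first.
    - by rewrite in_fset_set ?inE; [exists z|exact: sF.1].
    - exact: finmap.fset_uniq.
    by rewrite lerDl sumr_ge0// => v _; exact: hnorm_ge0.
  have fi : norm_integrable mu f.
    split => //; apply: (@le_lt_trans _ _ (\int[mu]_z (cst c%:E z))%E).
      apply: le_integral_nonmeasurable => z; first by rewrite lee_fin hnorm_ge0.
      by rewrite lee_fin; exact: le_trans (B_le _ _) (hc z).
    rewrite integral_cst//; apply: lte_mul_pinfty.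
    - by rewrite lee_fin; exact: le_trans (hnorm_ge0 _) (hc (0, 0)).
    - by [].
    - exact: mu_eta_lty.
  exists (bergman_op heta f) => [z dz|]; first exact: (bergman_opP sepH fi dz).1.
  (* [f] is weakly measurable, hence its own representative with empty exceptional set. *)
  apply: aeW => z; apply: T_rep => //; split => //.
  by exists set0; split => //; exact: measure0.
Qed.

End bergman_bounded.

(** * The weight *)

Section weight.
Context (R : realType) (K : hilbertType R).
Local Notation H := (dsum K).
Local Notation leb := (@plane_lebesgue R).

Definition proj_diag (x : H) : H :=
  (2^-1%:C *: (x.1 + x.2), 2^-1%:C *: (x.1 + x.2)).

Definition proj_snd (x : H) : H := (0, x.2).

Lemma proj_diag_orth : orth_proj proj_diag.
Proof.
split.
- have E (a : R[i]) (u v u' v' : K) :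
      2^-1%:C *: ((a *: u + u') + (a *: v + v')) =
      a *: (2^-1%:C *: (u + v)) + 2^-1%:C *: (u' + v').
    by rewrite addrACA -(scalerDr a) (scalerDr 2^-1%:C) !scalerA (mulrC a).
  by move=> a x y; congr (_, _); exact: E.
- have E (u : K) : 2^-1%:C *: (2^-1%:C *: u + 2^-1%:C *: u) = 2^-1%:C *: u.
    by apply: rdot_inj => e; rewrite !(rdotDl, rdotZR); field.
  by move=> x; congr (_, _); exact: E.
- move=> x y; rewrite /= /dsum_dot/= -linearDr/= linearZl_LR/=.
  rewrite -linearDl/= linearZr_LR/=; congr (_ * _).
  by apply/eqP; rewrite eq_complex /= oppr0 !eqxx.
Qed.

Lemma proj_snd_orth : orth_proj proj_snd.
Proof.
split => //.
- by move=> a x y; congr (_, _); rewrite /= scaler0 addr0.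
- by move=> x y; rewrite /= /dsum_dot/= linear0l linear0r.
Qed.

(* The boxes have area [2^-1 ^+ n.+2 / weight_level n], so that the weight is
   summable, while [weight_level n] grows faster than any power of [2 ^ n]. *)
Definition weight_level (n : nat) : R := 2 ^+ (n ^ 2).+1.

Definition weight_box (n : nat) : set (plane R) :=
  `](2^-1 ^+ n.+2), (2^-1 ^+ n.+1)[ `*` `[0, (weight_level n)^-1].

Lemma weight_level_ge2 n : 2 <= weight_level n.
Proof. by rewrite /weight_level exprS ler_peMr// exprn_ege1// ler1n. Qed.

Lemma weight_level_gt0 n : 0 < weight_level n.
Proof. by apply: lt_le_trans (weight_level_ge2 n). Qed.

Lemma measurable_weight_box n : measurable (weight_box n).
Proof. by apply: measurableX; exact: measurable_itv. Qed.

Lemma halfX_gt0 n : 0 < 2^-1 ^+ n :> R.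
Proof. by rewrite exprn_gt0. Qed.

Lemma lebesgue_weight_box n :
  leb (weight_box n) = (2^-1 ^+ n.+2 / weight_level n)%:E.
Proof.
rewrite /plane_lebesgue/= product_measure1E; [|exact: measurable_itv|exact: measurable_itv].
rewrite /= !lebesgue_measure_itv/= !lte_fin.
have h := halfX_gt0 n.+1.
rewrite [2^-1 ^+ n.+2]exprS gtr_pMl// invf_lt1// ltr1n invr_gt0 weight_level_gt0.
by rewrite -!EFinB -EFinM; congr EFin; field; rewrite gt_eqF// weight_level_gt0.
Qed.

Lemma weight_box_absq n z : weight_box n z -> absq z <= 2^-1.
Proof.
rewrite /weight_box /absq/= => -[]; rewrite /= !in_itv/= => /andP[x0 x1] /andP[y0 y1].
have x0' : 0 < z.1 :> R by exact: lt_trans (halfX_gt0 _) x0.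
have x2 : z.1 <= 2^-1 :> R.
  apply: le_trans (ltW x1) _; rewrite exprS ger_pMr//.
  by apply: exprn_ile1; rewrite ?invr_ge0// invf_le1// ler1n.
have y2 : z.2 <= 2^-1 :> R.
  by apply: le_trans y1 _; rewrite lef_pV2 ?posrE ?weight_level_gt0// weight_level_ge2.
move: x0' x2 y0 y2; move: (z.1 : R) (z.2 : R) => x y; nra.
Qed.

Lemma weight_box_disc n z : weight_box n z -> disc z.
Proof. by move=> /weight_box_absq h; apply: le_lt_trans h _; rewrite invf_lt1// ltr1n. Qed.

(** The first coordinates of distinct boxes lie in disjoint dyadic intervals. *)
Lemma weight_box_inj n m z : weight_box n z -> weight_box m z -> n = m.
Proof.
wlog : n m / (n < m)%N.
  move=> hw bn bm; case: (ltngtP n m) => // nm; first exact: hw.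
  by apply/esym/hw.
move=> nm [+ _] [+ _]; rewrite /= !in_itv/= => /andP[h1 _] /andP[_ h2].
have := lt_trans h1 h2; rewrite ltNge => /negP[].
by apply: ler_wiXn2l; rewrite ?invr_ge0// invf_le1// ler1n.
Qed.

(** The shift by one frees 0, the default of [xget], for the complement of the boxes. *)
Definition weight_index (z : plane R) : nat :=
  xget 0%N [set m | exists2 n, m = n.+1 & weight_box n z].

Lemma weight_index_box n z : weight_box n z -> weight_index z = n.+1.
Proof.
move=> bn; rewrite /weight_index.
have := xgetPex 0%N (ex_intro (fun m => exists2 n, m = n.+1 & weight_box n z)
  n.+1 (ex_intro2 _ _ n erefl bn)).
by move=> [m -> bm]; rewrite (weight_box_inj bn bm).
Qed.

Lemma weight_indexS n z : weight_index z = n.+1 -> weight_box n z.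
Proof.
rewrite /weight_index; case: xgetP => [m -> [k -> bk] [<-]//|//].
Qed.

Lemma weight_index0 z : (forall n, ~ weight_box n z) -> weight_index z = 0%N.
Proof.
by move=> h; case E: (weight_index z) => [//|n]; case: (h n); exact: weight_indexS.
Qed.

Lemma measurable_weight_index (A : set nat) : measurable (weight_index @^-1` A).
Proof.
have mS n : measurable (weight_index @^-1` [set n.+1]).
  rewrite [X in measurable X](_ : _ = weight_box n); first exact: measurable_weight_box.
  by apply/seteqP; split => z /=; [exact: weight_indexS|exact: weight_index_box].
have m0 : measurable (weight_index @^-1` [set 0%N]).
  rewrite [X in measurable X](_ : _ = ~` \bigcup_n (weight_index @^-1` [set n.+1])).
    by apply: measurableC; apply: bigcup_measurable.
  apply/seteqP; split => z /=; first by move=> z0 [n _ /=]; rewrite z0.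
  by move=> h; case E: (weight_index z) => [//|n]; case: h; exists n.
rewrite [X in measurable X](_ : _ = \bigcup_(n in A) (weight_index @^-1` [set n])).
  by apply: bigcup_measurable => -[|n] _.
by apply/seteqP; split => [z Az|z [n An /= ->]//]; exists (weight_index z).
Qed.

(** The value 3 is the eigenvalue of x + 2 Q x on the range of Q. All values exceed 1, as
    [op_pow_sop] requires. *)
Definition weight_eigen (m : nat) : R := if m is n.+1 then weight_level n else 3.

Definition weight_proj (m : nat) : H -> H := if m is _.+1 then proj_snd else proj_diag.

Definition weight (z : plane R) : H -> H :=
  sop (weight_proj (weight_index z)) (weight_eigen (weight_index z)).

Lemma weight_eigen_gt1 m : 1 < weight_eigen m.
Proof.
case: m => [|n] /=; first by rewrite ltr1n.
by apply: lt_le_trans (weight_level_ge2 n); rewrite ltr1n.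
Qed.

Lemma weight_proj_orth m : orth_proj (weight_proj m).
Proof. by case: m => [|n]; [exact: proj_diag_orth|exact: proj_snd_orth]. Qed.

(** The operator is constant on each of countably many measurable pieces, and self-adjointness moves
    its projection onto the test vector. *)
Lemma wmeas_weight (f : plane R -> H) (c : nat -> R) : wmeas f ->
  wmeas (fun z => sop (weight_proj (weight_index z)) (c (weight_index z)) (f z)).
Proof.
move=> mf e _ B mB; rewrite setTI.
rewrite [X in measurable X](_ : _ = \bigcup_m ((weight_index @^-1` [set m]) `&`
  ((fun z => rdot (sop (weight_proj m) (c m) (f z)) e) @^-1` B))).
  apply: bigcup_measurable => m _; apply: measurableI.
    exact: measurable_weight_index.
  suff : measurable_fun setT (fun z => rdot (sop (weight_proj m) (c m) (f z)) e).
    by move=> /(_ measurableT _ mB); rewrite setTI.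
  have [_ _ adj] := weight_proj_orth m.
  have E z : rdot (sop (weight_proj m) (c m) (f z)) e =
      rdot (f z) e + (c m - 1) * rdot (f z) (weight_proj m e).
    by rewrite /sop rdotDl rdotZR {2}/rdot adj.
  under eq_fun do rewrite E.
  apply: measurable_funD; first exact: mf.
  by apply: measurable_funM => //; exact: mf.
by apply/seteqP; split => [z Bz|z [m _ [/= -> //]]]; exists (weight_index z).
Qed.

Hypothesis K0 : exists x : K, x != 0.

(** A nonzero e of K gives nonzero vectors in range and kernel: (e, e) and (e, -e) for the diagonal,
    (0, e) and (e, 0) for the second summand. *)
Lemma op_pow_weight s z : op_pow (weight z) s =
  sop (weight_proj (weight_index z)) (weight_eigen (weight_index z) `^ s).
Proof.
have [e e0] := K0.
apply: op_pow_sop; last exact: weight_eigen_gt1.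
- exact: weight_proj_orth.
- case: (weight_index z) => [|n].
    exists (e, e); first by apply: contra_neq e0 => -[].
    have E : 2^-1%:C *: (e + e) = e.
      by apply: rdot_inj => e'; rewrite !(rdotDl, rdotZR); field.
    by congr (_, _); exact: E.
  by exists (0, e) => //; apply: contra_neq e0 => -[].
- case: (weight_index z) => [|n].
    exists (e, - e); first by apply: contra_neq e0 => -[].
    by rewrite /= /proj_diag/= subrr scaler0.
  by exists (e, 0) => //; apply: contra_neq e0 => -[].
Qed.

End weight.

(** * Measure of the boxes and integrability of the weight *)

Section weight_estimates.
Context (R : realType) (eta : R) (heta : -1 < eta).
Local Notation mu := (mu_eta heta).
Local Notation leb := (@plane_lebesgue R).
Local Notation box := (@weight_box R).

(** In this region 1 - |z|^2 lies between 1/2 and 1; the exponent |eta| covers both signs of eta. *)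
Lemma bergman_density_bounds : exists c C : R, [/\ 0 < c, 0 < C &
  forall z, absq z <= 2^-1 -> c <= bergman_density eta z <= C].
Proof.
have k0 : 0 < (eta + 1) * pi^-1 by rewrite mulr_gt0 ?invr_gt0 ?pi_gt0//; move: heta; lra.
exists ((eta + 1) * pi^-1 * 2^-1 `^ `|eta|), ((eta + 1) * pi^-1 * 2 `^ `|eta|); split.
- by rewrite mulr_gt0// powR_gt0// invr_gt0.
- by rewrite mulr_gt0// powR_gt0.
move=> z zr.
have -> : bergman_density eta z = (eta + 1) * pi^-1 * (1 - absq z) `^ eta.
  by rewrite /bergman_density; ring.
rewrite !ler_pM2l//.
have r1 : 1 - absq z <= 1 by rewrite gerBl absq_ge0.
have r2 : 2^-1 <= 1 - absq z by move: zr; lra.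
have r0 : 0 < 1 - absq z by apply: lt_le_trans r2; rewrite invr_gt0.
have h0 : (0 : R) < 2^-1 by rewrite invr_gt0.
have [e0|e0] := leP 0 eta.
  rewrite ger0_norm//; apply/andP; split.
    by apply: ge0_ler_powR; rewrite ?nnegrE ?(ltW h0) ?(ltW r0).
  apply: ge0_ler_powR; rewrite ?nnegrE ?(ltW r0)//.
  by apply: le_trans r1 _; rewrite ler1n.
have [e e_gt0 ->] : exists2 e, 0 < e & eta = - e.
  by exists (- eta); rewrite ?oppr_gt0 ?opprK.
rewrite normrN gtr0_norm// powRN; apply/andP; split.
  apply: (@le_trans _ _ 1).
    have h1 : 0 < (2^-1 : R) <= 1 by rewrite h0 invf_le1// ler1n.
    by have := ger_powR h1 (ltW e_gt0); rewrite powRr0.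
  rewrite invf_ge1 ?powR_gt0//.
  have h1 : 0 < 1 - absq z <= 1 by rewrite r0.
  by have := ger_powR h1 (ltW e_gt0); rewrite powRr0.
rewrite -div1r ler_pdivrMr ?powR_gt0// -powRM ?(ltW r0)//.
have h2 : 1 <= 2 * (1 - absq z) by lra.
have := @ge0_ler_powR _ e (ltW e_gt0) 1 (2 * (1 - absq z)).
by rewrite !nnegrE powR1; apply => //; exact: le_trans h2.
Qed.

Lemma mu_weight_box : exists c C : R, [/\ 0 < c, 0 < C & forall n,
  ((c * (2^-1 ^+ n.+2 / weight_level R n))%:E <= mu (box n) <=
   (C * (2^-1 ^+ n.+2 / weight_level R n))%:E)%E].
Proof.
have [c [C [c0 C0 hcC]]] := bergman_density_bounds.
exists c, C; split => // n.
have mE := @measurable_weight_box R n.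
have bd : box n `&` @disc R = box n.
  by apply/setIidPl => z; exact: weight_box_disc.
have md : measurable_fun (box n) (fun z => (bergman_density eta z)%:E).
  by apply/measurable_funTS/measurable_EFinP; exact: measurable_bergman_density.
have muE : (mu (box n) = \int[leb]_(z in box n) (bergman_density eta z)%:E)%E.
  by rewrite /= /mu_eta bd.
have cstE k : (\int[leb]_(z in box n) (cst k%:E z) =
    (k * (2^-1 ^+ n.+2 / weight_level R n))%:E)%E.
  by rewrite integral_cst//= lebesgue_weight_box EFinM.
rewrite muE -!cstE; apply/andP; split; apply: ge0_le_integral => //.
- by move=> z _; rewrite lee_fin ltW.
- by move=> z bz; rewrite lee_fin; have /andP[] := hcC z (weight_box_absq bz).
- by move=> z _; rewrite lee_fin bergman_density_ge0.
- by move=> z bz; rewrite lee_fin; have /andP[] := hcC z (weight_box_absq bz).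
Qed.

(** The part of the larger eigenvalue carried by the boxes. It serves as [V] in
    [bergman_bounded_of], with M = 3. *)
Definition weight_bump (z : plane R) : R :=
  if weight_index z is n.+1 then weight_level R n else 0.

Lemma weight_bump_ge0 z : 0 <= weight_bump z.
Proof. by rewrite /weight_bump; case: (weight_index z) => // n; exact/ltW/weight_level_gt0. Qed.

Lemma measurable_weight_bump : measurable_fun setT weight_bump.
Proof.
move=> _ B mB; rewrite setTI.
exact: (measurable_weight_index [set m | B (if m is n.+1 then weight_level R n else 0)]).
Qed.

Lemma weight_bump_box n z : box n z -> weight_bump z = weight_level R n.
Proof. by rewrite /weight_bump => /weight_index_box ->. Qed.

(** On each box the height cancels the same factor in the area, leaving a geometric series. *)
Lemma weight_bump_integrable : (\int[mu]_z (weight_bump z)%:E < +oo)%E.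
Proof.
have [c [C [c0 C0 hcC]]] := mu_weight_box.
have mb : measurable_fun setT (fun z => (weight_bump z)%:E).
  by apply/measurable_EFinP; exact: measurable_weight_bump.
have b0 z : (0 <= (weight_bump z)%:E)%E by rewrite lee_fin weight_bump_ge0.
have -> : (\int[mu]_z (weight_bump z)%:E =
    \int[mu]_(z in \bigcup_n box n) (weight_bump z)%:E)%E.
  rewrite [RHS]integral_mkcond; apply: eq_integral => z _; rewrite patchE.
  case: ifPn => // /negP h; rewrite /weight_bump.
  case E : (weight_index z) => [//|n]; case: h.
  by rewrite inE; exists n => //; exact: weight_indexS.
rewrite ge0_integral_bigcup//; last 3 first.
- by move=> n; exact: measurable_weight_box.
- exact: measurable_funTS.
- by move=> n m _ _ [z [bn bm]]; exact: weight_box_inj bn bm.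
have bound n : (\int[mu]_(z in box n) (weight_bump z)%:E <=
    (C / (2 ^ (n + 2))%:R)%:E)%E.
  have -> : (\int[mu]_(z in box n) (weight_bump z)%:E =
      \int[mu]_(z in box n) cst (weight_level R n)%:E z)%E.
    by apply: eq_integral => z /set_mem bz; rewrite (weight_bump_box bz).
  rewrite integral_cst//; last exact: measurable_weight_box.
  have /andP[_ h] := hcC n.
  apply: le_trans (lee_wpmul2l _ h) _.
    by rewrite lee_fin ltW// weight_level_gt0.
  rewrite -EFinM lee_fin natrX addn2 le_eqVlt; apply/orP; left; apply/eqP.
  have l0 : weight_level R n != 0 by rewrite gt_eqF// weight_level_gt0.
  by rewrite exprVn; field; rewrite l0 expf_neq0.
apply: (@le_lt_trans _ _ (\sum_(0 <= n <oo) (C / (2 ^ (n + 2))%:R)%:E)%E).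
  apply: lee_nneseries => n *; last exact: bound.
  by apply: integral_ge0 => z _; exact: b0.
by rewrite (cvg_lim _ (@cvg_geometric_eseries_half R C 1))// ltry.
Qed.

End weight_estimates.

(** * The required properties of the weight *)

Section weight_properties.
Context (R : realType) (p eta : R) (hp : 1 < p) (heta : -1 < eta).
Context (K : hilbertType R).
Hypothesis sepK : separable K.
Hypothesis K0 : exists x : K, x != 0.
Local Notation mu := (mu_eta heta).
Local Notation leb := (@plane_lebesgue R).
Local Notation box := (@weight_box R).
Local Notation H := (dsum K).
Local Notation W := (@weight R K).
Implicit Types (z : plane R) (x e : H).

Let p0 : 0 < p. Proof. exact: lt_trans hp. Qed.

Let ip0 : 0 < p^-1. Proof. by rewrite invr_gt0. Qed.

Let eigen_pow_ge1 s m : 0 <= s -> 1 <= weight_eigen R m `^ s.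
Proof.
move=> s0; have := ler_powR (ltW (weight_eigen_gt1 R m)) s0.
by rewrite powRr0.
Qed.

Let weight_A_ge z x : hnorm x <= hnorm (op_pow (W z) p^-1 x).
Proof.
rewrite op_pow_weight//; apply: sop_norm_ge1; first exact: weight_proj_orth.
by rewrite eigen_pow_ge1// ltW.
Qed.

Let weight_A_le z x :
  hnorm (op_pow (W z) p^-1 x) `^ p <= (3 + weight_bump z) * hnorm x `^ p.
Proof.
rewrite op_pow_weight//; set l := weight_eigen R _.
have l0 : 0 <= l by apply: le_trans (ltW (weight_eigen_gt1 R _)).
have h : hnorm (sop (weight_proj (weight_index z)) (l `^ p^-1) x) <= l `^ p^-1 * hnorm x.
  apply: sop_norm_le; first exact: weight_proj_orth.
    by rewrite powR_ge0 lexx.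
  by rewrite eigen_pow_ge1// ltW.
apply: (@le_trans _ _ ((l `^ p^-1 * hnorm x) `^ p)).
  by apply: ge0_ler_powR h; rewrite ?nnegrE ?mulr_ge0 ?powR_ge0 ?hnorm_ge0// ltW.
rewrite powRM ?powR_ge0 ?hnorm_ge0// -powRrM mulVf ?gt_eqF// powRr1//.
apply: ler_wpM2r; first exact: powR_ge0.
rewrite /l /weight_bump; case: (weight_index z) => [|n] /=; first by rewrite addr0.
by rewrite lerDr.
Qed.

Let weight_B_le z x : hnorm (op_pow (W z) (- p^-1) x) <= hnorm x.
Proof.
rewrite op_pow_weight//; rewrite -[leRHS]mul1r; apply: sop_norm_le => //.
  exact: weight_proj_orth.
rewrite powR_ge0/= powRN invf_le1; first by rewrite eigen_pow_ge1// ltW.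
by rewrite powR_gt0// (lt_trans ltr01)// weight_eigen_gt1.
Qed.

Lemma weight_is_weight : is_weight p heta W.
Proof.
have sepH := dsum_separable sepK.
split.
- apply: aeW => z.
  have l0 : 0 < weight_eigen R (weight_index z).
    by apply: lt_trans (weight_eigen_gt1 R _).
  have oQ := @weight_proj_orth R K (weight_index z).
  split; first exact: sop_bounded.
    by apply: sop_positive => //; exact: ltW.
  by apply: sop_invertible => //; rewrite gt_eqF.
- move=> e; apply: (wmeas_strongly sepH).
  by apply: (wmeas_weight (f := fun=> e)); apply: wmeas_simple; exact: simple_cst.
- move=> e.
  apply: (@le_lt_trans _ _ (\int[mu]_z ((3 + weight_bump z)%:E * (hnorm e `^ p)%:E))%E).
    apply: le_integral_nonmeasurable => z; first by rewrite lee_fin powR_ge0.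
    by rewrite -EFinM lee_fin weight_A_le.
  have mb := @measurable_weight_bump R.
  have b0 z := weight_bump_ge0 z.
  rewrite ge0_integralZr//; last 3 first.
  + by apply/measurable_EFinP; apply: measurable_funD.
  + by move=> z _; rewrite lee_fin addr_ge0.
  + by rewrite lee_fin powR_ge0.
  under eq_integral do rewrite EFinD.
  rewrite ge0_integralD//; last 2 first.
  + by move=> z _; rewrite lee_fin.
  + exact/measurable_EFinP.
  rewrite muleC; apply: lte_mul_pinfty; rewrite ?lee_fin ?powR_ge0//.
  rewrite lte_add_pinfty ?weight_bump_integrable//.
  by rewrite integral_cst//; apply: lte_mul_pinfty; rewrite ?lee_fin// mu_eta_lty.
- move=> e.
  apply: (@le_lt_trans _ _ (\int[mu]_z (cst (hnorm e `^ (p / (p - 1)))%:E z))%E).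
    apply: le_integral_nonmeasurable => z; first by rewrite lee_fin powR_ge0.
    rewrite lee_fin; apply: ge0_ler_powR; rewrite ?nnegrE ?hnorm_ge0//.
    by rewrite divr_ge0 ?subr_ge0// ltW.
  rewrite integral_cst//; apply: lte_mul_pinfty; rewrite ?lee_fin ?powR_ge0//.
  exact: mu_eta_lty.
Qed.

Lemma weight_bergman_bounded : bergman_bounded p heta W.
Proof.
apply: (@bergman_bounded_of _ _ _ hp heta _ (dsum_separable sepK) W 3 2^-1
  (@weight_bump R)) => //.
- move=> f mf; have := @wmeas_weight R K f (fun m => weight_eigen R m `^ (- p^-1)) mf.
  congr (wmeas _); apply/funext => z.
  by rewrite op_pow_weight.
- exact: weight_bump_ge0.
- exact: measurable_weight_bump.
- exact: weight_bump_integrable.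
- by rewrite invf_lt1// ltr1n.
- move=> z; rewrite /weight_bump; case E: (weight_index z) => [|n] bz.
    by rewrite eqxx in bz.
  by apply: (@weight_box_absq _ n); exact: weight_indexS.
Qed.

Let mu_box_gt0 n : (0 < mu (box n))%E.
Proof.
have [c [C [c0 C0 h]]] := mu_weight_box heta.
have /andP[h1 _] := h n; apply: lt_le_trans h1.
by rewrite lte_fin mulr_gt0// divr_gt0 ?halfX_gt0 ?weight_level_gt0.
Qed.

Let weight_on_box n z x : box n z ->
  W z x = (x.1, (weight_level R n)%:C *: x.2).
Proof.
move=> bz; rewrite /weight (weight_index_box bz) /=.
rewrite sopE; congr (_, _) => /=; first by rewrite subr0 scaler0 addr0.
by rewrite subrr add0r.
Qed.

(** At a point of the n-th box, (e, 0) forces c w <= 1 and (0, e) forces v_n <= C0 w, so v_n <= C0 /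
    c for every n. *)
Lemma weight_not_comparable : ~ scalar_comparable heta W.
Proof.
move=> [w [c [C0 [_ w0 c0 C00 [N [mN N0 hN]]]]]].
have [e e0] := K0.
have bound n : weight_level R n <= C0 / c.
  (* The box has positive measure, so it is not contained in the exceptional null set. *)
  have [z [bz zN]] : exists z, box n z /\ ~ N z.
    apply: contrapT => h; have := mu_box_gt0 n.
    apply/negP; rewrite -leNgt -N0; apply: le_measure; rewrite ?inE//.
      exact: measurable_weight_box.
    by move=> z bz; apply: contrapT => Nz; apply: h; exists z.
  have hz : forall x, (c * w z)%:C * hdot H x x <= hdot H (W z x) x
      <= (C0 * w z)%:C * hdot H x x.
    by apply: contrapT => h; apply: zN; exact: hN.
  have ee : 0 < hnorm e ^+ 2 by rewrite exprn_gt0// hnorm_gt0.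
  have oQ := @weight_proj_orth R K (weight_index z).
  have Wd (x : H) : hdot H (W z x) x =
      (hnorm x.1 ^+ 2 + weight_level R n * hnorm x.2 ^+ 2)%:C.
    rewrite /weight sop_dot// (weight_index_box bz) /= !dsum_hnormE /=.
    by rewrite subr0 subrr hnorm0 expr0n/= addr0 add0r.
  have /andP[+ _] := hz (e, 0).
  rewrite Wd hdotxx dsum_hnormE/= hnorm0 expr0n/= mulr0 addr0.
  rewrite -(rmorphM (real_complex R)) lecR ger_pMl// => cw.
  have /andP[_] := hz (0, e).
  rewrite Wd hdotxx dsum_hnormE/= hnorm0 expr0n/= !add0r.
  rewrite -(rmorphM (real_complex R)) lecR ler_pM2r// => vw.
  apply: le_trans vw _; rewrite ler_pM2l//.
  by rewrite -div1r ler_pdivlMr// mulrC.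
pose m := Num.truncn (C0 / c).
have := bound m; apply/negP; rewrite -ltNge.
apply: lt_le_trans (truncnS_gt _) _; rewrite -/m.
apply: (@le_trans _ _ (2 ^+ m.+1)).
  by rewrite -natrX ler_nat ltnW// ltn_expl.
by rewrite /weight_level ler_eXn2l ?ltr1n// ltnS; case: (m) => // k; rewrite leq_pmulr.
Qed.

(** Polar coordinates: as x > 0 and y >= 0, the angle is atan (y / x) in [0, pi/2[, and the radius
    is positive, which matters because the square omits the origin. *)
Let carleson0 n : box n `<=` @carleson_square R 0 1.
Proof.
move=> z bz; have dz := weight_box_disc bz.
move: bz => -[]; rewrite /= !in_itv/= => /andP[x0 x1] /andP[y0 y1].
pose x : R := z.1; pose y : R := z.2.
have xp : 0 < x by exact: lt_trans (halfX_gt0 R _) x0.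
pose t := atan (y / x); pose r := Num.sqrt (x ^+ 2 + y ^+ 2).
have s0 : 0 < x ^+ 2 + y ^+ 2 by rewrite ltr_pwDl ?sqr_ge0// exprn_gt0.
have r0 : 0 < r by rewrite sqrtr_gt0.
have r2 : r ^+ 2 = x ^+ 2 + y ^+ 2 by rewrite sqr_sqrtr// ltW.
have r1 : r < 1.
  rewrite -(@ltr_pXn2r _ 2)// ?nnegrE ?(ltW r0)// r2 expr1n; exact: dz.
have ct : cos t = x / r.
  rewrite /t cos_atan.
  have -> : 1 + (y / x) ^+ 2 = (r / x) ^+ 2.
    by rewrite !expr_div_n r2; field; rewrite gt_eqF.
  by rewrite sqrtr_sqr ger0_norm ?divr_ge0 ?ltW// invf_div.
have c0 : cos t != 0 by rewrite ct mulf_neq0 ?invr_neq0// gt_eqF.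
have st : sin t = y / r.
  have := atanK (y / x); rewrite -/t /tan ct => h.
  have -> : sin t = sin t / (x / r) * (x / r).
    by rewrite mulfVK// mulf_neq0 ?invr_neq0// gt_eqF.
  by rewrite h; field; rewrite !gt_eqF.
exists r, (cos t, sin t); split.
- by rewrite subrr r0 r1.
- exists t => //=; rewrite in_itv/= add0r mulr1; apply/andP; split.
    rewrite -(@atan0 R); apply: le_atan; rewrite divr_ge0// ltW//.
  apply: ltW; apply: lt_trans (atan_ltpi2 _) _.
  by have := pi_gt0 R; lra.
- rewrite /= ct st [LHS]surjective_pairing; congr (_, _);
  by rewrite mulrC mulfVK// gt_eqF.
Qed.

Let weight_level_unbounded (k s : R) : 0 < k -> 0 < s -> forall M : R,
  exists n, M <= k * (2^-1 ^+ n.+2 * weight_level R n `^ s).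
Proof.
move=> k0 s0 M.
(* The first condition gives n^2 s >= 2 n, so the exponent of 2 below is at least n - 2. The second
   gives M <= k n / 4 <= k 2^(n - 2). *)
have [n [n1 n2]] : exists n : nat, 2 / s <= n%:R /\ M * 4 / k <= n%:R.
  pose t := Num.max (2 / s) (M * 4 / k); exists (Num.truncn t).+1.
  have nt : t <= (Num.truncn t).+1%:R by apply: ltW; exact: truncnS_gt.
  by split; apply: le_trans nt; rewrite le_max lexx ?orbT.
exists n.
have two0 : (2 : R) != 0 by rewrite pnatr_eq0.
have -> : 2^-1 ^+ n.+2 * weight_level R n `^ s =
    2 `^ ((n ^ 2).+1%:R * s - (n + 2)%:R).
  rewrite powRD ?two0 ?implybT// powRrM powR_mulrn// powRN powR_mulrn//.
  by rewrite exprVn addn2 mulrC.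
have e1 : n%:R - 2 <= (n ^ 2).+1%:R * s - (n + 2)%:R.
  have : n%:R * 2 <= n%:R * (n%:R * s).
    by rewrite ler_wpM2l// -ler_pdivrMr.
  rewrite -[(n ^ 2).+1%:R]natr1 natrX natrD mulrDl mul1r expr2 -mulrA.
  by move: (n%:R * (n%:R * s)) => w; lra.
have two1 : (1 : R) <= 2 by rewrite ler1n.
apply: (@le_trans _ _ (k * 2 `^ (n%:R - 2))); last first.
  by rewrite ler_pM2l//; exact: ler_powR.
rewrite powRB ?two0 ?implybT// powR_mulrn// (@powR_mulrn _ 2 2)//.
have -> : M = k * ((M * 4 / k) / 4) by field; rewrite gt_eqF.
have -> : (2 : R) ^+ 2 = 4 by rewrite expr2; ring.
rewrite ler_pM2l// ler_pM2r ?invr_gt0//; apply: le_trans n2 _.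
by rewrite -natrX ler_nat ltnW// ltn_expl.
Qed.

Lemma weight_not_reverse_hoelder (eps C : R) : 0 < eps ->
  ~ reverse_holder p heta W eps C.
Proof.
move=> eps0 rh; have [e0 e00] := K0; pose e : H := (0, e0).
have ne : 0 < hnorm e.
  by apply: hnorm_gt0; apply: contra_neq e00 => -[].
pose S := @carleson_square R 0 1.
(* Length 1 is the whole circle; the corresponding square is the punctured disc. *)
have := rh 0 1 e _; rewrite ltr01 lexx => /(_ isT).
apply/negP; rewrite -ltNge /power_mean -/S.
have [c [C' [c0 C'0 hc]]] := mu_weight_box heta.
have muS0 : (0 < mu S)%E.
  apply: lt_le_trans (mu_box_gt0 0) _.
  rewrite /= /mu_eta [leLHS]integral_mkcond [leRHS]integral_mkcond.
  apply: le_integral_nonmeasurable => z.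
    by apply: erestrict_ge0 => {}z _; rewrite lee_fin bergman_density_ge0.
  rewrite !patchE; case: ifPn => [/set_mem[bz dz]|_].
    by rewrite mem_set//; split => //; exact: carleson0 bz.
  by case: ifPn => // _; rewrite lee_fin bergman_density_ge0.
have muSoo : (mu S < +oo)%E.
  apply: le_lt_trans (mu_eta_lty heta).
  rewrite /= /mu_eta [leLHS]integral_mkcond [leRHS]integral_mkcond.
  apply: le_integral_nonmeasurable => z.
    by apply: erestrict_ge0 => {}z _; rewrite lee_fin bergman_density_ge0.
  rewrite !patchE; case: ifPn => [/set_mem[_ dz]|_].
    by rewrite mem_set.
  by case: ifPn => // _; rewrite lee_fin bergman_density_ge0.
have kS : 0 < (fine (mu S))^-1 by rewrite invr_gt0 fine_gt0// muS0 muSoo.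
have fin_p : (\int[mu]_(z in S) (hnorm (op_pow (W z) p^-1 e) `^ p)%:E < +oo)%E.
  have [_ _ + _] := weight_is_weight => /(_ e); apply: le_lt_trans.
  rewrite [leLHS]integral_mkcond; apply: le_integral_nonmeasurable => z.
    by apply: erestrict_ge0 => {}z _; rewrite lee_fin powR_ge0.
  by rewrite patchE; case: ifPn => // _; rewrite lee_fin powR_ge0.
(* The contributions of single boxes are already unbounded, so the integral exceeds every M. *)
have inf_p : (\int[mu]_(z in S) (hnorm (op_pow (W z) p^-1 e) `^ (p + eps))%:E = +oo)%E.
  apply/eqyP => M M0.
  have [n hn] : exists n, M <= c * (2^-1 ^+ n.+2 / weight_level R n) *
      (weight_level R n `^ p^-1 * hnorm e) `^ (p + eps).
    have k0 : 0 < c * hnorm e `^ (p + eps) by rewrite mulr_gt0 ?powR_gt0.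
    have d0 : 0 < eps / p by rewrite divr_gt0.
    have [n hn] := weight_level_unbounded k0 d0 M; exists n.
    apply: le_trans hn _; rewrite le_eqVlt; apply/orP; left; apply/eqP.
    have v0 := weight_level_gt0 R n.
    rewrite powRM ?powR_ge0 ?hnorm_ge0// -powRrM.
    (* One factor v_n cancels against the area of the box and v_n^(eps/p) remains. *)
    have -> : p^-1 * (p + eps) = 1 + eps / p by field; rewrite gt_eqF.
    rewrite (@powRD _ _ 1 (eps / p)) ?(gt_eqF v0) ?implybT// powRr1 ?(ltW v0)//.
    by field; rewrite gt_eqF.
  apply: (@le_trans _ _ (\int[mu]_(z in box n)
      cst ((weight_level R n `^ p^-1 * hnorm e) `^ (p + eps))%:E z)%E).
    rewrite integral_cst; last exact: measurable_weight_box.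
    have /andP[h _] := hc n.
    apply: le_trans (lee_wpmul2l _ h); last by rewrite lee_fin powR_ge0.
    by rewrite -EFinM lee_fin mulrC.
  rewrite [leLHS]integral_mkcond [leRHS]integral_mkcond.
  apply: le_integral_nonmeasurable => z.
    by apply: erestrict_ge0 => {}z _; rewrite lee_fin powR_ge0.
  rewrite !patchE; case: ifPn => [/set_mem bz|_]; last first.
    by case: ifPn => // _; rewrite lee_fin powR_ge0.
  rewrite mem_set; last exact: carleson0 bz.
  rewrite op_pow_weight// (weight_index_box bz) sop_fix//= hnormZR.
  by rewrite ger0_norm ?powR_ge0.
rewrite inf_p gt0_muley ?lte_fin// poweRyr; last first.
  by rewrite invr_neq0// gt_eqF// addr_gt0.
have I0 : (0 <= \int[mu]_(z in S) (hnorm (op_pow (W z) p^-1 e) `^ p)%:E)%E.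
  by apply: integral_ge0 => z _; rewrite lee_fin powR_ge0.
by rewrite ltey_eq fin_numM// fin_num_poweR// fin_numM// ge0_fin_numE.
Qed.

(** For z in the box of index 1 and w in a rectangle with negative first coordinates, the two
    products send (e, 0) to (2 e, v_1 e) and (2 e, e). Hence the exceptional set contains a product
    of two sets of positive area. *)
Lemma weight_not_commuting : ~ commuting W.
Proof.
move=> [N [mN N0 hN]].
have [e e0] := K0.
pose B : set (plane R) := `](- 2^-1), 0[ `*` `[0, 2^-1].
have mB : measurable B by apply: measurableX; exact: measurable_itv.
have lebB : leb B = (4^-1)%:E.
  rewrite /plane_lebesgue/= product_measure1E; [|exact: measurable_itv|exact: measurable_itv].
  rewrite /= !lebesgue_measure_itv/= !lte_fin oppr_lt0 invr_gt0 ltr0n.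
  by rewrite -!EFinB -EFinM; congr EFin; field.
have Bdisc z : B z -> disc z.
  rewrite /disc /absq/= => -[]; rewrite /= !in_itv/=.
  by move: (z.1 : R) (z.2 : R) => x y /andP[? ?] /andP[? ?]; nra.
have Bidx z : B z -> weight_index z = 0%N.
  move=> -[]; rewrite /= !in_itv/= => /andP[_ xneg] _.
  apply: weight_index0 => n -[]; rewrite /= !in_itv/= => /andP[x0 _] _.
  by have := lt_trans (lt_trans (halfX_gt0 R _) x0) xneg; rewrite ltxx.
have sub z w : box 1 z -> B w -> N (z, w).
  move=> bz Bw; apply: hN => h.
  have := h (weight_box_disc bz) (Bdisc w Bw) (e, 0).
  have Wz : W z (e, 0) = (e, 0) by rewrite (weight_on_box _ bz) scaler0.
  (* The diagonal projection of (e, 0) is (e/2, e/2), and twice it is added to (e, 0). *)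
  have Ww : W w (e, 0) = (2%:C *: e, e).
    have E1 : e - 2^-1%:C *: (e + 0) + 3%:C *: (2^-1%:C *: (e + 0)) = 2%:C *: e.
      by rewrite addr0; apply: rdot_inj => e'; rewrite !(rdotDl, rdotNl, rdotZR); field.
    have E2 : 0 - 2^-1%:C *: (e + 0) + 3%:C *: (2^-1%:C *: (e + 0)) = e.
      by rewrite sub0r addr0; apply: rdot_inj => e'; rewrite !(rdotDl, rdotNl, rdotZR); field.
    by rewrite /weight (Bidx w Bw) /= sopE; congr (_, _); [exact: E1|exact: E2].
  rewrite /= Wz Ww (weight_on_box _ bz) => -[/eqP].
  rewrite -subr_eq0 -[X in _ - X]scale1r -scalerBl scaler_eq0 (negbTE e0) orbF.
  rewrite -(rmorph1 (real_complex R)) -(rmorphB (real_complex R)) => /eqP/complexI/eqP.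
  by rewrite subr_eq0 gt_eqF// (lt_le_trans _ (weight_level_ge2 R 1))// ltr1n.
have : (0 < (leb \x leb) N)%E.
  apply: (@lt_le_trans _ _ (leb B * leb (box 1))%E).
    rewrite lebB lebesgue_weight_box -EFinM lte_fin mulr_gt0// divr_gt0 ?halfX_gt0//.
    exact: weight_level_gt0.
  rewrite /product_measure1.
  have -> : (leb B * leb (box 1) = \int[leb]_(z in box 1) cst (leb B) z)%E.
    by rewrite integral_cst//; exact: measurable_weight_box.
  (* The product measure integrates the areas of the sections of [N], and each section over the box
     contains [B]. *)
  rewrite integral_mkcond; apply: le_integral_nonmeasurable => z.
    by apply: erestrict_ge0.
  rewrite patchE; case: ifPn => [/set_mem bz /=|_]; last exact: measure_ge0.
  apply: le_measure; rewrite ?inE//; first exact: measurable_xsection.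
  by move=> w Bw; rewrite /xsection/= inE; exact: sub.
by rewrite N0 ltxx.
Qed.

End weight_properties.

Theorem proposition5p3 (R : realType) (p eta : R) (hp : 1 < p)
    (heta : -1 < eta) (K : hilbertType R) (hKsep : separable K)
    (hK0 : exists x : K, x != 0) :
  exists W : plane R -> dsum K -> dsum K,
    [/\ is_weight p heta W,
        ~ commuting W,
        ~ scalar_comparable heta W,
        bergman_bounded p heta W &
        ~ exists eps C : R, 0 < eps /\ reverse_holder p heta W eps C].
Proof.
exists (@weight R K); split.
- exact: weight_is_weight.
- exact: weight_not_commuting.
- exact: weight_not_comparable.
- exact: weight_bergman_bounded.
- by move=> [eps [C [eps0]]]; exact: weight_not_reverse_hoelder.
Qed.
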